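(* Let $\{Y(t):t\in[0,1]\}$ be the LMSM with Hurst function $H(\cdot)$, where $H(\cdot)$ satisfies $|H(t_1)-H(t_2)|\le c_H|t_1-t_2|^{\rho_H}$ for all $t_1,t_2\in[0,1]$, for some constant $c_H$ and some $\rho_H$ with $1\ge\rho_H>\sup_{t\in[0,1]}H(t)$. Let $\beta\in(0,1/4]$ be a fixed real number and $L\ge2$ an integer with $L>\frac2\beta+1$. Let $N_0=\min\{N\in\mathbb N:0<9(L+1)N^{-1}(\log N)^2\le1\}$, and for all $N\ge N_0$ let $$\theta_N=\kappa_0(\log N)^{-1}+4(L+1)N^{-1}(\log N)^2,\qquad \kappa_0=2^{-1}(L+1)N_0^{-1}(\log N_0)^2.$$ Let $b$ be a fixed real number such that $$0<b<\frac{\rho_H}{1+\rho_H}.$$ Then the estimation error $\|\widetilde H_{N,\theta_N}^\beta-H\|_b^{\text{Hölder}}$ vanishes almost surely at a logarithmic rate when $N\to+\infty$; that is, there exists $\kappa>0$ such that, almost surely, $$\|\widetilde H_{N,\theta_N}^\beta-H\|_b^{\text{Hölder}}=\mathcal O\big((\log N)^{-\kappa}\big)\quad\text{as }N\to+\infty.$$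
   Context: Setting: $\alpha\in(1,2)$ is fixed and $(\Omega,\mathcal F,\mathbb P)$ is a probability space carrying an independently scattered symmetric $\alpha$-stable ($S\alpha S$) random measure $Z_\alpha(ds)$ on $\mathbb R$ with Lebesgue control measure: for $f\in L^\alpha(\mathbb R)$, $\int_{\mathbb R}f(s)Z_\alpha(ds)$ is the real $S\alpha S$ random variable with characteristic function $\xi\mapsto\exp(-|\sigma\xi|^\alpha)$, where $\sigma=\|f\|_{L^\alpha(\mathbb R)}$, and integrals of functions with (a.e.) disjoint supports are independent. For $x,\kappa\in\mathbb R$, $(x)_+^\kappa=x^\kappa$ if $x>0$ and $0$ otherwise. For $(u,v)\in[0,1]\times(1/\alpha,1)$, $$X(u,v)=\int_{\mathbb R}\{(u-s)_+^{v-1/\alpha}-(-s)_+^{v-1/\alpha}\}Z_\alpha(ds),$$ identified with its version with continuous sample paths. The Hurst function $H:[0,1]\to(1/\alpha,1)$ takes values in a compact subinterval of $(1/\alpha,1)$. The Linear Multifractional Stable Motion (LMSM) with Hurst function $H$ is $Y(t)=X(t,H(t))$, $t\in[0,1]$. Notation: $\log$ is the natural logarithm, $\log_2$ the logarithm to base 2, $\lambda$ Lebesgue measure, $[\cdot]$ the integer part. For $l\in\{0,\dots,L\}$, $a_l=(-1)^{L-l}\binom{L}{l}$. For $N\ge L$ and $k\in\{0,\dots,N-L\}$, $d_{N,k}=\sum_{l=0}^L a_l Y((k+l)/N)$. For a compact interval $I\subseteq[0,1]$ with non-empty interior and $N\ge(L+1)\lambda(I)^{-1}$, $\nu_N(I)=\{k\in\{0,\dots,N-L\}:k/N\in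 I\}$, $|\nu_N(I)|$ is its cardinality, $V_N^\beta(I)=|\nu_N(I)|^{-1}\sum_{k\in\nu_N(I)}|d_{N,k}|^\beta$. For $x\ge0$, $\mathcal T_\beta(x)=\min\{2^\beta,\max\{x,2^{\beta/2}\}\}$, and $\widehat H_N^\beta(I)=\beta^{-1}\log_2\big(\mathcal T_\beta(V_N^\beta(I)/V_{2N}^\beta(I))\big)$. Estimator of $H(\cdot)$: for $N\ge N_0$ and $n\in\{0,\dots,[\theta_N^{-1}]-1\}$, $\mathcal I_{N,n}=[n\theta_N,(n+1)\theta_N]$ if $n<[\theta_N^{-1}]-1$, and $\mathcal I_{N,[\theta_N^{-1}]-1}=[([\theta_N^{-1}]-1)\theta_N,1]$. Then $\widetilde H^\beta_{N,\theta_N}(t)=\widehat H_N^\beta(\mathcal I_{N,[\theta_N^{-1}]-1})$ for $t\in\mathcal I_{N,[\theta_N^{-1}]-1}$, and for $n\in\{0,\dots,[\theta_N^{-1}]-2\}$ and $t\in\mathcal I_{N,n}$, $$\widetilde H^\beta_{N,\theta_N}(t)=\big(1-\theta_N^{-1}(t-n\theta_N)\big)\widehat H_N^\beta(\mathcal I_{N,n})+\theta_N^{-1}(t-n\theta_N)\widehat H_N^\beta(\mathcal I_{N,n+1}).$$ Norms: $\|f\|_\infty=\sup_{t\in[0,1]}|f(t)|$ and, for $b\in(0,1]$, $\|f\|_b^{\text{Hölder}}=\|f\|_\infty+\sup_{0\le t_1<t_2\le1}\frac{|f(t_1)-f(t_2)|}{|t_1-t_2|^b}$. *)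

(* Defs.v *)
From HB Require Import structures.
From mathcomp Require Import all_boot all_order all_algebra.
From mathcomp Require Import all_classical all_reals all_analysis.
Set Implicit Arguments.
Unset Strict Implicit.
Unset Printing Implicit Defensive.
Import Order.TTheory GRing.Theory Num.Theory.
Import numFieldNormedType.Exports.
Local Open Scope classical_set_scope.
Local Open Scope ring_scope.

(* Mutual independence of a finite family; the product rule for subfamilies is
   obtained by taking some of the [B i] equal to [setT]. *)
Definition mutually_independent d (T : measurableType d) (R : realType)
    (P : probability T R) (n : nat) (X : 'I_n -> T -> R) : Prop :=
  forall B : 'I_n -> set R, (forall i, measurable (B i)) ->
    P (\bigcap_(i in [set: 'I_n]) (X i @^-1` B i)) =
    (\prod_(i < n) P (X i @^-1` B i))%E.

(* [X] is a real random variable with characteristic function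
   [xi |-> exp (- |sigma * xi| ^ alpha)].  As this function is real-valued, it
   is stated through the real and imaginary parts of [E (exp (i * xi * X))]. *)
Definition sas_law d (T : measurableType d) (R : realType)
    (P : probability T R) (alpha sigma : R) (X : T -> R) : Prop :=
  measurable_fun setT X /\
  forall xi : R,
    ('E_P[(fun w => cos (xi * X w))] =
       (expR (- (`|sigma * xi| `^ alpha)))%:E)%E /\
    ('E_P[(fun w => sin (xi * X w))] = 0)%E.

(* Independently scattered symmetric alpha-stable random measure on the real
   line with Lebesgue control measure, defined on the Borel sets of finite
   Lebesgue measure; the values of [Z] on other sets are irrelevant. *)
Record sas_random_measure d (T : measurableType d) (R : realType)
    (P : probability T R) (alpha : R) (Z : set R -> T -> R) : Prop := {
  sas_rm_law : forall A : set R, measurable A ->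
    (lebesgue_measure A < +oo)%E ->
    sas_law P alpha (fine (lebesgue_measure A) `^ alpha^-1) (Z A) ;
  sas_rm_indep : forall (n : nat) (A : 'I_n -> set R),
    (forall i, measurable (A i)) ->
    (forall i, (lebesgue_measure (A i) < +oo)%E) ->
    (forall i j, i != j -> A i `&` A j = set0) ->
    mutually_independent P (fun i => Z (A i)) ;
  sas_rm_sigma_additive : forall A : nat -> set R,
    (forall i, measurable (A i)) ->
    trivIset setT A ->
    (lebesgue_measure (\bigcup_i A i) < +oo)%E ->
    {ae P, forall w,
      (fun n => \sum_(i < n) Z (A i) w) @ \oo --> Z (\bigcup_i A i) w}
}.

Definition Lalpha (R : realType) (alpha : R) : {pred R -> R} :=
  Lfun (@lebesgue_measure R) alpha%:E.

Definition Lalpha_norm (R : realType) (alpha : R) (f : R -> R) : R :=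
  fine ('N[@lebesgue_measure R]_(alpha%:E) [EFin \o f])%E.

(* [I f] is the stochastic integral of [f] with respect to [Z], for [f] in
   L^alpha.  The first three clauses determine [I f] up to almost sure
   equality: [I] is linear, agrees with [Z] on indicators, and the scale of
   [I f - I g] is the L^alpha norm of [f - g]. *)
Record sas_integral d (T : measurableType d) (R : realType)
    (P : probability T R) (alpha : R) (Z : set R -> T -> R)
    (I : (R -> R) -> T -> R) : Prop := {
  sas_int_indic : forall A : set R, measurable A ->
    (lebesgue_measure A < +oo)%E ->
    {ae P, forall w, I (\1_A) w = Z A w} ;
  sas_int_linear : forall (a : R) (f g : R -> R),
    f \in Lalpha alpha -> g \in Lalpha alpha ->
    {ae P, forall w, I (fun s => a * f s + g s) w = a * I f w + I g w} ;
  sas_int_law : forall f : R -> R, f \in Lalpha alpha ->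
    sas_law P alpha (Lalpha_norm alpha f) (I f) ;
  sas_int_indep : forall (n : nat) (f : 'I_n -> R -> R),
    (forall i, f i \in Lalpha alpha) ->
    (forall i j, i != j ->
      {ae @lebesgue_measure R, forall s, f i s * f j s = 0}) ->
    mutually_independent P (fun i => I (f i))
}.

Definition pos_pow (R : realType) (x kappa : R) : R :=
  if 0 < x then x `^ kappa else 0.

Definition lmsm_kernel (R : realType) (alpha u v : R) (s : R) : R :=
  pos_pow (u - s) (v - alpha^-1) - pos_pow (- s) (v - alpha^-1).

(* The field [(u, v) |-> X(u, v)], in a version with continuous sample paths;
   only its values on [0, 1] x (1/alpha, 1) matter. *)
Record lmsm_field d (T : measurableType d) (R : realType)
    (P : probability T R) (alpha : R) (I : (R -> R) -> T -> R)
    (X : R -> R -> T -> R) : Prop := {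
  lmsm_field_measurable : forall u v : R,
    u \in `[0, 1] -> v \in `]alpha^-1, 1[ -> measurable_fun setT (X u v) ;
  lmsm_field_integral : forall u v : R,
    u \in `[0, 1] -> v \in `]alpha^-1, 1[ ->
    {ae P, forall w, X u v w = I (lmsm_kernel alpha u v) w} ;
  lmsm_field_continuous : forall w : T,
    {within `[0%R, 1%R]%classic `*` `]alpha^-1%R, 1%R[%classic,
      continuous (fun uv : R * R => X uv.1 uv.2 w)}
}.

Definition lmsm (T : Type) (R : realType) (X : R -> R -> T -> R) (H : R -> R)
    (t : R) : T -> R := X t (H t).

(* The statistics below are functions of one sample path [y] on [0, 1]. *)

Definition gen_increment (R : realType) (L : nat) (y : R -> R) (N k : nat) : R :=
  \sum_(l < L.+1)
    (-1) ^+ (L - l) * 'C(L, l)%:R * y ((k + l)%:R / N%:R).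

Definition nu (R : realType) (L N : nat) (J : interval R)
    : {set 'I_(N - L).+1} :=
  [set k : 'I_(N - L).+1 | (k%:R / N%:R : R) \in J].

Definition power_variation (R : realType) (L : nat) (beta : R) (y : R -> R)
    (N : nat) (J : interval R) : R :=
  (#|nu L N J|%:R)^-1 *
  \sum_(k in nu L N J) `|gen_increment L y N k| `^ beta.

Definition log2 (R : realType) (x : R) : R := ln x / ln 2.

Definition truncate (R : realType) (beta x : R) : R :=
  Num.min (2 `^ beta) (Num.max x (2 `^ (beta / 2))).

Definition hurst_est (R : realType) (L : nat) (beta : R) (y : R -> R)
    (N : nat) (J : interval R) : R :=
  beta^-1 * log2 (truncate beta
    (power_variation L beta y N J / power_variation L beta y (2 * N) J)).

(* [(L + 1) * N^-1 * (log N)^2]; it is [0] at [N = 0] and [N = 1]. *)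
Definition Llog2N (R : realType) (L N : nat) : R :=
  L.+1%:R * N%:R^-1 * (ln N%:R) ^+ 2.

Definition N0_cond (R : realType) (L N : nat) : bool :=
  0 < 9 * Llog2N R L N <= 1.

(* The least integer satisfying [N0_cond] (the default value 0 is never used,
   since [N0_cond] holds for all large [N]). *)
Definition N0 (R : realType) (L : nat) : nat :=
  xget 0%N [set N : nat | N0_cond R L N /\
                          forall M : nat, N0_cond R L M -> (N <= M)%N].

Definition kappa0 (R : realType) (L : nat) : R :=
  2^-1 * Llog2N R L (N0 R L).

Definition theta (R : realType) (L N : nat) : R :=
  kappa0 R L * (ln N%:R)^-1 + 4 * Llog2N R L N.

Definition ncells (R : realType) (th : R) : nat := Num.truncn (th^-1).

Definition cell (R : realType) (th : R) (n : nat) : interval R :=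
  if (n < (ncells th).-1)%N then `[n%:R * th, n.+1%:R * th]
  else `[n%:R * th, 1].

(* Consecutive cells share an endpoint, where the formulas of both cells
   agree; so for [t] before the last cell one may use the formula of the cell
   of index [t / th] rounded down. *)
Definition hurst_est_fun (R : realType) (L : nat) (beta : R) (y : R -> R)
    (N : nat) (th : R) (t : R) : R :=
  let last := (ncells th).-1 in
  let n := Num.truncn (t / th) in
  let est m := hurst_est L beta y N (cell th m) in
  if last%:R * th <= t then est last
  else (1 - th^-1 * (t - n%:R * th)) * est n +
       th^-1 * (t - n%:R * th) * est n.+1.

(* Suprema are taken in the extended reals, so that an infinite norm really is
   [+oo]. *)
Definition sup_norm (R : realType) (f : R -> R) : \bar R :=
  ereal_sup [set (`|f t|)%:E | t in `[0, 1]%classic].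

Definition hoelder_norm (R : realType) (b : R) (f : R -> R) : \bar R :=
  (sup_norm f +
   ereal_sup [set x : \bar R | exists t1 t2 : R,
     [/\ (0 <= t1)%R, (t1 < t2)%R, (t2 <= 1)%R &
      x = (`|f t1 - f t2| / `|t1 - t2| `^ b)%:E]])%E.

(* Main.v *)
Require Import Defs.
From HB Require Import structures.
From mathcomp Require Import all_boot all_order all_algebra.
From mathcomp Require Import all_classical all_reals all_analysis.
From mathcomp Require Import measurable_realfun ring lra zify.
Import Order.TTheory GRing.Theory Num.Theory.
Import numFieldNormedType.Exports.
Local Open Scope classical_set_scope.
Local Open Scope ring_scope.
Set Implicit Arguments.
Unset Strict Implicit.
Unset Printing Implicit Defensive.

(** Freeze the Hurst parameter of the increment d_(N,k) at a value v close to
    H(k/N).  The frozen increment is a stable integral whose kernel is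
    N^(-(v - 1/alpha)) Phi_v(N s - k), where Phi_v is the L-th difference of
    x_+^(v - 1/alpha); its scale is therefore N^(-v) |Phi_v|, and by
    [sas_moment] its beta-th absolute moment is an explicit constant times the
    power beta of that scale.  Replacing N by 2N multiplies this moment by
    2^(-beta v), so the ratio of the empirical means of |d|^beta at the levels
    N and 2N over a short interval is close to 2^(beta H), which is what the
    estimator inverts.  Four facts turn this heuristic into the theorem.

    Freezing costs little ([perturbation]).  The path of X in the direction v
    is only known to be continuous, so X(u, H) - X(u, v) cannot be bounded by a
    modulus of continuity.  The kernel, however, is analytic in v: up to a
    function of norm O(delta^(m+1)) it is the Lagrange interpolation of its
    values at the nodes v + i delta ([kernel_interp]), with coefficients that
    differ from (1, 0, ..., 0) by O(|H - v| / delta).  With delta = N^(-eps)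
    and m large the remainder is almost surely negligible by Markov and
    Borel-Cantelli, and since the path is bounded on a compact set, the freezing
    error is O(N^(-(rho - eps))).  It is negligible with respect to the typical
    size N^(-H) because rho > sup H.

    The power sums concentrate ([fluctuation]).  As 4 beta <= 1 < alpha, fourth
    moments of |I f|^beta are available.  Each kernel is cut at M ~ N^(1/4)
    sampling steps from its singularities: the inner parts of increments at
    distance at least L + M have disjoint supports, hence are independent, and
    the outer parts are small because an L-th difference decays fast; this is
    where L > 2/beta + 1 is used.  [no_dominant_term] bounds each term by
    N^(e0 - 1) times the mean of the sum over a cell, so that Markov's
    inequality and Borel-Cantelli give the relative error N^(-e0) over all cells
    at once ([level_concentration]).

    The means obey the scaling law ([mean_sum_double], [ratio_bound]): at level
    2N the increments 2k and 2k+1 are frozen at the value used for the increment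
    k at level N, so that the two means are compared term by term, up to a
    bounded number of boundary terms.  Hence the estimator on a cell differs
    from H on that cell by O(theta^rho) ([estimator_rate]).

    A piecewise linear function with nodes theta apart, whose nodal values are
    within D of a rho-Hoelder function, is within O((D + theta^rho) theta^(-b))
    of it in the b-Hoelder norm ([hoelder_norm_interpolant]).  With
    D = O(theta^rho) and theta of order 1 / log N this yields the rate
    (log N)^(-(rho - b)). *)

(** * Lebesgue integrals of powers *)

(** The left-hand side is a measure in [A] that has the right value on
    half-open intervals, and these determine Lebesgue measure. *)
Lemma lebesgue_affine (R : realType) (c x0 : R) (A : set R) : 0 < c ->
  measurable A ->
  (c%:E * (@lebesgue_measure R) ((fun x => (c * x + x0)%R) @^-1` A))%E = lebesgue_measure A.
Proof.
move=> c0 mA.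
have mphi : measurable_fun setT ((fun x => c * x + x0) : measurableTypeR R -> measurableTypeR R).
  by apply: measurable_funD => //; apply: measurable_funM.
pose phi : {mfun measurableTypeR R >-> measurableTypeR R} :=
  HB.pack ((fun x => c * x + x0) : measurableTypeR R -> measurableTypeR R) (isMeasurableFun.Build _ _ _ _ _ mphi).
pose cn := NngNum (ltW c0).
pose mu' := mscale cn (pushforward (@lebesgue_measure R) phi).
suff -> : lebesgue_measure A = mu' mphi A by [].
apply: (@lebesgue_measure_unique R (mu' mphi)) => //= _ [[a b]] _ <-.
rewrite /mu' /mscale/= /pushforward.
have -> : (fun x => c * x + x0) @^-1` `]a, b]%classic = `](a - x0) / c, (b - x0) / c]%classic.
  apply/seteqP; split => x /=; rewrite !in_itv/= => /andP[].
    by rewrite ltr_pdivrMr// ler_pdivlMr// ltrBlDr lerBrDr mulrC => -> ->.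
  by rewrite ltr_pdivrMr// ler_pdivlMr// ltrBlDr lerBrDr mulrC => -> ->.
rewrite !lebesgue_measure_itv/= !lte_fin ltr_pM2r ?invr_gt0// ltrD2r.
case: ifPn => ab; last by rewrite mule0.
rewrite -!EFinB -EFinM; congr (_%:E).
by field; rewrite gt_eqF.
Qed.

Lemma integral_affine (R : realType) (c x0 : R) (f : R -> \bar R) : 0 < c ->
  measurable_fun [set: R] f -> (forall x, (0 <= f x)%E) ->
  (c%:E * \int[@lebesgue_measure R]_x f (c * x + x0)%R)%E =
  (\int[@lebesgue_measure R]_x f x)%E.
Proof.
move=> c0 mf f0.
have mphi : measurable_fun setT ((fun x => c * x + x0) : measurableTypeR R -> measurableTypeR R).
  by apply: measurable_funD => //; apply: measurable_funM.
pose phi : {mfun measurableTypeR R >-> measurableTypeR R} :=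
  HB.pack ((fun x => c * x + x0) : measurableTypeR R -> measurableTypeR R) (isMeasurableFun.Build _ _ _ _ _ mphi).
pose cn := NngNum (ltW c0).
pose mu' := mscale cn (pushforward (@lebesgue_measure R) phi).
transitivity (\int[mu' mphi]_x f x)%E; last first.
  apply: eq_measure_integral => /= A mA _; rewrite /mu' /mscale/= /pushforward.
  by rewrite lebesgue_affine.
rewrite ge0_integral_mscale//= ge0_integral_pushforward//=.
Qed.

Lemma integral_powR_tail (R : realType) (r : R) : 1 < r ->
  (\int[@lebesgue_measure R]_(x in `[1%R, +oo[) (x `^ (- r))%:E = ((r - 1)^-1)%:E)%E.
Proof.
move=> r1.
pose F (x : R) : R := - (r - 1)^-1 * x `^ (1 - r).
have r10 : r - 1 != 0 by rewrite gt_eqF// subr_gt0.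
have dF (x : R) : 0 < x -> derivable F x 1 /\ derive1 F x = x `^ (- r).
  move=> x0; split.
    apply: derivableM; first exact: derivable_cst.
    by apply: derivable_powR; rewrite in_itv/= x0.
  rewrite derive1Ml; last by apply: derivable_powR; rewrite in_itv/= x0.
  rewrite powR_derive1 ?in_itv/= ?x0// addrAC subrr add0r.
  by rewrite mulrA mulNr -mulrN opprB mulVf// mul1r.
have cF (x : R) : 0 < x -> {for x, continuous F}.
  by move=> /dF[/derivable1_diffP/differentiable_continuous].
rewrite (@ge0_continuous_FTC2y _ _ F _ 0).
- by rewrite /F powR1 mulr1 sub0e -EFinN opprK.
- by move=> x _; exact: powR_ge0.
- apply: continuous_in_subspaceT => x; rewrite inE/= in_itv/= andbT => x1.
  apply/differentiable_continuous/derivable1_diffP.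
  by apply: derivable_powR; rewrite in_itv/= (lt_le_trans ltr01 x1).
- rewrite /F -(mulr0 (- (r - 1)^-1)).
  apply: cvgM; first exact: cvg_cst.
  apply/cvgr0Pnorm_lt => e e0.
  near=> x.
  have x0 : 0 < x by near: x; exact: nbhs_pinfty_gt.
  rewrite ger0_norm ?powR_ge0// -opprB powRN -[ltRHS]invrK ltf_pV2 ?posrE ?powR_gt0 ?invr_gt0//.
  have -> : e^-1 = (e^-1 `^ (r - 1)^-1) `^ (r - 1).
    by rewrite -powRrM mulVf// powRr1// invr_ge0 ltW.
  have xe : e^-1 `^ (r - 1)^-1 < x by near: x; exact: nbhs_pinfty_gt.
  by apply: gt0_ltr_powR; rewrite ?subr_gt0// nnegrE ?powR_ge0// ltW.
- by move=> x x1; have [] := dF _ (lt_trans ltr01 x1).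
- by apply: cvg_at_right_filter; exact: cF.
- by move=> x; rewrite in_itv/= andbT => x1; have [] := dF _ (lt_trans ltr01 x1).
Unshelve. all: by end_near. Qed.

(** Monotone convergence from the intervals [1/n, 1] avoids the singularity at 0
    when r < 1. *)
Lemma integral_powR_near0 (R : realType) (r : R) : 0 < r ->
  (\int[@lebesgue_measure R]_(x in `]0%R, 1%R]) (x `^ (r - 1))%:E <= (r^-1)%:E)%E.
Proof.
move=> r0.
pose F (x : R) : R := r^-1 * x `^ r.
have dF (x : R) : 0 < x -> derivable F x 1 /\ derive1 F x = x `^ (r - 1).
  move=> x0; split.
    apply: derivableM; first exact: derivable_cst.
    by apply: derivable_powR; rewrite in_itv/= x0.
  rewrite derive1Ml; last by apply: derivable_powR; rewrite in_itv/= x0.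
  by rewrite powR_derive1 ?in_itv/= ?x0// mulrA mulVf ?gt_eqF// mul1r.
have cF (x : R) : 0 < x -> {for x, continuous F}.
  by move=> /dF[/derivable1_diffP/differentiable_continuous].
have cf (x : R) : 0 < x -> {for x, continuous (fun x => x `^ (r - 1))}.
  move=> x0; apply/differentiable_continuous/derivable1_diffP.
  by apply: derivable_powR; rewrite in_itv/= x0.
pose G (n : nat) : set R := `[n.+2%:R^-1, 1]%classic.
have -> : `]0%R, 1%R]%classic = \bigcup_n G n.
  apply/seteqP; split => x /=.
    rewrite in_itv/= => /andP[x0 x1]; exists (Num.truncn x^-1) => //.
    rewrite /G/= in_itv/= x1 andbT -[leRHS]invrK lef_pV2 ?posrE ?invr_gt0//.
    by rewrite (le_trans (ltW (truncnS_gt _)))// ler_nat.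
  by move=> [n _]; rewrite /G/= !in_itv/= => /andP[nx ->]; rewrite (lt_le_trans _ nx).
have nG : nondecreasing_seq G.
  move=> m n mn; rewrite subsetEset => x /=; rewrite /G/= !in_itv/= => /andP[mx ->].
  by rewrite andbT (le_trans _ mx)// lef_pV2 ?posrE// ler_nat !ltnS.
have mf : measurable_fun setT (fun x : R => (x `^ (r - 1))%:E).
  by apply/measurable_EFinP; exact: measurable_powR.
have mG (i : nat) : measurable (G i : set (measurableTypeR R)) by exact: measurable_itv.
have mfG (i : nat) : measurable_fun (G i : set (measurableTypeR R)) (fun x : R => (x `^ (r - 1))%:E).
  exact: measurable_funS mf.
have f0 (i : nat) (x : R) : G i x -> (0 <= (x `^ (r - 1))%:E)%E by rewrite lee_fin powR_ge0.
have /cvg_lim <- // := @ge0_nondecreasing_set_cvg_integral _ (measurableTypeR R) R G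
  (fun x : R => (x `^ (r - 1))%:E) (@lebesgue_measure R) nG mG mfG f0.
apply: lime_le.
  apply: ereal_nondecreasing_is_cvgn.
  exact: (@ge0_nondecreasing_set_nondecreasing_integral _ (measurableTypeR R) R G
    (fun x : R => (x `^ (r - 1))%:E) (@lebesgue_measure R) nG mG mfG f0).
apply: nearW => n.
rewrite (@continuous_FTC2 _ _ F).
- by rewrite /F powR1 mulr1 -EFinB lee_fin gerBl mulr_ge0 ?powR_ge0 ?invr_ge0 ?ltW.
- by rewrite invf_lt1// ltr1n.
- apply: continuous_in_subspaceT => x; rewrite inE/= in_itv/= => /andP[x1 _].
  by apply: cf; apply: lt_le_trans x1; rewrite invr_gt0.
- split.
  + by move=> x /=; rewrite in_itv/= => /andP[x1 _]; apply: (dF _ _).1; apply: lt_trans x1; rewrite invr_gt0.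
  + by apply: cvg_at_right_filter; apply: cF; rewrite invr_gt0.
  + by apply: cvg_at_left_filter; apply: cF.
- by move=> x /=; rewrite in_itv/= => /andP[x1 _]; apply: (dF _ _).2; apply: lt_trans x1; rewrite invr_gt0.
Qed.

(** * Fractional moments of symmetric stable variables *)

Lemma measurable_pos_pow (R : realType) (k : R) :
  measurable_fun [set: R] (fun x : R => pos_pow x k).
Proof.
rewrite /pos_pow; apply: measurable_fun_ifT => //.
exact: measurable_fun_ltr.
Qed.

Lemma gt0_powRD (R : realType) (x r s : R) : 0 < x -> x `^ (r + s) = x `^ r * x `^ s.
Proof. by move=> x0; rewrite powRD// (gt_eqF x0) implybT. Qed.

Lemma pos_pow_ge0 (R : realType) (x k : R) : 0 <= pos_pow x k.
Proof. by rewrite /pos_pow; case: ifP => // _; exact: powR_ge0. Qed.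

Lemma pos_powM (R : realType) (a x k : R) : 0 < a ->
  pos_pow (a * x) k = a `^ k * pos_pow x k.
Proof.
move=> a0; rewrite /pos_pow pmulr_rgt0//; case: ifP => x0; last by rewrite mulr0.
by rewrite powRM// ltW.
Qed.

Section radial.
Context {R : realType}.
Local Notation leb := (@lebesgue_measure R).

(** Integral of [g] against x^(-1-gamma) dx on the positive half-line.  This
    weight is homogeneous, so that a dilation of [g] by [a] multiplies the
    integral by a^gamma: this is how a power |x|^gamma is recovered from bounded
    functions of x. *)
Definition radial (gamma : R) (g : R -> R) : \bar R :=
  (\int[leb]_x (g x * pos_pow x (- 1 - gamma))%:E)%E.

Let mrad gamma (g : R -> R) : measurable_fun [set: R] g ->
  measurable_fun [set: R] (fun x => (g x * pos_pow x (- 1 - gamma))%:E).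
Proof.
move=> mg; apply/measurable_EFinP; apply: measurable_funM => //.
exact: measurable_pos_pow.
Qed.

Lemma radial_scale (gamma a : R) (g : R -> R) : 0 < a ->
  measurable_fun [set: R] g -> (forall x, 0 <= g x) ->
  radial gamma (fun x => g (a * x)) = ((a `^ gamma)%:E * radial gamma g)%E.
Proof.
move=> a0 mg g0; rewrite /radial.
rewrite -(@integral_affine R a 0 (fun x => (g x * pos_pow x (-1 - gamma))%:E) a0); last 2 first.
- exact: mrad.
- by move=> x; rewrite lee_fin mulr_ge0 ?pos_pow_ge0.
rewrite muleA -EFinM -ge0_integralZl_EFin//; last 3 first.
- by move=> x _; rewrite lee_fin mulr_ge0 ?pos_pow_ge0.
- have ma : measurable_fun [set: R] (fun x : R => a * x + 0).
    by apply: measurable_funD => //; exact: measurable_funM.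
  apply/measurable_EFinP; apply: measurable_funM; first exact: (measurableT_comp mg ma).
  have mp : measurable_fun [set: R] ((fun x => pos_pow x (- 1 - gamma)) \o (fun x : R => a * x + 0)).
    by apply: measurableT_comp ma; exact: measurable_pos_pow.
  exact: mp.
- by rewrite mulr_ge0 ?powR_ge0 ?ltW.
have E : a `^ gamma * a * a `^ (- 1 - gamma) = 1.
  have e1 : a `^ 1 = a by rewrite powRr1 // ltW.
  rewrite -{2}e1 -!gt0_powRD//.
  rewrite (_ : gamma + 1 + (- 1 - gamma) = 0); last by ring.
  by rewrite powRr0.
apply: eq_integral => x _; rewrite addr0 -EFinM pos_powM//; congr (_%:E).
by rewrite -[LHS]mulr1 -[X in _ * X = _]E; ring.
Qed.

(** The weight is integrable at infinity against a bounded function since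
    gamma > 0, and at the origin against O(x^delta) since delta > gamma. *)
Lemma radial_fin (gamma delta C : R) (g : R -> R) : 0 < gamma -> gamma < delta ->
  measurable_fun [set: R] g -> (forall x, 0 <= g x <= 2) ->
  (forall x, 0 < x -> g x <= C * x `^ delta) -> radial gamma g \is a fin_num.
Proof.
move=> ga0 gade mg g02 gC.
rewrite ge0_fin_numE; last first.
  by apply: integral_ge0 => x _; rewrite lee_fin mulr_ge0 ?pos_pow_ge0//; have /andP[] := g02 x.
have C0 : 0 <= C.
  have := gC 1 ltr01; rewrite powR1 mulr1; apply: le_trans.
  by have /andP[] := g02 1.
(* majorant of the integrand on (0, 1], then on [1, oo) *)
pose f1 (x : R) := (C%:E * ((fun x => (x `^ (delta - gamma - 1))%:E) \_ `]0%R, 1%R]) x)%E.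
pose f2 (x : R) := (2%:E * ((fun x => (x `^ (- (1 + gamma)))%:E) \_ `[1%R, +oo[) x)%E.
have pE (p : R) : measurable_fun [set: R] (fun x : R => (x `^ p)%:E).
  by apply/measurable_EFinP; exact: measurable_powR.
have m1 : measurable_fun [set: R] ((fun x => (x `^ (delta - gamma - 1))%:E) \_ `]0%R, 1%R]).
  apply/(measurable_restrictT _ _).1; first exact: measurable_itv.
  exact: measurable_funS (pE _).
have m2 : measurable_fun [set: R] ((fun x => (x `^ (- (1 + gamma)))%:E) \_ `[1%R, +oo[).
  apply/(measurable_restrictT _ _).1; first exact: measurable_itv.
  exact: measurable_funS (pE _).
have p1 x : (0 <= ((fun x => (x `^ (delta - gamma - 1))%:E) \_ `]0%R, 1%R]) x)%E.
  by apply: erestrict_ge0 => y _; rewrite lee_fin powR_ge0.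
have p2 x : (0 <= ((fun x => (x `^ (- (1 + gamma)))%:E) \_ `[1%R, +oo[) x)%E.
  by apply: erestrict_ge0 => y _; rewrite lee_fin powR_ge0.
apply: (@le_lt_trans _ _ (\int[leb]_x (f1 x + f2 x))%E).
  apply: ge0_le_integral => //.
  - by move=> x _; rewrite lee_fin mulr_ge0 ?pos_pow_ge0//; have /andP[] := g02 x.
  - exact: mrad.
  - by apply: emeasurable_funD; apply: measurable_funeM.
  move=> x _; rewrite /f1 /f2 /patch !mem_setE !in_itv/= /pos_pow.
  case: (ltrP 0 x) => x0 /=; last first.
    rewrite mulr0 mule0 add0e; case: ifP => [|_]; last by rewrite mule0.
    by rewrite andbT => x1; have := lt_le_trans ltr01 x1; rewrite ltNge x0.
  case: (lerP x 1) => x1.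
    apply: (@le_trans _ _ (C%:E * (x `^ (delta - gamma - 1))%:E)%E).
      rewrite -EFinM lee_fin.
      have -> : x `^ (delta - gamma - 1) = x `^ delta * x `^ (-1 - gamma).
        by rewrite -gt0_powRD//; congr (_ `^ _); ring.
      by rewrite mulrA ler_wpM2r ?powR_ge0 ?gC.
    by move: (p2 x); rewrite /patch mem_setE in_itv/= => p2x; rewrite leeDl// mule_ge0.
  rewrite (ltW x1)/= mule0 add0e -EFinM lee_fin opprD.
  by rewrite ler_wpM2r ?powR_ge0//; have /andP[] := g02 x.
rewrite ge0_integralD//; last 4 first.
- by move=> x _; rewrite /f1 mule_ge0 ?lee_fin.
- exact: measurable_funeM.
- by move=> x _; rewrite /f2 mule_ge0 ?lee_fin.
- exact: measurable_funeM.
rewrite /f1 /f2 !ge0_integralZl_EFin//.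
rewrite -!integral_mkcond integral_powR_tail ?ltrDl//.
apply: lte_add_pinfty.
  apply: lte_mul_pinfty => //.
  apply: (@le_lt_trans _ _ ((delta - gamma)^-1)%:E); last exact: ltry.
  by apply: integral_powR_near0; rewrite subr_gt0.
by rewrite -EFinM ltry.
Qed.

Lemma radial_gt0 (gamma c : R) (g : R -> R) : 0 < c -> 0 < gamma ->
  measurable_fun [set: R] g -> (forall x, 0 <= g x) ->
  (forall x, 1 <= x <= 2 -> c <= g x) -> (0 < radial gamma g)%E.
Proof.
move=> c0 ga0 mg g0 gc.
pose e : R := c * 2 `^ (- 1 - gamma).
have e0 : 0 < e by rewrite mulr_gt0 ?powR_gt0.
apply: (@lt_le_trans _ _ (\int[leb]_(x in `[1%R, 2%R]) e%:E)%E).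
  rewrite integral_cst//= lebesgue_measure_itv/= lte_fin ifT ?ltr1n// -EFinB -EFinM lte_fin.
  by rewrite mulr_gt0// subr_gt0 ltr1n.
rewrite /radial.
apply: (@le_trans _ _ (\int[leb]_(x in `[1%R, 2%R]) (g x * pos_pow x (- 1 - gamma))%:E)%E).
  apply: ge0_le_integral => //.
  - by move=> x _; rewrite lee_fin ltW.
  - by apply/measurable_funTS; exact: mrad.
  move=> x /=; rewrite in_itv/= => /andP[x1 x2].
  have x0 : 0 < x by exact: lt_le_trans x1.
  have kle : 2 `^ (-1 - gamma) <= x `^ (-1 - gamma).
    rewrite (_ : -1 - gamma = - (1 + gamma)); last by ring.
    rewrite !powRN lef_pV2 ?posrE ?powR_gt0//.
    by apply: ge0_ler_powR => //; rewrite ?nnegrE ?addr_ge0// ltW.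
  rewrite lee_fin /e /pos_pow x0 ler_pM ?powR_ge0 ?(ltW c0)//.
  by rewrite gc// x1.
apply: ge0_subset_integral => //.
- exact: mrad.
- by move=> x _; rewrite lee_fin mulr_ge0 ?pos_pow_ge0.
Qed.

End radial.

Lemma measurable_norm_powR d (T : measurableType d) (R : realType) (f : T -> R) (p : R) :
  measurable_fun [set: T] f -> measurable_fun [set: T] (fun x => `|f x| `^ p).
Proof.
move=> mf.
have mg : measurable_fun [set: T] ((fun x : R => x `^ p) \o (fun x => `|f x|)).
  by apply: measurableT_comp; [exact: measurable_powR | exact: measurableT_comp].
exact: mg.
Qed.

Section moments.
Context {R : realType}.

Lemma sin_le_id (x : R) : 0 <= x -> sin x <= x.
Proof.
rewrite le_eqVlt => /predU1P[<-|x0]; first by rewrite sin0.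
have [c _] := @MVT R sin cos 0 x x0 (fun y _ => is_derive_sin y)
  (continuous_subspaceT (@continuous_sin R)).
rewrite sin0 !subr0 => ->.
by rewrite ger_pMl// cos_le1.
Qed.

Lemma onem_cos_le (x : R) : 0 <= x -> 1 - cos x <= x ^+ 2.
Proof.
rewrite le_eqVlt => /predU1P[<-|x0]; first by rewrite cos0 subrr sqr_ge0.
have [c] := @MVT R cos (fun y => - sin y) 0 x x0 (fun y _ => is_derive_cos y)
  (continuous_subspaceT (@continuous_cos R)).
rewrite in_itv/= => /andP[c0 cx].
rewrite cos0 subr0 mulNr => E; rewrite -opprB E opprK expr2 ler_wpM2r ?(ltW x0)//.
by apply: le_trans (ltW cx); apply: sin_le_id; exact: ltW.
Qed.

Let mcos : measurable_fun [set: R] cos.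
Proof. by apply: continuous_measurable_fun; exact: continuous_cos. Qed.

Definition onem_cos (x : R) : R := 1 - cos x.
Definition onem_expN (alpha x : R) : R := 1 - expR (- (`|x| `^ alpha)).

Lemma measurable_onem_cos : measurable_fun [set: R] onem_cos.
Proof. by apply: measurable_funB; [exact: measurable_cst|exact: mcos]. Qed.

Lemma measurable_onem_expN alpha : measurable_fun [set: R] (onem_expN alpha).
Proof.
apply: measurable_funB; first exact: measurable_cst.
apply: (measurableT_comp (@measurable_expR R)); apply: measurableT_comp => //.
exact: measurable_norm_powR.
Qed.

Lemma onem_cos02 x : 0 <= onem_cos x <= 2.
Proof.
rewrite /onem_cos; have := cos_le1 x; have := cos_geN1 x.
by move=> h1 h2; apply/andP; split; lra.
Qed.

Lemma onem_expN02 alpha x : 0 <= onem_expN alpha x <= 2.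
Proof.
rewrite /onem_expN; have h1 := expR_gt0 (- (`|x| `^ alpha)).
have h2 : expR (- (`|x| `^ alpha)) <= 1 by rewrite -expR0 ler_expR oppr_le0 powR_ge0.
by apply/andP; split; lra.
Qed.

Lemma radial_cos (gamma : R) : 0 < gamma < 2 ->
  exists2 c : R, 0 < c & radial gamma onem_cos = c%:E.
Proof.
move=> /andP[g0 g2].
have f : radial gamma onem_cos \is a fin_num.
  apply: (@radial_fin R gamma 2 1) => //.
  - exact: measurable_onem_cos.
  - exact: onem_cos02.
  - by move=> x x0; rewrite mul1r powR_mulrn ?onem_cos_le// ltW.
exists (fine (radial gamma onem_cos)); last by rewrite fineK.
rewrite fine_gt0// ltey_eq f/= andbT.
apply: (@radial_gt0 R gamma (1 - cos 1)) => //.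
- have p1 : 1 <= pi :> R by rewrite (le_trans _ (pi_ge2 R))// ler1n.
  have : cos 1 < cos (0 : R) by rewrite ltr_cos ?in_itv/= ?lexx ?pi_ge0 ?ler01.
  by rewrite cos0 subr_gt0.
- exact: measurable_onem_cos.
- by move=> x; have /andP[] := onem_cos02 x.
- move=> x /andP[x1 x2]; rewrite /onem_cos lerD2l lerN2.
  rewrite leNgt ltr_cos ?in_itv/= -?leNgt//.
    by rewrite (le_trans ler01 x1) (le_trans x2 (pi_ge2 R)).
  by rewrite ler01 (le_trans _ (pi_ge2 R))// ler1n.
Qed.

Lemma radial_exp (alpha gamma : R) : 0 < gamma < alpha ->
  exists2 c : R, 0 < c & radial gamma (onem_expN alpha) = c%:E.
Proof.
move=> /andP[g0 ga].
have f : radial gamma (onem_expN alpha) \is a fin_num.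
  apply: (@radial_fin R gamma alpha 1) => //.
  - exact: measurable_onem_expN.
  - exact: onem_expN02.
  - move=> x x0; rewrite mul1r /onem_expN ger0_norm ?(ltW x0)//.
    have h := expR_ge1Dx (- (x `^ alpha)); lra.
exists (fine (radial gamma (onem_expN alpha))); last by rewrite fineK.
rewrite fine_gt0// ltey_eq f/= andbT.
apply: (@radial_gt0 R gamma (1 - expR (- 1))) => //.
- exact: measurable_onem_expN.
- by move=> x; have /andP[] := onem_expN02 alpha x.
- move=> x /andP[x1 x2]; rewrite /onem_expN lerD2l lerN2 ler_expR lerN2.
  have x0 : 0 <= x by exact: le_trans x1.
  have h : 1 `^ alpha <= x `^ alpha.
    by apply: ge0_ler_powR; rewrite ?nnegrE// ltW// (lt_trans g0).
  by rewrite powR1 in h; rewrite ger0_norm.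
Qed.

(** The gamma-th absolute moment of the standard symmetric stable law: the
    denominator is the constant k of k |x|^gamma = radial (y |-> 1 - cos (x y)),
    and the numerator is the expectation of the right-hand side over x. *)
Definition stable_moment_const (alpha gamma : R) : R :=
  fine (radial gamma (onem_expN alpha)) / fine (radial gamma onem_cos).

Lemma stable_moment_const_gt0 alpha gamma : 0 < gamma < alpha -> alpha <= 2 ->
  0 < stable_moment_const alpha gamma.
Proof.
move=> ga a2; rewrite /stable_moment_const.
have [c c0 ->] := radial_exp ga.
have [|e e0 ->] := @radial_cos gamma; last by rewrite divr_gt0.
by case/andP: ga => -> /= ga; exact: lt_le_trans a2.
Qed.

(** Apply Tonelli's theorem to (1 - cos (x X)) x^(-1-gamma): integrating first in x
    gives a multiple of E |X|^gamma by homogeneity, and integrating first over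
    the probability space gives 1 - exp (- |sigma x|^alpha), whose radial integral
    is a multiple of sigma^gamma, again by homogeneity. *)
Lemma sas_moment d (T : measurableType d) (P : probability T R)
  (alpha sigma gamma : R) (X : T -> R) : 0 < gamma < alpha -> alpha <= 2 ->
  0 <= sigma -> sas_law P alpha sigma X ->
  (\int[P]_w (`|X w| `^ gamma)%:E = (stable_moment_const alpha gamma * sigma `^ gamma)%:E)%E.
Proof.
move=> ga a2 s0 [mX hX].
have [g0 gal] := andP ga.
have [|k k0 hk] := @radial_cos gamma.
  by rewrite g0 (lt_le_trans gal).
have [D D0 hD] := radial_exp ga.
pose pp x : R := pos_pow x (- 1 - gamma).
have mpp : measurable_fun [set: R] pp by exact: measurable_pos_pow.
pose F (z : T * measurableTypeR R) : \bar R := (onem_cos (z.2 * X z.1) * pp z.2)%:E.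
have mF : measurable_fun [set: T * measurableTypeR R] F.
  apply/measurable_EFinP; apply: measurable_funM.
    apply: (measurableT_comp measurable_onem_cos); apply: measurable_funM.
      exact: measurable_snd.
    exact: measurableT_comp.
  exact: (measurableT_comp mpp measurable_snd).
have F0 z : (0 <= F z)%E.
  rewrite /F lee_fin mulr_ge0 ?pos_pow_ge0//.
  by have /andP[] := onem_cos02 (z.2 * X z.1).
have FT := @fubini_tonelli _ _ _ _ _ P (@lebesgue_measure R) F mF F0.
have L1 : (\int[P]_w \int[@lebesgue_measure R]_x F (w, x) =
    \int[P]_w (k * `|X w| `^ gamma)%:E)%E.
  apply: eq_integral => w _; rewrite /F/=.
  have -> : (\int[@lebesgue_measure R]_x (onem_cos (x * X w) * pp x)%:E =
      radial gamma (fun x => onem_cos (`|X w| * x)))%E.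
    apply: eq_integral => x _; congr (_%:E); congr (_ * _).
    rewrite /onem_cos -[in RHS]cos_norm normrM normr_id -normrM cos_norm.
    by rewrite mulrC.
  have [X0|X0] := eqVneq (X w) 0.
    rewrite X0 normr0 powR0 ?(gt_eqF g0)// mulr0 /radial.
    by apply: integral0_eq => x _; rewrite mul0r /onem_cos cos0 subrr mul0r.
  rewrite radial_scale ?normr_gt0//; last 2 first.
  - exact: measurable_onem_cos.
  - by move=> x; have /andP[] := onem_cos02 x.
  by rewrite hk -EFinM mulrC.
have L2 : (\int[@lebesgue_measure R]_x \int[P]_w F (w, x) = (D * sigma `^ gamma)%:E)%E.
  transitivity (radial gamma (fun x => onem_expN alpha (sigma * x))).
    apply: eq_integral => x _; rewrite /F/=.
    have [hc _] := hX x.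
    have mc : measurable_fun [set: T] (fun w => onem_cos (x * X w)).
      apply: (measurableT_comp measurable_onem_cos); exact: measurable_funM.
    under eq_integral do rewrite mulrC EFinM.
    rewrite ge0_integralZl_EFin ?pos_pow_ge0//; last 2 first.
    - by move=> w _; rewrite lee_fin; have /andP[] := onem_cos02 (x * X w).
    - exact/measurable_EFinP.
    rewrite [in RHS]mulrC [in RHS]EFinM; congr (_ * _)%E.
    rewrite unlock in hc.
    rewrite /onem_cos /onem_expN.
    under eq_integral do rewrite EFinB.
    rewrite integralB//; last 2 first.
    - exact: finite_measure_integrable_cst.
    - apply: measurable_bounded_integrable => //.
      + by rewrite (le_lt_trans (probability_le1 P measurableT))// ltry.
      + by apply: (measurableT_comp mcos); exact: measurable_funM.
      + exists 1; split; first exact: num_real.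
        by move=> y y1 w _; apply: le_trans (ltW y1); exact: cos_max.
    have -> : (\int[P]__ 1 = 1)%E.
      by rewrite integral_cst// mul1e; exact: (@probability_setT _ _ _ P).
    by rewrite hc EFinB.
  have [->|s1] := eqVneq sigma 0.
    rewrite powR0 ?(gt_eqF g0)// mulr0 /radial.
    apply: integral0_eq => x _; rewrite mul0r /onem_expN normr0 powR0 ?oppr0 ?expR0 ?subrr ?mul0r//.
    by rewrite gt_eqF// (lt_trans g0).
  rewrite radial_scale ?lt0r ?s1//; last 2 first.
  - exact: measurable_onem_expN.
  - by move=> x; have /andP[] := onem_expN02 alpha x.
  by rewrite hD -EFinM mulrC.
have mXg : measurable_fun [set: T] (fun w => (`|X w| `^ gamma)%:E).
  by apply/measurable_EFinP; exact: measurable_norm_powR.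
move: FT; rewrite L1 L2.
under eq_integral do rewrite EFinM.
rewrite ge0_integralZl_EFin//; last by rewrite ltW.
rewrite /stable_moment_const hD hk/= => FT.
have -> : (D / k * sigma `^ gamma)%:E = ((k^-1)%:E * (D * sigma `^ gamma)%:E)%E.
  by rewrite -EFinM; congr (_%:E); ring.
by rewrite -FT muleA -EFinM mulVf ?(gt_eqF k0)// mul1e.
Qed.
End moments.

(** * Independence of a variable from a sum of earlier ones *)

Section independence.
Context d (T : measurableType d) (R : realType) (P : probability T R).

Definition indep2 (U V : T -> R) : Prop :=
  forall B C : set R, measurable B -> measurable C ->
    P (U @^-1` B `&` V @^-1` C) = (P (U @^-1` B) * P (V @^-1` C))%E.

Lemma indep2_comp (U V : T -> R) (f g : R -> R) : measurable_fun [set: R] f ->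
  measurable_fun [set: R] g -> indep2 U V -> indep2 (f \o U) (g \o V).
Proof.
move=> mf mg UV B C mB mC; apply: (UV (f @^-1` B) (g @^-1` C)).
- by rewrite -[X in measurable X]setTI; exact: mf.
- by rewrite -[X in measurable X]setTI; exact: mg.
Qed.

(** The joint law of two independent variables is the product of their laws, so
    the product formula is Fubini's theorem for that product. *)
Lemma indep2_integral (U V : T -> R) :
  P.-integrable setT (EFin \o U) -> P.-integrable setT (EFin \o V) -> indep2 U V ->
  P.-integrable setT (EFin \o (fun w => U w * V w)) /\
  (\int[P]_w (U w * V w)%:E = (\int[P]_w (U w)%:E) * (\int[P]_w (V w)%:E))%E.
Proof.
move=> iU iV UV.
have mU : measurable_fun [set: T] U by apply/measurable_EFinP; exact: measurable_int iU.
have mV : measurable_fun [set: T] V by apply/measurable_EFinP; exact: measurable_int iV.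
pose U' : {mfun T >-> R} := HB.pack U (isMeasurableFun.Build _ _ _ _ _ mU).
pose V' : {mfun T >-> R} := HB.pack V (isMeasurableFun.Build _ _ _ _ _ mV).
pose rU := distribution P U'; pose rV := distribution P V'.
have mW : measurable_fun [set: T] (fun w => (U w, V w)) by exact: measurable_fun_pair.
pose W : {mfun T >-> (R * R)%type} := HB.pack (fun w => (U w, V w)) (isMeasurableFun.Build _ _ _ _ _ mW).
pose rW := distribution P W.
have prodE (X : set (R * R)) : measurable X -> (rU \x rV)%E X = rW X.
  apply: product_measure_unique => A B mA mB.
  by rewrite /rW /distribution /pushforward/= -UV.
have intE (f : R * R -> \bar R) : (\int[rU \x rV]_z f z = \int[rW]_z f z)%E.
  by apply: eq_measure_integral => A mA _; exact: prodE.
pose f (z : R * R) : \bar R := (z.1 * z.2)%:E.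
have mf : measurable_fun [set: R * R] f.
  apply/measurable_EFinP; apply: measurable_funM.
    exact: measurable_fst.
  exact: measurable_snd.
have mfa : measurable_fun [set: R * R] (abse \o f) by exact: measurableT_comp.
have fa0 z : (0 <= (abse \o f) z)%E by exact: abse_ge0.
have mabs : measurable_fun [set: R] (fun x : R => `|x|%:E).
  by apply/measurable_EFinP; exact: normr_measurable.
have absU : (\int[rU]_x `|x|%:E < +oo)%E.
  rewrite ge0_integral_distribution//.
  by have /integrableP[_] := iU.
have absV : (\int[rV]_x `|x|%:E < +oo)%E.
  rewrite ge0_integral_distribution//.
  by have /integrableP[_] := iV.
have absU0 : (0 <= \int[rU]_x `|x|%:E)%E by apply: integral_ge0 => x _; rewrite lee_fin.
have absV0 : (0 <= \int[rV]_x `|x|%:E)%E by apply: integral_ge0 => x _; rewrite lee_fin.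
have fabs : (\int[rU]_x \int[rV]_y `|f (x, y)| < +oo)%E.
  rewrite (_ : (\int[rU]_x _)%E = (\int[rU]_x `|x|%:E * \int[rV]_x `|x|%:E)%E).
    by rewrite lte_mul_pinfty// ge0_fin_numE.
  rewrite -ge0_integralZr//; apply: eq_integral => x _.
  rewrite -ge0_integralZl_EFin//; apply: eq_integral => y _.
  by rewrite /f/= normrM EFinM.
have ifp : (rU \x rV)%E.-integrable setT f.
  by apply/integrable12ltyP.
have iUV : P.-integrable setT (EFin \o (fun w => U w * V w)).
  apply/integrableP; split.
    by apply/measurable_EFinP; exact: measurable_funM.
  have : (\int[rU \x rV]_z `|f z| < +oo)%E by have /integrableP[_] := ifp.
  by rewrite intE ge0_integral_distribution.
split => //.
have -> : (\int[P]_w (U w * V w)%:E = \int[rW]_z f z)%E.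
  by rewrite integral_distribution.
rewrite -intE -integral12_prod_meas1//= /fubini_F.
have -> : (\int[P]_w (U w)%:E = \int[rU]_x x%:E)%E.
  by rewrite integral_distribution//; exact/measurable_EFinP.
have iU' : rU.-integrable setT (fun x => x%:E).
  by apply/integrableP; split => //; exact/measurable_EFinP.
have iV' : rV.-integrable setT (fun x => x%:E).
  by apply/integrableP; split => //; exact/measurable_EFinP.
have -> : (\int[P]_w (V w)%:E = \int[rV]_x x%:E)%E.
  by rewrite integral_distribution//; exact/measurable_EFinP.
under eq_integral.
  move=> x _.
  under eq_integral do rewrite /f/= EFinM.
  rewrite integralZl//.
  over.
have cf : (\int[rV]_x x%:E)%E \is a fin_num by exact: integrable_fin_num.
transitivity (\int[rU]_x (x%:E * (fine (\int[rV]_y y%:E))%:E))%E.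
  by apply: eq_integral => x _; rewrite fineK.
by rewrite integralZr// fineK.
Qed.

Variable X : nat -> T -> R.
Hypothesis mX : forall i, measurable_fun [set: T] (X i).

Definition cylinder (n : nat) : set (set T) :=
  [set A | exists2 B : nat -> set R, (forall i, measurable (B i)) &
     A = \bigcap_(i in [set: 'I_n]) (X i @^-1` B i)].

Lemma cylinder_setI n : setI_closed (cylinder n).
Proof.
move=> _ _ [B mB ->] [C mC ->]; exists (fun i => B i `&` C i).
  by move=> i; exact: measurableI.
by rewrite -bigcapI; apply: eq_bigcapr => i _; rewrite preimage_setI.
Qed.

Lemma cylinder_measurable n : cylinder n `<=` measurable.
Proof.
move=> _ [B mB ->]; apply: fin_bigcap_measurable => // i _.
by rewrite -[X in measurable X]setTI; exact: mX.
Qed.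

Lemma cylinder_indep n : mutually_independent P (fun i : 'I_n.+1 => X i) ->
  mutually_independent P (fun i : 'I_n => X i) ->
  forall A C, cylinder n A -> measurable C ->
  P (A `&` X n @^-1` C) = (P A * P (X n @^-1` C))%E.
Proof.
move=> hS h A C [B mB ->] mC.
rewrite h//.
(* the cylinder and the event of X n form one cylinder over n + 1 variables *)
have := hS (fun i => if (i < n)%N then B i else C) _.
rewrite big_ord_recr/= ltnn => E.
rewrite (eq_bigr (fun i : 'I_n => P (X i @^-1` (if (i < n)%N then B i else C)))); last first.
  by move=> i _; rewrite ltn_ord.
rewrite -E; last by move=> i; case: ifP.
congr (P _); apply/seteqP; split => w /=.
- move=> [wB wC] i _ /=; case: ifP => // iN; first exact: (wB (Ordinal iN)).
  suff -> : (i : nat) = n by [].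
  by apply/eqP; rewrite eqn_leq -ltnS ltn_ord leqNgt iN.
- move=> h1; split.
    move=> i _ /=; have := h1 (widen_ord (leqnSn n) i) I.
    by rewrite /= ltn_ord.
  by have := h1 ord_max I; rewrite /= ltnn.
Qed.

(** The events on which independence from [X n] holds form a lambda-system, and
    the cylinders over the first [n] variables form a pi-system that generates
    all the events depending on these variables. *)
Lemma sum_indep n (phi : nat -> R -> R) :
  (forall i, measurable_fun [set: R] (phi i)) ->
  mutually_independent P (fun i : 'I_n.+1 => X i) ->
  mutually_independent P (fun i : 'I_n => X i) ->
  indep2 (fun w => \sum_(i < n) phi i (X i w)) (X n).
Proof.
move=> mphi hS h B C mB mC.
pose E := X n @^-1` C.
have mE : measurable E by rewrite -[X in measurable X]setTI; exact: mX.
pose H : set (set T) := [set A | measurable A /\ P (A `&` E) = (P A * P E)%E].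
have PEfin A : measurable A -> P A \is a fin_num by move=> mA; rewrite fin_num_measure.
have lH : lambda_system setT H.
  apply/dynkin_lambda_system; split.
  - by split => //; rewrite setTI probability_setT mul1e.
  - move=> A [mA AE]; split; first exact: measurableC.
    rewrite setIC -setDE measureD//; last by rewrite -ge0_fin_numE// PEfin.
    transitivity (P E - P A * P E)%E; first by congr (_ - _)%E; rewrite setIC; exact: AE.
    rewrite probability_setC// muleBl ?PEfin ?fin_num_adde_defr//.
    by rewrite mul1e.
  - move=> F tF hF; split; first by apply: bigcup_measurable => k _; have [] := hF k.
    rewrite setI_bigcupl measure_bigcup//; last 2 first.
    + by move=> i _; apply: measurableI => //; have [] := hF i.
    + by apply: trivIset_setIr.
    rewrite measure_bigcup//; last by move=> i _; have [] := hF i.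
    rewrite -[P E]fineK ?PEfin// muleC -nneseriesZl//.
    apply: eq_eseriesr => i _; have [_ FE] := hF i.
    by apply: etrans FE _; rewrite fineK ?PEfin// muleC.
have sub : <<s setT, cylinder n >> `<=` H.
  apply: lambda_system_subset => //.
  - exact: cylinder_setI.
  - move=> A cA; split; first exact: (@cylinder_measurable n A cA).
    exact: (@cylinder_indep n hS h).
pose S := (fun w => \sum_(i < n) phi i (X i w)).
have mS : measurable_fun [set: g_sigma_algebraType (cylinder n)] (S : g_sigma_algebraType (cylinder n) -> R).
  apply: measurable_sum => i.
  have mXi : measurable_fun [set: g_sigma_algebraType (cylinder n)] (X i : g_sigma_algebraType (cylinder n) -> R).
    move=> _ D mD; rewrite setTI; apply: sub_sigma_algebra.
    exists (fun j => if j == i :> nat then D else setT).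
      by move=> j; case: ifP.
    apply/seteqP; split => w /=.
      by move=> wD j _ /=; case: ifP => // /eqP ->.
    by move=> /(_ i I); rewrite /= eqxx.
  exact: (measurableT_comp (mphi i) mXi).
have [] : H (S @^-1` B) by apply: sub; rewrite -[_ @^-1` _]setTI; exact: mS.
by [].
Qed.
End independence.

(** * Fourth moments of sums of weakly dependent variables *)

Section fourth_moment.
Context d (T : measurableType d) (R : realType) (P : probability T R).
Local Notation intg f := (P.-integrable [set: T] (EFin \o f)).
Local Notation Ex f := (\int[P]_w (f w)).

Lemma integrable_le (f g : T -> R) : measurable_fun [set: T] f -> intg g ->
  (forall w, `|f w| <= `|g w|) -> intg f.
Proof.
move=> mf ig fg; apply: le_integrable ig => //; first exact/measurable_EFinP.
by move=> w _; rewrite /= lee_fin.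
Qed.

Lemma integrable_cst (c : R) : intg (fun=> c).
Proof. exact: finite_measure_integrable_cst. Qed.

Lemma integrableDR (f g : T -> R) : intg f -> intg g -> intg (fun w => f w + g w).
Proof.
move=> fi gi; rewrite (_ : EFin \o _ = (EFin \o f) \+ (EFin \o g))%E; last exact/funext.
exact: integrableD.
Qed.

Lemma integrableZR (c : R) (f : T -> R) : intg f -> intg (fun w => c * f w).
Proof.
move=> fi; rewrite (_ : EFin \o _ = (fun w => c%:E * (EFin \o f) w))%E; last exact/funext.
exact: integrableZl.
Qed.

Lemma integrable_pow (f : T -> R) (k : nat) : (k <= 4)%N ->
  measurable_fun [set: T] f -> intg (fun w => f w ^+ 4) -> intg (fun w => f w ^+ k).
Proof.
move=> k4 mf i4.
apply: (@integrable_le _ (fun w => 1 + f w ^+ 4)).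
- exact: measurable_funX.
- by apply: integrableDR => //; exact: integrable_cst.
- move=> w; rewrite normrX [leRHS]ger0_norm ?addr_ge0 ?exprn_even_ge0//.
  rewrite -(@ger0_norm _ (f w ^+ 4)) ?exprn_even_ge0// normrX.
  set a := `|f w|; have a0 : 0 <= a by exact: normr_ge0.
  have [a1|/ltW a1] := leP a 1.
    by apply: (@le_trans _ _ 1); [exact: exprn_ile1 | rewrite lerDl exprn_ge0].
  by rewrite (le_trans (ler_weXn2l a1 k4))// lerDr.
Qed.

Lemma indep2_Rintegral (U V : T -> R) : intg U -> intg V -> indep2 P U V ->
  intg (fun w => U w * V w) /\ Ex (fun w => U w * V w) = Ex U * Ex V.
Proof.
move=> iU iV UV; have [i E] := indep2_integral iU iV UV; split => //.
by rewrite /Rintegral E fineM// integrable_fin_num.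
Qed.

(** The form of the bounds makes them inductive: if each term of a sum of [n]
    independent centered terms has fourth moment at most s^2, then A = n s and
    B = 3 n^2 s^2 are preserved. *)
Lemma fourth_moment_add (S Y : T -> R) (s A B : R) : 0 < s ->
  measurable_fun [set: T] S -> measurable_fun [set: T] Y ->
  intg (fun w => S w ^+ 4) -> intg (fun w => Y w ^+ 4) ->
  indep2 P S Y -> Ex S = 0 -> Ex Y = 0 ->
  Ex (fun w => S w ^+ 2) <= A -> Ex (fun w => S w ^+ 4) <= B ->
  Ex (fun w => Y w ^+ 4) <= s ^+ 2 ->
  [/\ intg (fun w => (S w + Y w) ^+ 4), Ex (fun w => S w + Y w) = 0,
      Ex (fun w => (S w + Y w) ^+ 2) <= A + s &
      Ex (fun w => (S w + Y w) ^+ 4) <= B + 6 * A * s + s ^+ 2].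
Proof.
move=> s0 mS mY iS4 iY4 SY S0 Y0 SA SB Ys.
have iS k : (k <= 4)%N -> intg (fun w => S w ^+ k) by move=> h; exact: integrable_pow.
have iY k : (k <= 4)%N -> intg (fun w => Y w ^+ k) by move=> h; exact: integrable_pow.
have SYk j k : (j <= 4)%N -> (k <= 4)%N ->
    intg (fun w => S w ^+ j * Y w ^+ k) /\
    Ex (fun w => S w ^+ j * Y w ^+ k) = Ex (fun w => S w ^+ j) * Ex (fun w => Y w ^+ k).
  move=> hj hk; apply: indep2_Rintegral; [exact: iS|exact: iY|].
  apply: (@indep2_comp _ _ _ _ _ _ (fun x => x ^+ j) (fun x => x ^+ k)) => //; exact: exprn_measurable.
have Y2 : Ex (fun w => Y w ^+ 2) <= s.
  have : Ex (fun w => Y w ^+ 2) <= Ex (fun w => 2^-1 * s^-1 * Y w ^+ 4 + 2^-1 * s).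
    apply: le_Rintegral => //; first exact: iY.
      by apply: integrableDR; [exact: integrableZR|exact: integrable_cst].
    move=> w _.
    (* E Y^2 <= s follows from E Y^4 <= s^2 by the inequality 2 s Y^2 <= Y^4 + s^2 *)
    have -> : 2^-1 * s^-1 * Y w ^+ 4 + 2^-1 * s = Y w ^+ 2 + 2^-1 * s^-1 * (Y w ^+ 2 - s) ^+ 2.
      by field; rewrite gt_eqF.
    by rewrite lerDl mulr_ge0 ?sqr_ge0// mulr_ge0// invr_ge0 ltW.
  rewrite RintegralD//; last 2 first.
  - exact: integrableZR.
  - exact: integrable_cst.
  rewrite RintegralZl// Rintegral_cst//.
  rewrite (_ : fine (P [set: T]) = 1); last by rewrite probability_setT.
  move=> h; apply: (le_trans h).
  have : 2^-1 * s^-1 * Ex (fun x => Y x ^+ 4) <= 2^-1 * s^-1 * s ^+ 2.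
    by rewrite ler_wpM2l// mulr_ge0// invr_ge0 ltW.
  have -> : 2^-1 * s^-1 * s ^+ 2 = 2^-1 * s by field; rewrite gt_eqF.
  by move=> h2; lra.
have iS1 : intg S by exact: (iS 1%N).
have iY1 : intg Y by exact: (iY 1%N).
have ZI := integrableZR; have DI := integrableDR.
have E4 : (fun w => (S w + Y w) ^+ 4) =
  (fun w => S w ^+ 4 + (4 * (S w ^+ 3 * Y w ^+ 1) + (6 * (S w ^+ 2 * Y w ^+ 2) +
     (4 * (S w ^+ 1 * Y w ^+ 3) + Y w ^+ 4)))).
  by apply/funext => w; ring.
have E2 : (fun w => (S w + Y w) ^+ 2) =
  (fun w => S w ^+ 2 + (2 * (S w ^+ 1 * Y w ^+ 1) + Y w ^+ 2)).
  by apply/funext => w; ring.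
have [i31 e31] := SYk 3%N 1%N isT isT.
have [i22 e22] := SYk 2%N 2%N isT isT.
have [i13 e13] := SYk 1%N 3%N isT isT.
have [i11 e11] := SYk 1%N 1%N isT isT.
have j4 := DI _ _ (ZI 4 _ i13) iY4.
have j3 := DI _ _ (ZI 6 _ i22) j4.
have j2 := DI _ _ (ZI 4 _ i31) j3.
have S1 : Ex (fun w => S w ^+ 1) = 0 by [].
have Y1 : Ex (fun w => Y w ^+ 1) = 0 by [].
split.
- by rewrite E4; exact: DI.
- by rewrite RintegralD// S0 Y0 addr0.
- rewrite E2 RintegralD//; [|exact: iS|by apply: DI; [exact: ZI|exact: iY]].
  rewrite RintegralD//; [|exact: ZI|exact: iY].
  rewrite RintegralZl// e11 S1 mul0r mulr0 add0r.
  exact: lerD.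
- rewrite E4 RintegralD// RintegralD//; [|exact: ZI].
  rewrite RintegralD//; [|exact: ZI].
  rewrite RintegralD//; [|exact: ZI].
  rewrite !RintegralZl// e31 e13 e22 S1 Y1 mul0r !mulr0 !add0r addrA.
  apply: lerD => //; apply: lerD => //.
  rewrite -mulrA ler_wpM2l//.
  have E20 : 0 <= Ex (fun x => S x ^+ 2) by apply: Rintegral_ge0 => w _; exact: sqr_ge0.
  have F20 : 0 <= Ex (fun x => Y x ^+ 2) by apply: Rintegral_ge0 => w _; exact: sqr_ge0.
  exact: ler_pM.
Qed.

Variable X : nat -> T -> R.
Hypothesis mX : forall i, measurable_fun [set: T] (X i).
Variable phi : nat -> R -> R.
Hypothesis mphi : forall i, measurable_fun [set: R] (phi i).

(** The odd cross terms vanish, so the fourth moment grows like the square of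
    the number of terms instead of its fourth power; this gain makes the
    probabilities of the deviations summable. *)
Lemma fourth_moment_indep (s : R) (m : nat) : 0 < s ->
  (forall n, (n <= m)%N -> mutually_independent P (fun i : 'I_n => X i)) ->
  (forall i, (i < m)%N -> intg (fun w => phi i (X i w) ^+ 4)) ->
  (forall i, (i < m)%N -> Ex (fun w => phi i (X i w)) = 0) ->
  (forall i, (i < m)%N -> Ex (fun w => phi i (X i w) ^+ 4) <= s ^+ 2) ->
  intg (fun w => (\sum_(i < m) phi i (X i w)) ^+ 4) /\
  Ex (fun w => (\sum_(i < m) phi i (X i w)) ^+ 4) <= 3 * m%:R ^+ 2 * s ^+ 2.
Proof.
move=> s0.
have mS n : measurable_fun [set: T] (fun w => \sum_(i < n) phi i (X i w)).
  by apply: measurable_sum => i; exact: (measurableT_comp (mphi i) (mX i)).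
suff H : forall n, (n <= m)%N ->
  (forall n, (n <= m)%N -> mutually_independent P (fun i : 'I_n => X i)) ->
  (forall i, (i < m)%N -> intg (fun w => phi i (X i w) ^+ 4)) ->
  (forall i, (i < m)%N -> Ex (fun w => phi i (X i w)) = 0) ->
  (forall i, (i < m)%N -> Ex (fun w => phi i (X i w) ^+ 4) <= s ^+ 2) ->
  [/\ intg (fun w => (\sum_(i < n) phi i (X i w)) ^+ 4),
  Ex (fun w => (\sum_(i < n) phi i (X i w))) = 0,
  Ex (fun w => (\sum_(i < n) phi i (X i w)) ^+ 2) <= n%:R * s &
  Ex (fun w => (\sum_(i < n) phi i (X i w)) ^+ 4) <= 3 * n%:R ^+ 2 * s ^+ 2].
  by move=> h1 h2 h3 h4; have [] := H m (leqnn _) h1 h2 h3 h4.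
move=> n + hI h4 h0 hs; elim: n => [|n IH] nm.
  have E k : (fun w : T => (\sum_(i < 0) phi i (X i w)) ^+ k.+1) = (fun=> 0).
    by apply/funext => w; rewrite big_ord0 expr0n.
  rewrite (E 3%N) (E 1%N) (_ : (fun w => \sum_(i < 0) phi i (X i w)) = (fun=> 0)); last exact: (E 0%N).
  rewrite !Rintegral_cst// expr0n/= !(mul0r, mulr0) lexx; split => //; exact: integrable_cst.
have [i4 e1 e2 e4] := IH (ltnW nm).
have D k : (fun w => (\sum_(i < n.+1) phi i (X i w)) ^+ k) =
    (fun w => (\sum_(i < n) phi i (X i w) + phi n (X n w)) ^+ k).
  by apply/funext => w; rewrite big_ord_recr.
have mY : measurable_fun [set: T] (fun w => phi n (X n w)).
  exact: (measurableT_comp (mphi n) (mX n)).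
have ind : indep2 P (fun w => \sum_(i < n) phi i (X i w)) (fun w => phi n (X n w)).
  apply: (@indep2_comp _ _ _ P (fun w => \sum_(i < n) phi i (X i w)) (X n) id (phi n)) => //.
  by apply: sum_indep => //; apply: hI => //; exact: ltnW.
have [r4 r1 r2 r3] := fourth_moment_add s0 (mS n) mY i4 (h4 n nm) ind e1 (h0 n nm) e2 e4 (hs n nm).
rewrite !D (_ : (fun w => \sum_(i < n.+1) phi i (X i w)) =
  (fun w => \sum_(i < n) phi i (X i w) + phi n (X n w))); last exact: (D 1%N).
split => //.
- by rewrite (le_trans r2)// -natr1 mulrDl mul1r.
- apply: (le_trans r3); rewrite -natr1 -subr_ge0.
  rewrite [leRHS](_ : _ = 2 * s ^+ 2); last by ring.
  by rewrite mulr_ge0 ?sqr_ge0.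
Qed.

End fourth_moment.

Section power_mean.
Context {R : realType}.

Lemma sum_sqr_le (n : nat) (a : nat -> R) :
  (\sum_(i < n) a i) ^+ 2 <= n%:R * \sum_(i < n) a i ^+ 2.
Proof.
elim: n => [|n IH]; first by rewrite !big_ord0 expr0n mulr0.
rewrite !big_ord_recr/=; set S := \sum_(i < n) a i in IH *; set Q := \sum_(i < n) a i ^+ 2 in IH *.
have h : 2 * S * a n <= Q + n%:R * a n ^+ 2.
  rewrite /S /Q mulr_sumr mulr_suml.
  have -> : n%:R * a n ^+ 2 = \sum_(i < n) a n ^+ 2 by rewrite sumr_const card_ord mulr_natl.
  rewrite -big_split/=; apply: ler_sum => i _.
  by rewrite -subr_ge0 (_ : _ - _ = (a i - a n) ^+ 2) ?sqr_ge0//; ring.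
rewrite -natr1; have := IH; move: h; set c : R := n%:R => h IH'.
rewrite (_ : (S + a n) ^+ 2 = S ^+ 2 + 2 * S * a n + a n ^+ 2); last by ring.
rewrite (_ : (c + 1) * (Q + a n ^+ 2) = c * Q + (Q + c * a n ^+ 2) + a n ^+ 2); last by ring.
by rewrite lerD2r lerD.
Qed.

Lemma sum_pow4_le (n : nat) (a : nat -> R) :
  (\sum_(i < n) a i) ^+ 4 <= n%:R ^+ 3 * \sum_(i < n) a i ^+ 4.
Proof.
have h1 := sum_sqr_le n a.
have h2 := sum_sqr_le n (fun i => a i ^+ 2).
have -> : (\sum_(i < n) a i) ^+ 4 = ((\sum_(i < n) a i) ^+ 2) ^+ 2 by rewrite -exprM.
apply: (@le_trans _ _ ((n%:R * \sum_(i < n) a i ^+ 2) ^+ 2)).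
  by rewrite ler_pXn2r ?nnegrE ?sqr_ge0// mulr_ge0// sumr_ge0// => i _; exact: sqr_ge0.
rewrite exprMn exprS mulrC mulrAC -[leRHS]mulrA [in leRHS]mulrC.
have -> : \sum_(i < n) a i ^+ 4 = \sum_(i < n) (a i ^+ 2) ^+ 2.
  by apply: eq_bigr => i _; rewrite -exprM.
nra.
Qed.

Lemma sum_residue_classes (q m : nat) (F : nat -> R) :
  \sum_(k < q * m) F k = \sum_(r < q) \sum_(i < m) F (r + i * q)%N.
Proof.
elim: m => [|m IH].
  by rewrite muln0 big_ord0 big1// => r _; rewrite big_ord0.
rewrite mulnS addnC big_split_ord/= IH -big_split/=.
by apply: eq_bigr => r _; rewrite big_ord_recr/= [(q * m)%N]mulnC addnC.
Qed.
End power_mean.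

Section dependent.
Context d (T : measurableType d) (R : realType) (P : probability T R).
Local Notation intg f := (P.-integrable [set: T] (EFin \o f)).
Local Notation Ex f := (\int[P]_w (f w)).

Lemma integrable_sumR (n : nat) (f : nat -> T -> R) :
  (forall i, (i < n)%N -> intg (f i)) -> intg (fun w => \sum_(i < n) f i w).
Proof.
elim: n => [|n IH] h.
  rewrite (_ : (fun w => _) = (fun=> 0)); last by apply/funext => w; rewrite big_ord0.
  exact: integrable_cst.
rewrite (_ : (fun w => _) = (fun w => \sum_(i < n) f i w + f n w)); last first.
  by apply/funext => w; rewrite big_ord_recr.
by apply: integrableDR; [apply: IH => i /ltnW; exact: h|exact: h].
Qed.

Lemma Rintegral_sumR (n : nat) (f : nat -> T -> R) :
  (forall i, (i < n)%N -> intg (f i)) ->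
  Ex (fun w => \sum_(i < n) f i w) = \sum_(i < n) Ex (f i).
Proof.
elim: n => [|n IH] h.
  rewrite (_ : (fun w => _) = (fun=> 0)); last by apply/funext => w; rewrite big_ord0.
  by rewrite Rintegral_cst// mul0r big_ord0.
rewrite (_ : (fun w => _) = (fun w => \sum_(i < n) f i w + f n w)); last first.
  by apply/funext => w; rewrite big_ord_recr.
have hn i : (i < n)%N -> intg (f i) by move=> /ltnW; exact: h.
by rewrite RintegralD// ?big_ord_recr/= ?IH//; [exact: integrable_sumR|exact: h].
Qed.

Lemma fourth_moment_sum (n : nat) (Y : nat -> T -> R) (K : R) :
  (forall i, measurable_fun [set: T] (Y i)) ->
  (forall i, (i < n)%N -> intg (fun w => Y i w ^+ 4)) ->
  (forall i, (i < n)%N -> Ex (fun w => Y i w ^+ 4) <= K) ->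
  intg (fun w => (\sum_(i < n) Y i w) ^+ 4) /\
  Ex (fun w => (\sum_(i < n) Y i w) ^+ 4) <= n%:R ^+ 4 * K.
Proof.
move=> mY iY hK.
have iS : intg (fun w => n%:R ^+ 3 * \sum_(i < n) Y i w ^+ 4).
  exact/integrableZR/(@integrable_sumR n (fun i w => Y i w ^+ 4)).
have i4 : intg (fun w => (\sum_(i < n) Y i w) ^+ 4).
  apply: integrable_le iS _; first exact/measurable_funX/measurable_sum.
  move=> w; rewrite ger0_norm ?exprn_even_ge0// ger0_norm; last first.
    by rewrite mulr_ge0// sumr_ge0// => i _; rewrite exprn_even_ge0.
  exact: (sum_pow4_le n (fun i => Y i w)).
split => //.
apply: (@le_trans _ _ (Ex (fun w => n%:R ^+ 3 * \sum_(i < n) Y i w ^+ 4))).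
  by apply: le_Rintegral => // w _; exact: (sum_pow4_le n (fun i => Y i w)).
rewrite RintegralZl//; last exact: (@integrable_sumR n (fun i w => Y i w ^+ 4)).
rewrite (@Rintegral_sumR n (fun i w => Y i w ^+ 4))// [n%:R ^+ 4]exprSr -mulrA ler_wpM2l// ?exprn_ge0//.
apply: (@le_trans _ _ (\sum_(i < n) K)).
  by apply: ler_sum => i _; exact: hK.
by rewrite sumr_const card_ord mulr_natl.
Qed.

(** When terms at distance at least [q] are independent, each residue class
    modulo [q] is a sum of independent terms; the classes are then recombined by
    the crude bound [fourth_moment_sum], which costs the factor q^4. *)
Lemma fourth_moment_mdep (X : nat -> T -> R) (phi : nat -> R -> R) (q m : nat) (s : R) :
  (forall i, measurable_fun [set: T] (X i)) ->
  (forall i, measurable_fun [set: R] (phi i)) -> 0 < s ->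
  (forall r n, (r < q)%N -> (n <= m)%N ->
     mutually_independent P (fun i : 'I_n => X (r + i * q)%N)) ->
  (forall k, (k < q * m)%N -> [/\ intg (fun w => phi k (X k w) ^+ 4),
     Ex (fun w => phi k (X k w)) = 0 &
     Ex (fun w => phi k (X k w) ^+ 4) <= s ^+ 2]) ->
  intg (fun w => (\sum_(k < q * m) phi k (X k w)) ^+ 4) /\
  Ex (fun w => (\sum_(k < q * m) phi k (X k w)) ^+ 4) <=
     q%:R ^+ 4 * (3 * m%:R ^+ 2 * s ^+ 2).
Proof.
move=> mX mphi s0 hI hk.
pose Y r w := \sum_(i < m) phi (r + i * q)%N (X (r + i * q)%N w).
have lt_rq r i : (r < q)%N -> (i < m)%N -> (r + i * q < q * m)%N.
  move=> rq im; apply: (@leq_trans (q + i * q)); first by rewrite ltn_add2r.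
  by rewrite -mulSn mulnC leq_mul2l im orbT.
have H r : (r < q)%N -> intg (fun w => Y r w ^+ 4) /\
    Ex (fun w => Y r w ^+ 4) <= 3 * m%:R ^+ 2 * s ^+ 2.
  move=> rq; apply: (@fourth_moment_indep _ _ _ P (fun i => X (r + i * q)%N) _
    (fun i => phi (r + i * q)%N)) => // [n nm|i im|i im|i im]; first exact: hI.
  - by have [] := hk _ (lt_rq _ _ rq im).
  - by have [] := hk _ (lt_rq _ _ rq im).
  - by have [] := hk _ (lt_rq _ _ rq im).
rewrite (_ : (fun w => (\sum_(k < q * m) _) ^+ 4) = (fun w => (\sum_(r < q) Y r w) ^+ 4)); last first.
  by apply/funext => w; rewrite (@sum_residue_classes _ _ _ (fun k => phi k (X k w))).
apply: fourth_moment_sum => [i|i /H[]//|i /H[]//].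
by apply: measurable_sum => j; exact: (measurableT_comp (mphi _) (mX _)).
Qed.

Lemma markov4 (W : T -> R) (t : R) : measurable_fun [set: T] W -> 0 < t ->
  intg (fun w => W w ^+ 4) ->
  (P [set w | t <= `|W w|]%R <= (Ex (fun w => W w ^+ 4) / t ^+ 4)%:E)%E.
Proof.
move=> mW t0 iW.
pose A := [set w | t <= `|W w|].
have mA : measurable A.
  rewrite (_ : A = [set: T] `&` (fun w => `|W w|) @^-1` `[t, +oo[); last first.
    by apply/seteqP; split => w /=; rewrite /A/= in_itv/= andbT => // -[].
  exact: (measurableT_comp (@normr_measurable _ _) mW).
have -> : P A = (fine (P A))%:E by rewrite fineK// fin_num_measure.
rewrite lee_fin ler_pdivlMr ?exprn_gt0//.
have -> : fine (P A) * t ^+ 4 = Ex (fun w => t ^+ 4 * \1_A w).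
  rewrite RintegralZl//; last first.
    by apply: (integrable_le _ (integrable_cst P 1)) => // w; rewrite normr1 indicE; case: (_ \in _); rewrite ?normr1 ?normr0.
  by rewrite mulrC /Rintegral integral_indic// setIT.
apply: le_Rintegral => //.
  apply: integrableZR.
  by apply: (integrable_le _ (integrable_cst P 1)) => // w; rewrite normr1 indicE; case: (_ \in _); rewrite ?normr1 ?normr0.
move=> w _; rewrite indicE; case: (boolP (w \in A)); rewrite ?(mulr0, mulr1).
  rewrite inE => tW; rewrite -[leRHS]ger0_norm ?exprn_even_ge0// normrX.
  by rewrite ler_pXn2r ?nnegrE// ltW.
by rewrite exprn_even_ge0.
Qed.
End dependent.

(** * Kernels in the space of alpha-integrable functions *)

Section Lalpha.
Context {R : realType} (alpha : R).
Hypothesis alpha1 : 1 < alpha.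
Local Notation leb := (@lebesgue_measure R).
Implicit Types f g : R -> R.

(** The alpha-th power of the norm, kept in the extended reals so that
    comparison theorems for integrals of nonnegative functions apply before
    integrability is known. *)
Definition pow_integral f : \bar R := (\int[leb]_s (`|f s| `^ alpha)%:E)%E.

Let alpha0 : 0 < alpha. Proof. by rewrite (lt_trans ltr01). Qed.

Lemma pow_integral_ge0 f : (0 <= pow_integral f)%E.
Proof. by apply: integral_ge0 => s _; rewrite lee_fin powR_ge0. Qed.

Lemma Lnorm_pow_integral f : ('N[leb]_(alpha%:E) [EFin \o f] = pow_integral f `^ alpha^-1)%E.
Proof. by rewrite unlock; congr (_ `^ _)%E; apply: eq_integral => s _. Qed.

Lemma Lalpha_of_pow_integral f : measurable_fun [set: R] f ->
  (pow_integral f < +oo)%E -> f \in Lalpha alpha.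
Proof.
move=> mf pf; apply/andP; split; rewrite inE//=.
by rewrite /finite_norm Lnorm_pow_integral poweR_lty.
Qed.

Lemma Lalpha_measurable f : f \in Lalpha alpha -> measurable_fun [set: R] f.
Proof. by move=> /andP[]; rewrite inE. Qed.

Lemma pow_integral_lty f : f \in Lalpha alpha -> (pow_integral f < +oo)%E.
Proof.
move=> /andP[_]; rewrite inE/= /finite_norm => h.
have := @poweR_lty _ _ alpha h; rewrite Lnorm_pow_integral -poweRrM mulVf ?gt_eqF// poweRe1//.
exact: pow_integral_ge0.
Qed.

Lemma Lalpha_normE f : Lalpha_norm alpha f = fine (pow_integral f) `^ alpha^-1.
Proof. by rewrite /Lalpha_norm Lnorm_pow_integral fine_poweR. Qed.

Lemma Lalpha_norm_ge0 f : 0 <= Lalpha_norm alpha f.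
Proof. by rewrite Lalpha_normE powR_ge0. Qed.

Lemma pow_integral_fine f : f \in Lalpha alpha -> pow_integral f = (fine (pow_integral f))%:E.
Proof. by move=> hf; rewrite fineK// ge0_fin_numE ?pow_integral_ge0 ?pow_integral_lty. Qed.

Let mpow f : measurable_fun [set: R] f ->
  measurable_fun [set: R] (fun s => (`|f s| `^ alpha)%:E).
Proof. by move=> mf; apply/measurable_EFinP; exact: measurable_norm_powR. Qed.

Lemma Lalpha_dominated f g (C : R) : 0 <= C -> measurable_fun [set: R] f -> g \in Lalpha alpha ->
  (forall s, `|f s| <= C * `|g s|) ->
  f \in Lalpha alpha /\ Lalpha_norm alpha f <= C * Lalpha_norm alpha g.
Proof.
move=> C0 mf Lg fg.
have mg := Lalpha_measurable Lg.
have H : (pow_integral f <= (C `^ alpha)%:E * pow_integral g)%E.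
  rewrite /pow_integral -ge0_integralZl_EFin ?powR_ge0//; last exact: mpow.
  apply: ge0_le_integral => //.
  - exact: mpow.
  - by under eq_fun do rewrite -EFinM; apply/measurable_EFinP/measurable_funM => //; exact: measurable_norm_powR.
  - move=> s _; rewrite -EFinM lee_fin -powRM//.
    by apply: ge0_ler_powR; rewrite ?nnegrE ?mulr_ge0 ?(ltW alpha0).
have Lf : f \in Lalpha alpha.
  apply: Lalpha_of_pow_integral => //; apply: (le_lt_trans H).
  by rewrite pow_integral_fine// -EFinM ltry.
split => //.
rewrite !Lalpha_normE -[leLHS]mul1r.
move: H; rewrite (pow_integral_fine Lf) (pow_integral_fine Lg) -EFinM lee_fin/= => H.
have -> : C = (C `^ alpha) `^ alpha^-1 by rewrite -powRrM mulfV ?gt_eqF// powRr1.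
rewrite mul1r -powRM ?powR_ge0 ?fine_ge0 ?pow_integral_ge0//.
by apply: ge0_ler_powR; rewrite ?nnegrE ?mulr_ge0 ?powR_ge0 ?fine_ge0 ?pow_integral_ge0 ?invr_ge0 ?(ltW alpha0).
Qed.

(** The exponent - 1/alpha comes from the Jacobian of the dilation. *)
Lemma Lalpha_affine f (c x0 b : R) : 0 < c -> f \in Lalpha alpha -> 0 <= b ->
  (fun s => b * f (c * s + x0)) \in Lalpha alpha /\
  Lalpha_norm alpha (fun s => b * f (c * s + x0)) =
    b * c `^ (- alpha^-1) * Lalpha_norm alpha f.
Proof.
move=> c0 Lf b0.
have mf := Lalpha_measurable Lf.
have ma : measurable_fun [set: R] (fun s : R => c * s + x0).
  by apply: measurable_funD => //; exact: measurable_funM.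
have mfa : measurable_fun [set: R] (fun s : R => f (c * s + x0)) by exact: (measurableT_comp mf ma).
have E : pow_integral (fun s => b * f (c * s + x0)) = ((b `^ alpha * c^-1)%:E * pow_integral f)%E.
  rewrite /pow_integral -(@integral_affine R c x0 (fun s => (`|f s| `^ alpha)%:E))//; last exact: mpow.
  rewrite muleA -EFinM -mulrA mulVf ?gt_eqF// mulr1 -ge0_integralZl_EFin ?powR_ge0//.
    apply: eq_integral => s _; rewrite normrM (ger0_norm b0) powRM// ?normr_ge0//.
  exact: mpow.
have Lfa : (fun s => b * f (c * s + x0)) \in Lalpha alpha.
  apply: Lalpha_of_pow_integral; first exact: measurable_funM.
  by rewrite E pow_integral_fine// -EFinM ltry.
split => //; rewrite !Lalpha_normE E pow_integral_fine// -EFinM/=.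
rewrite !powRM ?mulr_ge0 ?powR_ge0 ?invr_ge0 ?(ltW c0) ?fine_ge0 ?pow_integral_ge0//.
rewrite -powRrM mulfV ?gt_eqF// powRr1//; congr (_ * _ * _).
by rewrite -[c^-1]powR_inv1 ?(ltW c0)// -powRrM mulN1r.
Qed.

Lemma Lalpha_normD f g : f \in Lalpha alpha -> g \in Lalpha alpha ->
  Lalpha_norm alpha (fun s => f s + g s) <= Lalpha_norm alpha f + Lalpha_norm alpha g.
Proof.
move=> Lf Lg; have a1 : (1 <= alpha%:E)%E by rewrite lee_fin ltW.
have := @eminkowski _ _ R leb f g alpha%:E (Lalpha_measurable Lf) (Lalpha_measurable Lg) a1.
have fin h : h \in Lalpha alpha -> ('N[leb]_(alpha%:E) [EFin \o h])%E = (Lalpha_norm alpha h)%:E.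
  move=> Lh; rewrite /Lalpha_norm fineK// ge0_fin_numE ?Lnorm_ge0//.
  by rewrite Lnorm_pow_integral poweR_lty// pow_integral_lty.
have Lfg : (f \+ g) \in Lalpha alpha by have [_ /(_ 1 f g Lf Lg)] := @Lfun_submod_closed _ _ R leb _ a1; rewrite scale1r.
by rewrite !fin// -EFinD lee_fin.
Qed.

(** A common majorant for kernels: they vanish to the right of [b], are bounded
    near their singularities, and decay like a power at minus infinity. *)
Definition envelope (p b s : R) : R :=
  if b < s then 0 else if -1 <= s then 1 else (- s) `^ (- p).

Lemma envelope_ge0 p b s : 0 <= envelope p b s.
Proof. by rewrite /envelope; do 2 case: ifP => // _; exact: powR_ge0. Qed.

Lemma measurable_envelope p b : measurable_fun [set: R] (envelope p b).
Proof.
rewrite /envelope; apply: measurable_fun_ifT; [exact: measurable_fun_ltr|by []|].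
apply: measurable_fun_ifT; [exact: measurable_fun_ler|by []|].
have mc : measurable_fun [set: R] ((fun x : R => x `^ (- p)) \o (fun x => - x)).
  by apply: measurableT_comp; [exact: measurable_powR|exact: measurable_funN].
exact: mc.
Qed.

Lemma integral_opp (f : R -> \bar R) : measurable_fun [set: R] f ->
  (forall x, (0 <= f x)%E) ->
  (\int[leb]_x f (- x)%R = \int[leb]_x f x)%E.
Proof.
move=> mf f0.
transitivity (\int[pushforward leb (-%R : _ -> measurableTypeR R)]_x f x)%E.
  by rewrite ge0_integral_pushforward.
by apply: eq_measure_integral => //= A mA _; exact: lebesgue_measureN.
Qed.

Lemma envelope_Lalpha p b : 1 < p * alpha -> 1 <= b -> envelope p b \in Lalpha alpha.
Proof.
move=> pa b1; apply: Lalpha_of_pow_integral; first exact: measurable_envelope.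
pose k (r : R) : \bar R := ((fun r => (r `^ (- (p * alpha)))%:E) \_ `[1%R, +oo[) r.
have mk : measurable_fun [set: R] k.
  apply/(measurable_restrictT _ _).1; first exact: measurable_itv.
  by apply: measurable_funTS; apply/measurable_EFinP; exact: measurable_powR.
have k0 r : (0 <= k r)%E by apply: erestrict_ge0 => y _; rewrite lee_fin powR_ge0.
have mkN : measurable_fun [set: R] (fun r => k (- r)%R).
  by apply: measurableT_comp mk _; exact: measurable_funN.
pose i (s : R) : \bar R := (\1_(`[-1, b]%classic) s)%:E.
have mi : measurable_fun [set: R] i.
  by apply/measurable_EFinP; apply: measurable_indic; exact: measurable_itv.
apply: (@le_lt_trans _ _ (\int[leb]_s (i s + k (- s)%R))%E).
  apply: ge0_le_integral => //.
  - by apply: mpow; exact: measurable_envelope.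
  - exact: emeasurable_funD.
  move=> s _; rewrite ger0_norm ?envelope_ge0// /envelope /i.
  have [bs|sb] := ltP b s.
    by rewrite powR0 ?gt_eqF// adde_ge0// lee_fin indicE ler0n.
  have [s1|s1] := leP (-1) s.
    by rewrite powR1 indicE mem_setE in_itv/= s1 sb/= leeDl.
  rewrite -powRrM mulNr.
  apply: (@le_trans _ _ (k (- s)%R)); last by rewrite leeDr// lee_fin indicE ler0n.
  by rewrite /k patchE mem_setE in_itv/= andbT ifT// lerNr ltW.
rewrite ge0_integralD//; last by move=> s _; rewrite lee_fin indicE ler0n.
rewrite (integral_opp mk)// lte_add_pinfty//.
  rewrite integral_indic//= setIT lebesgue_measure_itv/= lte_fin; case: ifP => _; rewrite ?ltry//.
by rewrite /k -integral_mkcond integral_powR_tail// ltry.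
Qed.

End Lalpha.

(** * Interpolation of the moving-average kernel in the Hurst parameter *)

Section taylor.
Context {R : realType}.

Lemma is_derive_powR (a y : R) : 0 < y ->
  is_derive y 1 (fun x : R => x `^ a) (a * y `^ (a - 1)).
Proof.
move=> y0; have hy : y \in `]0, +oo[ by rewrite in_itv/= y0.
have h := @derivable_powR R 1 a y hy.
apply: DeriveDef => //.
by rewrite -derive1E powR_derive1.
Qed.

Definition exp_rem (m : nat) (x : R) : R := expR x - \sum_(j < m) x ^+ j / j`!%:R.

Lemma exp_remS m x : exp_rem m.+1 x = exp_rem m x - x ^+ m / m`!%:R.
Proof. by rewrite /exp_rem big_ord_recr/= opprD addrA. Qed.

Lemma is_derive_exp_rem m (x : R) : is_derive x 1 (exp_rem m.+1) (exp_rem m x).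
Proof.
elim: m => [|m IH].
  rewrite (_ : exp_rem 1 = (fun x => expR x - 1)); last first.
    by apply/funext => y; rewrite /exp_rem big_ord1 expr0 fact0 divr1.
  rewrite /exp_rem big_ord0 subr0 -[X in is_derive _ _ _ X]subr0.
  by apply: is_deriveB.
rewrite (_ : exp_rem m.+2 = (fun x => exp_rem m.+1 x - (m.+1)`!%:R^-1 * x ^+ m.+1)); last first.
  by apply/funext => y; rewrite exp_remS [in RHS]mulrC.
have -> : exp_rem m.+1 x = exp_rem m x - (m.+1)`!%:R^-1 * (m.+1%:R * x ^+ m).
  rewrite exp_remS factS natrM.
  have f0 : m`!%:R != 0 :> R by rewrite pnatr_eq0 -lt0n fact_gt0.
  have s0 : m.+1%:R != 0 :> R by rewrite pnatr_eq0.
  by move: (m.+1%:R) s0 (m`!%:R) f0 => A A0 B B0; field; rewrite A0 B0.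
apply: is_deriveB.
have h : is_derive x 1 (fun x : R => x ^+ m.+1) (m.+1%:R * x ^+ m).
  have := @is_deriveX _ _ id m.+1 x 1 1 (is_derive_id x 1).
  rewrite /GRing.scale/= mulr1 (_ : id ^+ m.+1 = (fun x : R => x ^+ m.+1))//.
  by apply/funext => y; rewrite exprfctE.
exact: is_deriveZ.
Qed.

Lemma exp_rem_le m (x : R) : `|exp_rem m x| <= `|x| ^+ m * expR `|x|.
Proof.
elim: m x => [|m IH] x.
  by rewrite /exp_rem big_ord0 subr0 expr0 mul1r ger0_norm ?expR_ge0// ler_expR ler_norm.
have E0 : exp_rem m.+1 0 = 0.
  rewrite /exp_rem expR0 big_ord_recl expr0 fact0 divr1 big1 ?addr0 ?subrr// => i _.
  by rewrite expr0n mul0r.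
have cont : continuous (exp_rem m.+1).
  move=> y; apply/differentiable_continuous/derivable1_diffP.
  by have [] := is_derive_exp_rem m y.
have H (a b : R) : a <= b -> exists2 c, c \in `[a, b] &
    exp_rem m.+1 b - exp_rem m.+1 a = exp_rem m c * (b - a).
  move=> ab; apply: (@MVT_segment R _ (exp_rem m)) => //.
    by move=> y _; exact: is_derive_exp_rem.
  exact: continuous_subspaceT.
have [c cx ->] : exists2 c : R, `|c| <= `|x| & exp_rem m.+1 x = exp_rem m c * x.
  have [x0|/ltW x0] := leP 0 x.
    have [c] := H _ _ x0; rewrite E0 !subr0 in_itv/= => /andP[c0 cx] E; exists c => //.
    by rewrite !ger0_norm.
  have [c] := H _ _ x0; rewrite E0 !sub0r in_itv/= => /andP[xc c0] E; exists c => //.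
    by rewrite !ler0_norm// lerN2.
  by apply: oppr_inj; rewrite E mulrN.
rewrite normrM exprSr mulrAC ler_wpM2r//.
apply: (le_trans (IH c)); apply: ler_pM; [exact: exprn_ge0|exact: expR_ge0| |].
  by rewrite lerXn2r ?nnegrE.
by rewrite ler_expR.
Qed.

(** Trades a power of a logarithm for a small exponential, that is, for a small
    change of the exponent of a power. *)
Lemma expn_le_exp (m : nat) (t e : R) : 0 <= t -> 0 < e ->
  t ^+ m <= m`!%:R * e ^- m * expR (e * t).
Proof.
move=> t0 e0; case: m => [|m].
  by rewrite !expr0 fact0 invr1 !mul1r -expR0 ler_expR mulr_ge0// ltW.
have h := @expR_ge1Dxn R (e * t) m (mulr_ge0 (ltW e0) t0).
have h2 : (e * t) ^+ m.+1 / (m.+1)`!%:R <= expR (e * t).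
  by apply: le_trans h; rewrite lerDr.
have f0 : 0 < (m.+1)`!%:R :> R by rewrite ltr0n fact_gt0.
move: h2; rewrite ler_pdivrMr// => h2.
have -> : t ^+ m.+1 = e ^- m.+1 * (e * t) ^+ m.+1.
  by rewrite exprMn mulKf// expf_neq0// gt_eqF.
rewrite [leRHS](_ : _ = e ^- m.+1 * (expR (e * t) * (m.+1)`!%:R)); last by ring.
by rewrite ler_wpM2l// invr_ge0 exprn_ge0// ltW.
Qed.

(** If the weights kill the moments of order less than [m] of the exponents,
    they kill the Taylor polynomial of order [m] of the exponential in
    y^(a_j) = y^(a0) exp ((a_j - a0) ln y), and only its remainder is left. *)
Lemma moment_powR (n m : nat) (w a : nat -> R) (a0 eta y : R) : 0 < y ->
  (forall r, (r < m)%N -> \sum_(j < n) w j * (a j - a0) ^+ r = 0) ->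
  (forall j, (j < n)%N -> `|a j - a0| <= eta) ->
  `|\sum_(j < n) w j * y `^ (a j)| <=
    y `^ a0 * (\sum_(j < n) `|w j|) * (eta * `|ln y|) ^+ m * expR (eta * `|ln y|).
Proof.
move=> y0 hr he.
have E (j : nat) : y `^ (a j) = y `^ a0 * expR ((a j - a0) * ln y).
  rewrite /powR gt_eqF// -expRD; congr expR; ring.
rewrite (eq_bigr (fun j : 'I_n => y `^ a0 * (w j * expR ((a j - a0) * ln y)))); last first.
  by move=> j _; rewrite E mulrCA.
rewrite -mulr_sumr normrM (ger0_norm (powR_ge0 _ _)) -!mulrA ler_wpM2l ?powR_ge0//.
have -> : \sum_(j < n) w j * expR ((a j - a0) * ln y) =
   \sum_(j < n) w j * exp_rem m ((a j - a0) * ln y).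
  apply/eqP; rewrite -subr_eq0 -sumrB.
  rewrite (eq_bigr (fun j : 'I_n => \sum_(r < m) (w j * (a j - a0) ^+ r) * (ln y ^+ r / r`!%:R))); last first.
    move=> j _; rewrite -mulrBr /exp_rem opprB addrC subrK mulr_sumr; apply: eq_bigr => r _.
    by rewrite exprMn !mulrA.
  rewrite exchange_big/= big1// => r _; rewrite -mulr_suml hr ?mul0r//.
apply: (le_trans (ler_norm_sum _ _ _)).
rewrite mulr_suml; apply: ler_sum => j _; rewrite normrM ler_wpM2l//.
apply: (le_trans (exp_rem_le _ _)).
have h : `|(a j - a0) * ln y| <= eta * `|ln y| by rewrite normrM ler_wpM2r// he.
apply: ler_pM => //; rewrite ?expR_ge0 ?exprn_ge0//; last by rewrite ler_expR.
by rewrite lerXn2r ?nnegrE ?normr_ge0// (le_trans _ h).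
Qed.

End taylor.

Section lagrange.
Context {R : realType}.

(** The coefficients are the values at [y] of the Lagrange polynomials for the
    nodes 0, ..., m - 1; they solve a Vandermonde system whose right-hand side
    (1, y, y^2, ...) differs by O(|y|) from (1, 0, 0, ...), the right-hand side
    for y = 0. *)
Lemma lagrange_coefs (m : nat) : exists2 C : R, 0 <= C &
  forall y : R, `|y| <= 1 -> exists c : nat -> R,
    (forall r, (r < m)%N -> \sum_(i < m) c i * i%:R ^+ r = y ^+ r) /\
    (forall i, (i < m)%N -> `|c i - (i == 0)%:R| <= C * `|y|).
Proof.
case: m => [|m].
  by exists 0 => // y _; exists (fun=> 0); split.
pose V : 'M[R]_(m.+1) := Vandermonde m.+1 (\row_(j < m.+1) (j%:R : R)).
have Vu : V \in unitmx.
  rewrite unitmxE det_Vandermonde unitfE; apply/prodf_neq0 => i _.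
  apply/prodf_neq0 => j ij; rewrite !mxE subr_eq0 eqr_nat.
  by rewrite gtn_eqF.
pose C := \sum_(i < m.+1) \sum_(r < m.+1) `|invmx V i r|.
exists C; first by apply: sumr_ge0 => i _; apply: sumr_ge0.
move=> y y1.
pose x : 'cV[R]_(m.+1) := \col_r (y ^+ r).
pose d : 'cV[R]_(m.+1) := \col_i (i == 0)%:R.
pose z := invmx V *m x.
exists (fun i => z (inord i) 0); split.
  move=> r rm.
  have : (V *m z) (Ordinal rm) 0 = x (Ordinal rm) 0 by rewrite /z mulKVmx.
  rewrite !mxE /= => <-; apply: eq_bigr => i _.
  by rewrite inord_val mulrC !mxE.
move=> i im.
have Vd : V *m d = \col_r (r == 0)%:R.
  apply/matrixP => r k; rewrite !mxE (bigD1 ord0)//= big1 ?addr0.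
    by rewrite !mxE/= mulr1 expr0n.
  by move=> j j0; rewrite !mxE (negPf j0) mulr0.
have -> : z (inord i) 0 - (i == 0)%:R = (invmx V *m (x - V *m d)) (inord i) 0.
  rewrite mulmxBr mulKmx// !mxE; congr (_ - _).
  by rewrite -val_eqE/= inordK.
rewrite mxE; apply: (le_trans (ler_norm_sum _ _ _)).
rewrite /C [leRHS]mulr_suml [leRHS](bigD1 (inord i : 'I_m.+1))//= -[leLHS]addr0.
apply: lerD; last by apply: sumr_ge0 => k _; rewrite mulr_ge0// sumr_ge0.
rewrite mulr_suml; apply: ler_sum => r _; rewrite normrM ler_wpM2l//.
rewrite Vd !mxE; have [->|r0] := eqVneq r 0; first by rewrite expr0 subrr normr0.
rewrite subr0 normrX; have : (0 < r)%N by rewrite lt0n.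
case: (r : nat) => // k _; rewrite exprS ler_piMr// exprn_ile1//.
Qed.

End lagrange.

Section kernel.
Context {R : realType} (alpha : R).
Hypothesis alpha1 : 1 < alpha.

Lemma is_derive_comb (n : nat) (w a : nat -> R) (y : R) : 0 < y ->
  is_derive y 1 (fun x : R => \sum_(j < n) w j * x `^ (a j))
    (\sum_(j < n) w j * (a j * y `^ (a j - 1))).
Proof.
move=> y0.
have := @is_derive_sum R R R n (fun j => (fun x : R => w j * x `^ (a j))) y 1
  (fun j => w j * (a j * y `^ (a j - 1))).
rewrite (_ : \sum_(i < n) _ = (fun x : R => \sum_(j < n) w j * x `^ (a j))); last first.
  by apply/funext => x; rewrite fct_sumE.
by apply => j; apply: is_deriveZ; exact: is_derive_powR.
Qed.

(** For s >= -1 the two terms of the kernel are bounded separately; for s < -1 the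
    kernel is an increment of length [u] of a differentiable function, to which
    the mean value theorem applies. *)
Lemma kernel_comb_le_envelope (n : nat) (w v : nat -> R) (B p u s : R) :
  0 <= B -> 0 <= p -> 0 <= u <= 1 ->
  (forall y, 0 < y -> y <= 2 -> `|\sum_(j < n) w j * y `^ (v j - alpha^-1)| <= B) ->
  (forall y, 1 <= y -> `|\sum_(j < n) w j * ((v j - alpha^-1) * y `^ (v j - alpha^-1 - 1))| <= B * y `^ (- p)) ->
  `|\sum_(j < n) w j * lmsm_kernel alpha u (v j) s| <= 2 * B * envelope p 1 s.
Proof.
move=> B0 p0 /andP[u0 u1] H1 H2.
pose Phi y := \sum_(j < n) w j * y `^ (v j - alpha^-1).
pose PhiP y := \sum_(j < n) w j * pos_pow y (v j - alpha^-1).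
have PhiPE y : 0 < y -> PhiP y = Phi y.
  by move=> y0; apply: eq_bigr => j _; rewrite /pos_pow y0.
have PhiP0 y : y <= 0 -> PhiP y = 0.
  by move=> y0; rewrite /PhiP big1// => j _; rewrite /pos_pow ltNge y0/= mulr0.
have -> : \sum_(j < n) w j * lmsm_kernel alpha u (v j) s = PhiP (u - s) - PhiP (- s).
  by rewrite -sumrB; apply: eq_bigr => j _; rewrite -mulrBr.
have PB y : y <= 2 -> `|PhiP y| <= B.
  have [y0|y0] := leP y 0; first by rewrite PhiP0// normr0.
  by move=> y2; rewrite PhiPE//; exact: H1.
rewrite /envelope; have [s1|s1] := ltP 1 s.
  rewrite !PhiP0 ?subrr ?normr0 ?mulr0//.
    by rewrite oppr_le0 (le_trans ler01 (ltW s1)).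
  by rewrite subr_le0 (le_trans u1 (ltW s1)).
have [sm1|sm1] := leP (-1) s.
  rewrite mulr1 mulr_natl mulr2n; apply: (le_trans (ler_normB _ _)).
  by apply: lerD; apply: PB; lra.
have s0 : 1 < - s by lra.
rewrite !PhiPE; [|lra|lra].
have [|||c] := @MVT_segment R Phi (fun y => \sum_(j < n) w j * ((v j - alpha^-1) * y `^ (v j - alpha^-1 - 1))) (- s) (u - s) _ _ _.
- lra.
- move=> y; rewrite in_itv/= => /andP[ys _]; apply: (@is_derive_comb n w (fun j => v j - alpha^-1)).
  by rewrite (lt_trans _ ys)// (lt_trans _ s0).
- apply: continuous_in_subspaceT => y; rewrite inE/= in_itv/= => /andP[ys _].
  apply/differentiable_continuous/derivable1_diffP.
  have y0 : 0 < y by rewrite (lt_le_trans _ ys)// (lt_trans _ s0).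
  by have [] := is_derive_comb n w (fun j => v j - alpha^-1) y0.
rewrite in_itv/= => /andP[cs _] ->.
have c0 : 0 < - s by exact: lt_trans s0.
have -> : u - s - - s = u by ring.
rewrite normrM (ger0_norm u0).
apply: (@le_trans _ _ (B * c `^ (- p))).
  rewrite -[leRHS]mulr1 ler_pM//; apply: H2; exact: le_trans (ltW s0) cs.
rewrite -mulrA mulr_natl mulr2n -[leLHS]addr0 lerD ?mulr_ge0 ?powR_ge0// ler_wpM2l//.
rewrite !powRN lef_pV2 ?posrE ?powR_gt0//; last exact: lt_le_trans cs.
by apply: ge0_ler_powR; rewrite ?nnegrE ?(ltW c0)// (le_trans (ltW c0) cs).
Qed.

Variables h1 h2 : R.
Hypotheses (h1a : alpha^-1 < h1) (h12 : h1 <= h2) (h21 : h2 < 1).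

(** The kernel with parameter v decays like (-s)^(v - 1/alpha - 1).  Taking
    v = (h2 + 1) / 2 instead of h2 leaves room for the logarithms produced by
    interpolation, and for nodes slightly above h2, while the envelope remains in
    the space of alpha-integrable functions. *)
Definition tail_exponent : R := 1 - ((h2 + 1) / 2 - alpha^-1).

Let ai0 : 0 < alpha^-1. Proof. by rewrite invr_gt0 (lt_trans ltr01). Qed.

Let kp : [/\ alpha^-1 < h1, h1 <= h2, h2 < 1 & 0 < alpha^-1].
Proof. by split. Qed.

Lemma tail_exponent_gt : 1 < tail_exponent * alpha.
Proof.
have a0 : 0 < alpha by rewrite (lt_trans ltr01).
rewrite /tail_exponent (_ : _ * alpha = 1 + alpha * (1 - (h2 + 1) / 2)); last by field; rewrite gt_eqF.
by rewrite ltrDl mulr_gt0//; have [? ? ? ?] := kp; lra.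
Qed.

Lemma tail_exponent_ge0 : 0 <= tail_exponent.
Proof. by have [? ? ? ?] := kp; rewrite /tail_exponent; lra. Qed.

Lemma kernel_le_envelope (u v s : R) : 0 <= u <= 1 -> h1 <= v <= (h2 + 1) / 2 ->
  `|lmsm_kernel alpha u v s| <= 4 * envelope tail_exponent 1 s.
Proof.
move=> u01 /andP[v1 v2]; have [? ? ? ?] := kp.
have := @kernel_comb_le_envelope 1 (fun=> 1) (fun=> v) 2 tail_exponent u s _ tail_exponent_ge0 u01.
rewrite !big_ord1 !mul1r (_ : 2 * 2 = 4 :> R); last by ring.
apply => // y.
  move=> y0 y2; rewrite big_ord1 mul1r ger0_norm ?powR_ge0//.
  have [y1|/ltW y1] := leP y 1.
    apply: (@le_trans _ _ 1); last by rewrite ler1n.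
    rewrite -(powRr0 y) ger_powR ?y0//; lra.
  apply: (@le_trans _ _ (y `^ 1)); last by rewrite powRr1// ltW.
  by rewrite ler_powR//; lra.
move=> y1; rewrite big_ord1 mul1r normrM (ger0_norm (powR_ge0 _ _)).
apply: ler_pM; rewrite ?powR_ge0//.
  by rewrite ger0_norm; lra.
by apply: ler_powR => //; rewrite /tail_exponent; lra.
Qed.

(** Combines [moment_powR] for the function and its derivative with the bound by
    the envelope.  The logarithms are absorbed in a change of the exponents by
    2 e, which is affordable because h1 > 1/alpha near the singularities and
    h2 < 1 at infinity. *)
Lemma kernel_comb_small (m : nat) : exists C eta0 : R, [/\ 0 <= C, 0 < eta0 &
  forall (n : nat) (w v : nat -> R) (v0 eta W : R),
    h1 <= v0 <= h2 -> 0 <= eta <= eta0 ->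
    (forall r, (r < m.+1)%N -> \sum_(j < n) w j * (v j - v0) ^+ r = 0) ->
    (forall j, (j < n)%N -> `|v j - v0| <= eta) ->
    \sum_(j < n) `|w j| <= W ->
    forall u s, 0 <= u <= 1 ->
    `|\sum_(j < n) w j * lmsm_kernel alpha u (v j) s| <= C * W * eta ^+ m.+1 * envelope tail_exponent 1 s].
Proof.
have [? ? ? ?] := kp.
(* the share of the exponents that is given up for logarithms *)
pose e := Num.min (h1 - alpha^-1) (1 - h2) / 8.
have e0 : 0 < e by rewrite divr_gt0// lt_min !subr_gt0 h1a h21.
have e1 : e <= (h1 - alpha^-1) / 8 by rewrite ler_wpM2r// ge_min lexx.
have e2 : e <= (1 - h2) / 8 by rewrite ler_wpM2r// ge_min lexx orbT.
pose D := (m.+1)`!%:R * e ^- m.+1 + m`!%:R * e ^- m.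
have D1 : 0 <= (m.+1)`!%:R * e ^- m.+1 by rewrite mulr_ge0// invr_ge0 exprn_ge0// ltW.
have D2 : 0 <= m`!%:R * e ^- m by rewrite mulr_ge0// invr_ge0 exprn_ge0// ltW.
have D0 : 0 <= D by exact: addr_ge0.
exists (4 * D), e; split => //; first by rewrite mulr_ge0.
move=> n w v v0 eta W /andP[v01 v02] /andP[eta0 etae] hr he hW u s u01.
have W0 : 0 <= W by apply: le_trans hW; apply: sumr_ge0.
have expE k (t : R) : 0 <= t ->
    (eta * t) ^+ k * expR (eta * t) <= eta ^+ k * (k`!%:R * e ^- k) * expR ((e + e) * t).
  move=> t0; rewrite exprMn -!mulrA ler_wpM2l ?exprn_ge0// mulrDl expRD !mulrA.
  apply: ler_pM; rewrite ?exprn_ge0 ?expR_ge0//; last by rewrite ler_expR ler_wpM2r.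
  exact: expn_le_exp.
have -> : 4 * D * W * eta ^+ m.+1 = 2 * (2 * (D * W * eta ^+ m.+1)) by ring.
apply: kernel_comb_le_envelope => //; first by rewrite !mulr_ge0// exprn_ge0.
- exact: tail_exponent_ge0.
- move=> y y0 y2.
  apply: (le_trans (@moment_powR R n m.+1 w (fun j => v j - alpha^-1) (v0 - alpha^-1) eta y y0 _ _)).
  + move=> r rm; rewrite -[RHS](hr r rm); apply: eq_bigr => j _; congr (_ * _ ^+ _); ring.
  + by move=> j jn; rewrite (_ : _ - _ - _ = v j - v0) ?he//; ring.
  rewrite -!mulrA.
  have h : y `^ (v0 - alpha^-1) * expR ((e + e) * `|ln y|) <= 2.
    rewrite [y `^ _]/powR gt_eqF// -expRD.
    have [y1|/ltW y1] := leP y 1.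
      rewrite (ler0_norm (ln_le0 y1)) (_ : _ + _ = (v0 - alpha^-1 - (e + e)) * ln y); last by ring.
      apply: (@le_trans _ _ 1); last by rewrite ler1n.
      rewrite -expR0 ler_expR; apply: mulr_ge0_le0; last exact: ln_le0.
      lra.
    rewrite (ger0_norm (ln_ge0 y1)) -mulrDl.
    apply: (@le_trans _ _ (expR (1 * ln y))); last by rewrite mul1r lnK.
    by rewrite ler_expR ler_wpM2r ?ln_ge0//; lra.
  apply: (@le_trans _ _ (y `^ (v0 - alpha^-1) * (W * (eta ^+ m.+1 * (D * expR ((e + e) * `|ln y|)))))).
    rewrite ler_wpM2l ?powR_ge0//; apply: ler_pM => //.
    - exact: sumr_ge0.
    - by rewrite mulr_ge0 ?expR_ge0// exprn_ge0// mulr_ge0.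
    - apply: (le_trans (expE _ _ (normr_ge0 _))).
      rewrite -mulrA ler_wpM2l ?exprn_ge0// ler_wpM2r ?expR_ge0// /D lerDl//.
  rewrite (_ : _ * _ = (y `^ (v0 - alpha^-1) * expR ((e + e) * `|ln y|)) * (D * (W * eta ^+ m.+1))); last by ring.
  by rewrite ler_wpM2r// !mulr_ge0// exprn_ge0.
- move=> y y1.
  have y0 : 0 < y by rewrite (lt_le_trans _ y1).
  have ly : 0 <= ln y by exact: ln_ge0.
  rewrite (_ : \sum_(j < n) _ = (v0 - alpha^-1) * (\sum_(j < n) w j * y `^ (v j - alpha^-1 - 1)) +
     \sum_(j < n) (w j * (v j - v0)) * y `^ (v j - alpha^-1 - 1)); last first.
    by rewrite mulr_sumr -big_split; apply: eq_bigr => j _ /=; ring.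
  have B1 := @moment_powR R n m.+1 w (fun j => v j - alpha^-1 - 1) (v0 - alpha^-1 - 1) eta y y0.
  have B2 := @moment_powR R n m (fun j => w j * (v j - v0)) (fun j => v j - alpha^-1 - 1) (v0 - alpha^-1 - 1) eta y y0.
  have {}B1 := B1 _ _.
  have C1 r : (r < m.+1)%N -> \sum_(j < n) w j * (v j - alpha^-1 - 1 - (v0 - alpha^-1 - 1)) ^+ r = 0.
    by move=> rm; rewrite -[RHS](hr r rm); apply: eq_bigr => j _; congr (_ * _ ^+ _); ring.
  have C2 r : (r < m)%N -> \sum_(j < n) (w j * (v j - v0)) * (v j - alpha^-1 - 1 - (v0 - alpha^-1 - 1)) ^+ r = 0.
    move=> rm; rewrite -[RHS](hr r.+1 rm); apply: eq_bigr => j _.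
    rewrite exprS mulrA; congr (_ * _ ^+ _); ring.
  have C3 j : (j < n)%N -> `|v j - alpha^-1 - 1 - (v0 - alpha^-1 - 1)| <= eta.
    by move=> jn; rewrite (_ : _ - _ = v j - v0) ?he//; ring.
  have {}B1 := B1 C1 C3. have {}B2 := B2 C2 C3.
  rewrite (ger0_norm ly) in B1 B2.
  apply: (le_trans (ler_normD _ _)).
  have h : y `^ (v0 - alpha^-1 - 1) * expR ((e + e) * ln y) <= y `^ (- tail_exponent).
    have -> : expR ((e + e) * ln y) = y `^ (e + e) by rewrite /powR gt_eqF.
    by rewrite -gt0_powRD// ler_powR// /tail_exponent; lra.
  have W2 : \sum_(j < n) `|w j * (v j - v0)| <= eta * W.
    apply: (@le_trans _ _ (\sum_(j < n) eta * `|w j|)); last by rewrite -mulr_sumr ler_wpM2l.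
    by apply: ler_sum => j _; rewrite normrM mulrC ler_wpM2r// he.
  have Q1 : `|(v0 - alpha^-1) * (\sum_(j < n) w j * y `^ (v j - alpha^-1 - 1))| <=
     W * eta ^+ m.+1 * ((m.+1)`!%:R * e ^- m.+1) * y `^ (- tail_exponent).
    rewrite normrM -[leRHS]mul1r; apply: ler_pM => //; first by rewrite ger0_norm; lra.
    apply: (le_trans B1); rewrite -!mulrA.
    apply: (@le_trans _ _ (y `^ (v0 - alpha^-1 - 1) * (W * (eta ^+ m.+1 * ((m.+1)`!%:R * e ^- m.+1) * expR ((e + e) * ln y))))).
      rewrite ler_wpM2l ?powR_ge0//; apply: ler_pM => //.
      + exact: sumr_ge0.
      + by rewrite mulr_ge0 ?expR_ge0// exprn_ge0// mulr_ge0.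
      + exact: expE.
    rewrite (_ : _ * _ = (y `^ (v0 - alpha^-1 - 1) * expR ((e + e) * ln y)) * (W * (eta ^+ m.+1 * ((m.+1)`!%:R * e ^- m.+1)))); last by ring.
    rewrite [leRHS](_ : _ = y `^ (- tail_exponent) * (W * (eta ^+ m.+1 * ((m.+1)`!%:R * e ^- m.+1)))); last by ring.
    by rewrite ler_wpM2r// !mulr_ge0// ?exprn_ge0// ?invr_ge0 ?exprn_ge0// ltW.
  have Q2 : `|\sum_(j < n) (w j * (v j - v0)) * y `^ (v j - alpha^-1 - 1)| <=
     W * eta ^+ m.+1 * (m`!%:R * e ^- m) * y `^ (- tail_exponent).
    apply: (le_trans B2); rewrite -!mulrA.
    apply: (@le_trans _ _ (y `^ (v0 - alpha^-1 - 1) * ((eta * W) * (eta ^+ m * (m`!%:R * e ^- m) * expR ((e + e) * ln y))))).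
      rewrite ler_wpM2l ?powR_ge0//; apply: ler_pM => //.
      + exact: sumr_ge0.
      + by rewrite mulr_ge0 ?expR_ge0// exprn_ge0// mulr_ge0.
      + exact: expE.
    rewrite (_ : _ * _ = (y `^ (v0 - alpha^-1 - 1) * expR ((e + e) * ln y)) * (W * (eta ^+ m.+1 * (m`!%:R * e ^- m)))); last by rewrite exprS; ring.
    rewrite [leRHS](_ : _ = y `^ (- tail_exponent) * (W * (eta ^+ m.+1 * (m`!%:R * e ^- m)))); last by ring.
    by rewrite ler_wpM2r// !mulr_ge0// ?exprn_ge0// ?invr_ge0 ?exprn_ge0// ltW.
  apply: (le_trans (lerD Q1 Q2)).
  rewrite [leLHS](_ : _ = (D * W * eta ^+ m.+1) * y `^ (- tail_exponent)); last by rewrite /D; ring.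
  rewrite ler_wpM2r ?powR_ge0// mulr_natl mulr2n lerDl !mulr_ge0// exprn_ge0//.
Qed.

(** [v'] and the nodes v + i delta, weighted by 1 and by minus the Lagrange
    coefficients, form a system whose moments about [v] of order at most [m]
    vanish. *)
Lemma kernel_interp (m : nat) : exists C delta0 : R, [/\ 0 <= C, 0 < delta0 &
  forall v v' delta : R, h1 <= v <= h2 -> 0 < delta <= delta0 -> `|v' - v| <= delta ->
  exists c : nat -> R, (forall i, (i < m.+1)%N -> `|c i - (i == 0)%:R| <= C * (`|v' - v| / delta)) /\
   forall u s, 0 <= u <= 1 ->
   `|lmsm_kernel alpha u v' s - \sum_(i < m.+1) c i * lmsm_kernel alpha u (v + i%:R * delta) s|
     <= C * delta ^+ m.+1 * envelope tail_exponent 1 s].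
Proof.
have [C1 C10 HL] := @lagrange_coefs R m.+1.
have [C2 [eta0 [C20 eta00 HK]]] := kernel_comb_small m.
pose M : R := m.+1%:R.
have M0 : 0 < M by rewrite ltr0n.
pose W : R := 1 + M * (1 + C1).
have W0 : 0 <= W by rewrite addr_ge0// mulr_ge0 ?addr_ge0// ltW.
exists (C1 + C2 * W * M ^+ m.+1), (eta0 / M); split.
- by rewrite addr_ge0// !mulr_ge0// exprn_ge0// ltW.
- by rewrite divr_gt0.
move=> v v' delta hv /andP[d0 dd] vv'.
pose y := (v' - v) / delta.
have ye : y * delta = v' - v by rewrite /y divfK// gt_eqF.
have ny : `|y| = `|v' - v| / delta by rewrite /y normrM normfV (gtr0_norm d0).
have y1 : `|y| <= 1 by rewrite ny ler_pdivrMr// mul1r.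
have [c [cr ci]] := HL y y1.
exists c; split.
  move=> i im; rewrite -ny; apply: (le_trans (ci i im)).
  by rewrite ler_wpM2r// lerDl !mulr_ge0// exprn_ge0// ltW.
move=> u s u01.
(* index m.+1 stands for the target, the smaller ones for the nodes *)
pose w (j : nat) : R := if (j < m.+1)%N then - c j else 1.
pose vv (j : nat) : R := if (j < m.+1)%N then v + j%:R * delta else v'.
have E (F : R -> R) : \sum_(j < m.+2) w j * F (vv j) = F v' - \sum_(i < m.+1) c i * F (v + i%:R * delta).
  rewrite big_ord_recr/= /w /vv ltnn mul1r addrC; congr (_ + _).
  by rewrite -sumrN; apply: eq_bigr => i _; rewrite ltn_ord mulNr.
rewrite -(E (fun v => lmsm_kernel alpha u v s)).
apply: (le_trans (HK m.+2 w vv v (M * delta) W hv _ _ _ _ u s u01)).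
- by apply/andP; split; [rewrite mulr_ge0// ltW | rewrite mulrC -ler_pdivlMr].
- move=> r rm; rewrite (E (fun x => (x - v) ^+ r)).
  rewrite (eq_bigr (fun i : 'I_m.+1 => (c i * i%:R ^+ r) * delta ^+ r)); last first.
    by move=> i _; rewrite addrAC subrr add0r exprMn mulrA.
  by rewrite -mulr_suml cr// -exprMn ye subrr.
- move=> j jm; rewrite /vv; case: ifP => jm1.
    rewrite addrAC subrr add0r normrM normr_nat (gtr0_norm d0) ler_wpM2r ?(ltW d0)//.
    by rewrite ler_nat ltnW.
  apply: (le_trans vv'); rewrite -[leLHS]mul1r ler_wpM2r ?(ltW d0)//.
  by rewrite ler1n.
- rewrite big_ord_recr/= /w ltnn normr1 addrC lerD2l.
  apply: (@le_trans _ _ (\sum_(i < m.+1) (1 + C1))); last by rewrite sumr_const card_ord mulr_natl.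
  apply: ler_sum => i _; rewrite ltn_ord normrN.
  rewrite -[c i](subrK (i == 0 :> nat)%:R) addrC; apply: (le_trans (ler_normD _ _)).
  apply: lerD; first by rewrite normr_nat lern1; case: (_ == _).
  apply: (le_trans (ci i (ltn_ord i))).
  by rewrite -[leRHS]mulr1 ler_wpM2l.
rewrite ler_wpM2r ?envelope_ge0// exprMn mulrA ler_wpM2r ?exprn_ge0 ?(ltW d0)//.
by rewrite lerDr.
Qed.

End kernel.

(** * Kernels of the generalized increments *)

Section finite_difference.
Context {R : realType}.

Definition fd_coef (L l : nat) : R := (-1) ^+ (L - l) * 'C(L, l)%:R.

Definition fd (L : nat) (f : R -> R) (y : R) : R :=
  \sum_(l < L.+1) fd_coef L l * f (y + l%:R).

Lemma fd0 f y : fd 0 f y = f y.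
Proof. by rewrite /fd big_ord1 /fd_coef subn0 expr0 bin0 !mul1r addr0. Qed.

Lemma fd_comb_S (L : nat) (F : nat -> R) :
  \sum_(l < L.+2) fd_coef L.+1 l * F l =
  \sum_(l < L.+1) fd_coef L l * F l.+1 - \sum_(l < L.+1) fd_coef L l * F l.
Proof.
rewrite big_ord_recl /=.
rewrite (eq_bigr (fun l : 'I_L.+1 => fd_coef L l * F l.+1 +
   (-1) ^+ (L - l) * 'C(L, l.+1)%:R * F l.+1)); last first.
  move=> l _; rewrite /bump leq0n add1n /fd_coef subSS binS natrD; ring.
rewrite big_split/= addrCA; congr (_ + _).
rewrite big_ord_recr/= bin_small// mulr0 mul0r addr0 [in RHS]big_ord_recl/= opprD.
congr (_ + _).
  by rewrite /fd_coef !subn0 !bin0 exprS; ring.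
rewrite -sumrN; apply: eq_bigr => l _; rewrite /bump leq0n add1n /fd_coef.
have -> : (L - l = (L - l.+1).+1)%N by rewrite subnSK.
by rewrite exprS; ring.
Qed.

Lemma fdS L f y : fd L.+1 f y = fd L f (y + 1) - fd L f y.
Proof.
rewrite /fd (fd_comb_S L (fun l => f (y + l%:R))); congr (_ - _).
by apply: eq_bigr => l _; rewrite -natr1 [l%:R + 1]addrC addrA.
Qed.

Lemma fd_coef_sum L : (0 < L)%N -> \sum_(l < L.+1) fd_coef L l = 0.
Proof.
case: L => // L _; have := fd_comb_S L (fun=> 1); rewrite subrr => E.
by rewrite -[RHS]E; apply: eq_bigr => l _; rewrite mulr1.
Qed.

Lemma is_derive_fd (L : nat) (c y : R) : 0 < y ->
  is_derive y 1 (fd L (fun x => x `^ c)) (c * fd L (fun x => x `^ (c - 1)) y).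
Proof.
move=> y0.
have := @is_derive_sum R R R L.+1 (fun l => (fun x : R => fd_coef L l * (x + l%:R) `^ c)) y 1
  (fun l => fd_coef L l * (c * (y + l%:R) `^ (c - 1))).
rewrite (_ : \sum_(i < L.+1) _ = fd L (fun x => x `^ c)); last first.
  by apply/funext => x; rewrite fct_sumE.
rewrite (_ : \sum_(i < L.+1) _ = c * fd L (fun x => x `^ (c - 1)) y); last first.
  by rewrite /fd mulr_sumr; apply: eq_bigr => l _; rewrite mulrCA.
apply => l; apply: is_deriveZ.
have yl : 0 < y + l%:R by rewrite ltr_pwDl.
rewrite -[X in is_derive _ _ _ X]mulr1.
apply: (@is_derive1_comp R (fun x => x `^ c) (fun x => x + l%:R)).
  exact: is_derive_powR.
rewrite -[X in is_derive _ _ _ X]addr0; apply: is_deriveD.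
Qed.

(** Each difference step gains one derivative, hence one power of 1/y, by the
    mean value theorem. *)
Lemma fd_powR_le (L : nat) (c y : R) : 0 < y -> c <= 1 ->
  `|fd L (fun x => x `^ c) y| <= (`|c| + L%:R) ^+ L * y `^ (c - L%:R).
Proof.
elim: L c y => [|L IH] c y y0 c1.
  by rewrite fd0 expr0 mul1r subr0 ger0_norm ?powR_ge0.
rewrite fdS.
have [|||x] := @MVT_segment R (fd L (fun x => x `^ c)) (fun x => c * fd L (fun x => x `^ (c - 1)) x) y (y + 1).
- by rewrite lerDl.
- by move=> x; rewrite in_itv/= => /andP[yx _]; apply: is_derive_fd; exact: lt_trans yx.
- apply: continuous_in_subspaceT => x; rewrite inE/= in_itv/= => /andP[yx _].
  apply/differentiable_continuous/derivable1_diffP.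
  by have [] := is_derive_fd L c (lt_le_trans y0 yx).
rewrite in_itv/= => /andP[yx _] ->.
have x0 := lt_le_trans y0 yx.
rewrite addrAC subrr add0r mulr1 normrM exprS -mulrA.
have c2 : c - 1 <= 1 by rewrite (le_trans _ c1)// gerBl.
apply: ler_pM => //; first by rewrite lerDl.
apply: (le_trans (IH _ _ x0 c2)).
apply: ler_pM; rewrite ?exprn_ge0 ?addr_ge0 ?powR_ge0//.
  rewrite lerXn2r ?nnegrE ?addr_ge0//.
  rewrite -natr1 [_ + 1]addrC addrA lerD2r.
  by apply: (le_trans (ler_normB _ _)); rewrite normr1.
rewrite -natr1 opprD addrA addrAC.
have -> : c - 1 - L%:R = - (L%:R + 1 - c) by ring.
rewrite !powRN lef_pV2 ?posrE ?powR_gt0//.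
by apply: ge0_ler_powR; rewrite ?nnegrE ?(ltW x0) ?(ltW y0)// subr_ge0 (le_trans c1)// lerDr.
Qed.

End finite_difference.

Section increments.
Context {R : realType} (alpha h1 h2 : R) (L : nat).
Hypotheses (alpha1 : 1 < alpha) (h1a : alpha^-1 < h1) (h12 : h1 <= h2) (h21 : h2 < 1).
Hypothesis L2 : (2 <= L)%N.

Let kp : [/\ alpha^-1 < h1, h1 <= h2, h2 < 1 & 0 < alpha^-1].
Proof. by split => //; rewrite invr_gt0 (lt_trans ltr01). Qed.

(** Kernel of the generalized increment, up to the dilation and translation
    performed by [rescaled]. *)
Definition Phi (v s : R) : R :=
  \sum_(l < L.+1) fd_coef L l * pos_pow (l%:R - s) (v - alpha^-1).

(** The cut at distance [M] to the left: the inner part has compact support, and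
    the outer part has a small norm. *)
Definition Phi_in (M : nat) (v s : R) : R := if - M%:R <= s then Phi v s else 0.
Definition Phi_out (M : nat) (v s : R) : R := if - M%:R <= s then 0 else Phi v s.

Local Notation p := (tail_exponent alpha h2).
Local Notation D := (envelope p L%:R).

Lemma Phi_eq0 v s : L%:R <= s -> Phi v s = 0.
Proof.
move=> Ls; rewrite /Phi big1// => l _; rewrite /pos_pow ifF ?mulr0//.
apply/negbTE; rewrite -leNgt subr_le0 (le_trans _ Ls)// ler_nat.
by rewrite -ltnS.
Qed.

Lemma measurable_Phi v : measurable_fun [set: R] (Phi v).
Proof.
apply: measurable_sum => l; apply: measurable_funM => //.
have mm : measurable_fun [set: R] ((fun x : R => pos_pow x (v - alpha^-1)) \o (fun s => l%:R - s)).
  by apply: measurableT_comp; [exact: measurable_pos_pow|exact: measurable_funB].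
exact: mm.
Qed.

Lemma measurable_Phi_in M v : measurable_fun [set: R] (Phi_in M v).
Proof. by apply: measurable_fun_ifT => //; [exact: measurable_fun_ler|exact: measurable_Phi]. Qed.

Lemma measurable_Phi_out M v : measurable_fun [set: R] (Phi_out M v).
Proof. by apply: measurable_fun_ifT => //; [exact: measurable_fun_ler|exact: measurable_Phi]. Qed.

Lemma Phi_tail v s : h1 <= v <= h2 -> s < 0 ->
  `|Phi v s| <= (1 + L%:R) ^+ L * (- s) `^ (v - alpha^-1 - L%:R).
Proof.
move=> /andP[v1 v2] s0; have [? ? ? ?] := kp.
have sp : 0 < - s by rewrite oppr_gt0.
have -> : Phi v s = fd L (fun x => x `^ (v - alpha^-1)) (- s).
  apply: eq_bigr => l _; rewrite /pos_pow addrC ifT//.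
  by rewrite ltr_wpDr.
apply: (le_trans (@fd_powR_le R L (v - alpha^-1) _ sp _)); first by lra.
rewrite ler_wpM2r ?powR_ge0// lerXn2r ?nnegrE ?addr_ge0// lerD2r ger0_norm; lra.
Qed.

Definition Phi_bound : R := (\sum_(l < L.+1) `|fd_coef L l : R|) * (L.+1%:R) + (1 + L%:R) ^+ L.

Lemma Phi_bound_ge0 : 0 <= Phi_bound.
Proof. by rewrite addr_ge0 ?exprn_ge0 ?addr_ge0// mulr_ge0// sumr_ge0. Qed.

Let Lr : 2 <= L%:R :> R. Proof. by rewrite ler_nat. Qed.

Lemma Phi_le_envelope v s : h1 <= v <= h2 -> `|Phi v s| <= Phi_bound * `|D s|.
Proof.
move=> hv; have /andP[v1 v2] := hv; have [? ? ? ?] := kp; have hL := Lr.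
rewrite (ger0_norm (envelope_ge0 _ _ _)) /envelope; have [Ls|sL] := ltP (L%:R : R) s.
  by rewrite Phi_eq0 ?(ltW Ls)// normr0 mulr0.
have [s1|s1] := leP (-1) s.
  rewrite mulr1 /Phi_bound -[leLHS]addr0; apply: lerD; last by rewrite exprn_ge0// addr_ge0.
  apply: (le_trans (ler_norm_sum _ _ _)); rewrite mulr_suml; apply: ler_sum => l _.
  rewrite normrM ler_wpM2l// ger0_norm ?pos_pow_ge0// /pos_pow.
  case: ifP => // ls.
  have l1 : l%:R - s <= L.+1%:R.
    rewrite -natr1; apply: lerD; first by rewrite ler_nat -ltnS.
    lra.
  have [le1|/ltW le1] := leP (l%:R - s) 1.
    apply: (@le_trans _ _ 1); last by rewrite ler1n.
    have : (l%:R - s) `^ (v - alpha^-1) <= (l%:R - s) `^ 0.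
      by apply: ger_powR; [rewrite ls|lra].
    by rewrite powRr0.
  apply: le_trans l1; rewrite -[leRHS]powRr1 ?(ltW ls)// ler_powR//; lra.
rewrite /Phi_bound mulrDl -[leLHS]add0r; apply: lerD.
  by rewrite !mulr_ge0 ?powR_ge0// sumr_ge0.
apply: (le_trans (Phi_tail hv _)); first lra.
apply: ler_wpM2l; first by rewrite exprn_ge0 ?addr_ge0.
by apply: ler_powR; rewrite /tail_exponent; lra.
Qed.

Lemma envelope_L_Lalpha : D \in Lalpha alpha.
Proof.
apply: envelope_Lalpha => //; first exact: (tail_exponent_gt alpha1 h1a h12 h21).
by rewrite ler1n; exact: leq_trans L2.
Qed.

Lemma Phi_Lalpha v : h1 <= v <= h2 -> Phi v \in Lalpha alpha /\
  Lalpha_norm alpha (Phi v) <= Phi_bound * Lalpha_norm alpha D.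
Proof.
move=> hv; apply: Lalpha_dominated => //; [exact: Phi_bound_ge0|exact: measurable_Phi|exact: envelope_L_Lalpha|].
by move=> s; exact: Phi_le_envelope.
Qed.

Lemma Phi_in_Lalpha M v : h1 <= v <= h2 -> Phi_in M v \in Lalpha alpha /\
  Lalpha_norm alpha (Phi_in M v) <= Lalpha_norm alpha (Phi v).
Proof.
move=> hv; rewrite -[Lalpha_norm alpha (Phi v)]mul1r.
apply: Lalpha_dominated => //; [exact: measurable_Phi_in|exact: (Phi_Lalpha hv).1|].
by move=> s; rewrite mul1r /Phi_in; case: ifP => // _; rewrite normr0.
Qed.

(** At distance r >= M the L-th difference is O(r^(v - 1/alpha - L)), of which the
    factor r^(-(L - 2)) is taken out as M^(-(L - 2)); what is left is below the
    envelope. *)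
Lemma Phi_out_Lalpha M v : h1 <= v <= h2 -> (0 < M)%N ->
  Phi_out M v \in Lalpha alpha /\
  Lalpha_norm alpha (Phi_out M v) <= Phi_bound * M%:R ^- (L - 2) * Lalpha_norm alpha D.
Proof.
move=> hv M0; have /andP[v1 v2] := hv; have [? ? ? ?] := kp; have hL := Lr.
have Mr : 1 <= M%:R :> R by rewrite ler1n.
have K0 : 0 <= Phi_bound * M%:R ^- (L - 2) by rewrite mulr_ge0 ?Phi_bound_ge0// invr_ge0 exprn_ge0.
apply: Lalpha_dominated => //; [exact: measurable_Phi_out|exact: envelope_L_Lalpha|].
move=> s; rewrite /Phi_out; have [_|sM] := leP (- M%:R) s.
  by rewrite normr0 mulr_ge0.
have s1 : 1 < - s by lra.
rewrite (ger0_norm (envelope_ge0 _ _ _)) /envelope ifF; last by apply/negbTE; rewrite -leNgt; lra.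
rewrite ifF; last by apply/negbTE; rewrite -ltNge; lra.
apply: (le_trans (Phi_tail hv _)); first lra.
have -> : (- s) `^ (v - alpha^-1 - L%:R) = (- s) ^- (L - 2) * (- s) `^ (v - alpha^-1 - 2).
  rewrite -powR_invn; last lra.
  rewrite -gt0_powRD; last lra.
  by congr (_ `^ _); rewrite natrB//; ring.
rewrite mulrA ler_pM ?powR_ge0 ?mulr_ge0 ?exprn_ge0 ?addr_ge0 ?invr_ge0 ?exprn_ge0//; first lra.
  apply: ler_pM; rewrite ?exprn_ge0 ?addr_ge0 ?invr_ge0 ?exprn_ge0//; first lra.
    by rewrite /Phi_bound lerDr mulr_ge0// sumr_ge0.
  have p1 : 0 < M%:R :> R by lra.
  have p2 : 0 < - s by lra.
  rewrite lef_pV2 ?posrE ?exprn_gt0//.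
  by rewrite lerXn2r ?nnegrE; lra.
by rewrite ler_powR /tail_exponent; lra.
Qed.

(** On [L - 1, L) only the term l = L of the difference is nonzero, and it is
    (L - s)^(v - 1/alpha); the part of this interval to the left of L - 1/2 already
    carries enough mass, uniformly in [v]. *)
Lemma Phi_norm_ge v : h1 <= v <= h2 -> 8^-1 <= Lalpha_norm alpha (Phi v).
Proof.
move=> hv; have /andP[v1 v2] := hv; have [? ? ? ?] := kp.
have a0 : 0 < alpha by exact: lt_trans alpha1.
have LP := (Phi_Lalpha hv).1.
have H : ((2^-1 `^ alpha * 2^-1)%:E <= pow_integral alpha (Phi v))%E.
  apply: (@le_trans _ _ (\int[@lebesgue_measure R]_(s in `[(L%:R - 1)%R, (L%:R - 2^-1)%R]) (2^-1 `^ alpha)%:E)%E).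
    rewrite integral_cst//= lebesgue_measure_itv/= lte_fin ifT; last lra.
    by rewrite -EFinB -EFinM lee_fin ler_wpM2l ?powR_ge0//; lra.
  apply: (@le_trans _ _ (\int[@lebesgue_measure R]_(s in `[(L%:R - 1)%R, (L%:R - 2^-1)%R]) (`|Phi v s| `^ alpha)%:E)%E).
    apply: ge0_le_integral => //.
    - by apply: measurable_funTS; apply/measurable_EFinP/measurable_norm_powR; exact: measurable_Phi.
    move=> s /=; rewrite in_itv/= => /andP[s1 s2]; rewrite lee_fin.
    apply: ge0_ler_powR; rewrite ?nnegrE ?(ltW a0)//.
    have -> : Phi v s = (L%:R - s) `^ (v - alpha^-1).
      rewrite /Phi big_ord_recr/= big1 ?add0r.
        rewrite /fd_coef subnn expr0 binn !mul1r /pos_pow ifT//; lra.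
      move=> l _; rewrite /pos_pow ifF ?mulr0//; apply/negbTE; rewrite -leNgt.
      have : l.+1%:R <= L%:R :> R by rewrite ler_nat.
      by rewrite -natr1; lra.
    rewrite ger0_norm ?powR_ge0//.
    apply: (@le_trans _ _ (L%:R - s)); first lra.
    rewrite -[leLHS]powRr1; last lra.
    apply: ger_powR; last lra.
    by apply/andP; split; lra.
  apply: ge0_subset_integral => //.
  by apply/measurable_EFinP/measurable_norm_powR; exact: measurable_Phi.
rewrite Lalpha_normE; rewrite [X in (_ <= X)%E](pow_integral_fine alpha1 LP) lee_fin in H.
have i0 : 0 <= alpha^-1 by rewrite invr_ge0 ltW.
apply: (@le_trans _ _ ((2^-1 `^ alpha * 2^-1) `^ alpha^-1)); last first.
  by apply: ge0_ler_powR => //; rewrite nnegrE ?mulr_ge0 ?powR_ge0 ?fine_ge0 ?pow_integral_ge0.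
rewrite powRM ?powR_ge0// -powRrM mulfV ?gt_eqF// powRr1//.
have : 2^-1 <= 2^-1 `^ alpha^-1 :> R.
  rewrite -[leLHS]powRr1//; apply: ger_powR; last lra.
  by apply/andP; split; lra.
lra.
Qed.

Definition rescaled (f : R -> R -> R) (N k : nat) (v s : R) : R :=
  N%:R `^ (- (v - alpha^-1)) * f v (N%:R * s + - k%:R).

Lemma rescaled_Lalpha (f : R -> R -> R) (N k : nat) (v : R) : (0 < N)%N ->
  f v \in Lalpha alpha -> rescaled f N k v \in Lalpha alpha /\
  Lalpha_norm alpha (rescaled f N k v) = N%:R `^ (- v) * Lalpha_norm alpha (f v).
Proof.
move=> N0 Lf; have N0' : 0 < N%:R :> R by rewrite ltr0n.
have [h ->] := @Lalpha_affine R alpha alpha1 _ N%:R (- k%:R) (N%:R `^ (- (v - alpha^-1))) N0' Lf (powR_ge0 _ _).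
split => //; congr (_ * _); rewrite -gt0_powRD//; congr (_ `^ _); ring.
Qed.

(** The dilation by N of x_+^(v - 1/alpha) produces N^(v - 1/alpha), which the
    normalization cancels, and the part of the kernel that does not depend on the
    time disappears since the coefficients of the difference sum to 0. *)
Lemma rescaled_PhiE (N k : nat) (v s : R) : (0 < N)%N ->
  rescaled Phi N k v s = \sum_(l < L.+1) fd_coef L l * lmsm_kernel alpha ((k + l)%:R / N%:R) v s.
Proof.
move=> N0; have N0' : 0 < N%:R :> R by rewrite ltr0n.
rewrite (eq_bigr (fun l : 'I_L.+1 => fd_coef L l * pos_pow ((k + l)%:R / N%:R - s) (v - alpha^-1) -
   fd_coef L l * pos_pow (- s) (v - alpha^-1))); last by move=> l _; rewrite -mulrBr.
rewrite sumrB -mulr_suml fd_coef_sum ?mul0r ?subr0; last exact: ltn_trans L2.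
rewrite /rescaled /Phi mulr_sumr; apply: eq_bigr => l _.
rewrite mulrCA; congr (_ * _).
have -> : l%:R - (N%:R * s + - k%:R) = N%:R * ((k + l)%:R / N%:R - s).
  by rewrite natrD; field; rewrite gt_eqF.
by rewrite pos_powM// mulrA powRN mulVf ?mul1r// gt_eqF// powR_gt0.
Qed.

Lemma Phi_split M v s : Phi_in M v s + Phi_out M v s = Phi v s.
Proof. by rewrite /Phi_in /Phi_out; case: ifP; rewrite ?addr0 ?add0r. Qed.

Lemma rescaled_split M N k v s :
  rescaled (Phi_in M) N k v s + rescaled (Phi_out M) N k v s = rescaled Phi N k v s.
Proof. by rewrite /rescaled -mulrDr Phi_split. Qed.

Lemma rescaled_in_disjoint M N k k' v v' s : (k + L + M <= k')%N ->
  rescaled (Phi_in M) N k v s * rescaled (Phi_in M) N k' v' s = 0.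
Proof.
move=> kk'; rewrite /rescaled /Phi_in.
have [h1'|h1'] := leP (- M%:R : R) (N%:R * s + - k'%:R); last by rewrite mulr0 mulr0.
have kr : k%:R + L%:R + M%:R <= k'%:R :> R by rewrite -!natrD ler_nat.
rewrite [Phi v _]Phi_eq0; last lra.
by rewrite [if _ then _ else _](_ : _ = 0) ?mulr0 ?mul0r//; case: ifP.
Qed.

End increments.

(** * Borel-Cantelli, subadditivity of powers and stable integrals *)

Section borel_cantelli.
Context d (T : measurableType d) (R : realType) (P : probability T R).

Lemma powR_series_fin (th : R) : 1 < th ->
  (\sum_(0 <= n <oo) ((n.+2%:R : R) `^ (- th))%:E < +oo)%E.
Proof.
move=> th1.
pose F (i : nat) : set (measurableTypeR R) := `]i.+1%:R, i.+2%:R]%classic.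
have mF i : measurable (F i) by exact: measurable_itv.
pose f (x : R) : \bar R := (x `^ (- th))%:E.
have mf : measurable_fun [set: R] f by apply/measurable_EFinP; exact: measurable_powR.
have f0 x : (0 <= f x)%E by rewrite lee_fin powR_ge0.
have tF : trivIset setT F.
  apply/trivIsetP => /= i j _ _ /eqP ij; apply/seteqP; split => // x.
  rewrite /F/= !in_itv/= => -[/andP[a1 a2] /andP[b1 b2]]; apply: ij.
  have h1 : i.+1%:R < j.+2%:R :> R by exact: lt_le_trans a1 b2.
  have h2 : j.+1%:R < i.+2%:R :> R by exact: lt_le_trans b1 a2.
  move: h1 h2; rewrite !ltr_nat !ltnS => h1 h2.
  by apply/eqP; rewrite eqn_leq h1 h2.
have H : (\sum_(0 <= i <oo) \int[@lebesgue_measure R]_(x in F i) f x <= ((th - 1)^-1)%:E)%E.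
  rewrite -ge0_integral_bigcup//; last exact: measurable_funTS.
  rewrite -integral_powR_tail//; apply: ge0_subset_integral => //.
  - exact: bigcup_measurable.
  - exact: measurable_funTS.
  - move=> x [i _]; rewrite /F/= !in_itv/= => /andP[h _]; rewrite andbT (le_trans _ (ltW h))//.
    by rewrite ler1n.
apply: (@le_lt_trans _ _ (\sum_(0 <= i <oo) \int[@lebesgue_measure R]_(x in F i) f x)%E).
  apply: lee_nneseries => // i _.
  apply: (@le_trans _ _ (\int[@lebesgue_measure R]_(x in F i) ((i.+2%:R : R) `^ (- th))%:E)%E).
    rewrite integral_cst//= lebesgue_measure_itv/= lte_fin ltr_nat ltnSn -EFinB -EFinM lee_fin.
    by rewrite -natrB ?leqnSn// subSnn mulr1.
  apply: ge0_le_integral => //.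
  - exact: measurable_funTS.
  move=> x; rewrite /F/= in_itv/= => /andP[x1 x2]; rewrite lee_fin.
  have x0 : 0 < x by exact: lt_trans x1.
  rewrite !powRN lef_pV2 ?posrE ?powR_gt0//.
  by apply: ge0_ler_powR; rewrite ?nnegrE ?(ltW x0)// ltW// (lt_trans _ th1).
by apply: (le_lt_trans H); rewrite ltry.
Qed.

Lemma borel_cantelli_powR (F : nat -> set T) (C th : R) (N0 : nat) : 1 < th -> 0 <= C ->
  (forall N, measurable (F N)) ->
  (forall N, (N0 <= N)%N -> (P (F N) <= (C * N%:R `^ (- th))%:E)%E) ->
  {ae P, forall w, exists N1, forall N, (N1 <= N)%N -> ~ F N w}.
Proof.
move=> th1 C0 mF hF.
pose G n := F (N0 + n.+2)%N.
have mG n : measurable (G n) by exact: mF.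
have G0 : P (lim_sup_set G) = 0%E.
  apply: lim_sup_set_cvg0 => //.
  apply: (@le_lt_trans _ _ (\sum_(0 <= n <oo) (C%:E * ((n.+2%:R : R) `^ (- th))%:E))%E).
    apply: lee_nneseries => // n _; rewrite -EFinM.
    apply: (le_trans (hF _ (leq_addr _ _))); rewrite lee_fin ler_wpM2l//.
    rewrite !powRN lef_pV2 ?posrE ?powR_gt0 ?ltr0n ?addnS//.
    apply: ge0_ler_powR; rewrite ?nnegrE ?ler0n// ?ler_nat ?ltnS ?leq_addl//.
    by rewrite ltW// (lt_trans _ th1).
  rewrite nneseriesZl//.
  by rewrite lte_mul_pinfty// powR_series_fin.
exists (lim_sup_set G); split => //.
  by apply: bigcap_measurable => // n _; exact: bigcup_measurable.
move=> w /= h; apply: contrapT => h2; apply: h.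
have [n hn] : exists n, ~ (\bigcup_(j >= n) G j) w.
  by apply: contrapT => h3; apply: h2 => n _; apply: contrapT => h4; apply: h3; exists n.
exists (N0 + n.+2)%N => N NN FN; apply: hn; exists (N - N0 - 2)%N => /=.
  by move: NN; lia.
by rewrite /G (_ : (N0 + _)%N = N)//; move: NN; lia.
Qed.

End borel_cantelli.

Section elementary.
Context {R : realType}.

(** With t = x / (x + y), the claim is 1 <= t^b + (1 - t)^b, and t <= t^b on [0, 1]. *)
Lemma powR_subadd (x y b : R) : 0 <= x -> 0 <= y -> 0 < b <= 1 ->
  (x + y) `^ b <= x `^ b + y `^ b.
Proof.
move=> x0 y0 /andP[b0 b1].
have [xy0|xy] := eqVneq (x + y) 0.
  by rewrite xy0 powR0 ?gt_eqF// addr_ge0 ?powR_ge0.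
have s0 : 0 < x + y by rewrite lt0r xy addr_ge0.
have H z : 0 <= z -> z <= x + y -> z / (x + y) * (x + y) `^ b <= z `^ b.
  move=> z0 zs.
  have [->|zn] := eqVneq z 0; first by rewrite !mul0r powR_ge0.
  have zp : 0 < z by rewrite lt0r zn.
  have -> : z `^ b = (z / (x + y)) `^ b * (x + y) `^ b.
    by rewrite -powRM ?divr_ge0 ?(ltW s0)// divfK.
  rewrite ler_wpM2r ?powR_ge0// ger1_powR// divr_gt0//= ler_pdivrMr// mul1r//.
have := lerD (H x x0 _) (H y y0 _).
rewrite -mulrDl -mulrDl divff// mul1r; apply; lra.
Qed.

Lemma powR_dist (x y b : R) : 0 < b <= 1 ->
  `| `|x| `^ b - `|y| `^ b | <= `|x - y| `^ b.
Proof.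
move=> hb.
have b0 : 0 <= b by case/andP: hb => /ltW.
have H (u v : R) : `|u| `^ b <= `|v| `^ b + `|u - v| `^ b.
  apply: (@le_trans _ _ ((`|v| + `|u - v|) `^ b)); last exact: powR_subadd.
  apply: ge0_ler_powR; rewrite ?nnegrE ?addr_ge0//.
  by rewrite -{1}[u](subrK v) addrC; exact: ler_normD.
have h1 := H x y; have h2 := H y x; rewrite [`|y - x|]distrC in h2.
by rewrite ler_norml; apply/andP; split; lra.
Qed.

Lemma pow4_add_le (x y : R) : (x + y) ^+ 4 <= 8 * (x ^+ 4 + y ^+ 4).
Proof.
have -> : (x + y) ^+ 4 = ((x + y) ^+ 2) ^+ 2 by rewrite -exprM.
have -> : 8 * (x ^+ 4 + y ^+ 4) = 4 * (2 * ((x ^+ 2) ^+ 2 + (y ^+ 2) ^+ 2)) by rewrite -!exprM; ring.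
have h : (x + y) ^+ 2 <= 2 * (x ^+ 2 + y ^+ 2).
  by rewrite -subr_ge0 (_ : _ - _ = (x - y) ^+ 2) ?sqr_ge0//; ring.
apply: (@le_trans _ _ ((2 * (x ^+ 2 + y ^+ 2)) ^+ 2)).
  by rewrite lerXn2r ?nnegrE ?sqr_ge0// mulr_ge0// addr_ge0 ?sqr_ge0.
rewrite -subr_ge0; move: (x ^+ 2) (y ^+ 2) => a c.
have -> : 4 * (2 * (a ^+ 2 + c ^+ 2)) - (2 * (a + c)) ^+ 2 = 4 * (a - c) ^+ 2 by ring.
by rewrite mulr_ge0 ?sqr_ge0.
Qed.

End elementary.

Section stable_integral.
Context d (T : measurableType d) (R : realType) (P : probability T R).
Variables (alpha : R) (Z : set R -> T -> R) (I : (R -> R) -> T -> R).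
Hypotheses (alpha1 : 1 < alpha) (alpha2 : alpha <= 2).
Hypothesis hI : sas_integral P alpha Z I.
Local Notation intg f := (P.-integrable [set: T] (EFin \o f)).
Local Notation Ex f := (\int[P]_w (f w)).
Local Notation cst g := (@stable_moment_const R alpha g).

Lemma sas_int_measurable f : f \in Lalpha alpha -> measurable_fun [set: T] (I f).
Proof. by move=> /(sas_int_law hI)[]. Qed.

Lemma sas_int_moment f g : f \in Lalpha alpha -> 0 < g < alpha ->
  intg (fun w => `|I f w| `^ g) /\
  Ex (fun w => `|I f w| `^ g) = cst g * Lalpha_norm alpha f `^ g.
Proof.
move=> Lf hg.
have E := sas_moment hg alpha2 (Lalpha_norm_ge0 alpha f) (sas_int_law hI Lf).
split; last by rewrite /Rintegral E.
apply/integrableP; split.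
  by apply/measurable_EFinP/measurable_norm_powR; exact: sas_int_measurable.
under eq_integral do rewrite /= ger0_norm ?powR_ge0//.
by rewrite E ltry.
Qed.

Lemma Lalpha0 : (fun=> 0 : R) \in Lalpha alpha.
Proof.
apply: Lalpha_of_pow_integral => //; rewrite /pow_integral.
under eq_integral do rewrite normr0 powR0 ?gt_eqF ?(lt_trans ltr01)//.
by rewrite integral0 ltry.
Qed.

(** The case of the empty sum rests on linearity: I 0 = I 0 + I 0 almost surely. *)
Lemma sas_int_comb (n : nat) (c : nat -> R) (f : nat -> R -> R) :
  (forall i, (i < n)%N -> f i \in Lalpha alpha) ->
  (fun s => \sum_(i < n) c i * f i s) \in Lalpha alpha /\
  {ae P, forall w, I (fun s => \sum_(i < n) c i * f i s) w = \sum_(i < n) c i * I (f i) w}.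
Proof.
elim: n => [|n IH] h.
  have E : (fun s : R => \sum_(i < 0) c i * f i s) = (fun=> 0).
    by apply/funext => s; rewrite big_ord0.
  rewrite E; split; first exact: Lalpha0.
  have := sas_int_linear hI 1 Lalpha0 Lalpha0.
  rewrite (_ : (fun s : R => 1 * 0 + 0) = (fun=> 0)); last by apply/funext => s; rewrite mulr0 addr0.
  apply: filterS => w E2; rewrite big_ord0.
  by move: E2; rewrite mul1r => /eqP; rewrite -subr_eq subrr => /eqP.
have [L1 E1] := IH (fun i hi => h i (ltnW hi)).
have Ln := h n (ltnSn n).
have E : (fun s : R => \sum_(i < n.+1) c i * f i s) = (fun s => c n * f n s + \sum_(i < n) c i * f i s).
  by apply/funext => s; rewrite big_ord_recr addrC.
rewrite E; split.
  have a1 : (1 <= alpha%:E)%E by rewrite lee_fin ltW.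
  have [_ /(_ (c n) _ _ Ln L1)] := @Lfun_submod_closed _ _ R (@lebesgue_measure R) _ a1.
  by [].
have := sas_int_linear hI (c n) Ln L1.
apply: filterS2 E1 => w E1 E2.
by rewrite E2 E1 big_ord_recr addrC.
Qed.

Lemma sas_int_add f g : f \in Lalpha alpha -> g \in Lalpha alpha ->
  {ae P, forall w, I (fun s => f s + g s) w = I f w + I g w}.
Proof.
move=> Lf Lg; have := sas_int_linear hI 1 Lf Lg.
rewrite (_ : (fun s : R => 1 * f s + g s) = (fun s => f s + g s)); last by apply/funext => s; rewrite mul1r.
by apply: filterS => w ->; rewrite mul1r.
Qed.

Lemma sas_int_markov f t : f \in Lalpha alpha -> 0 < t ->
  (P [set w | t <= `|I f w|]%R <= (cst 1 * Lalpha_norm alpha f / t)%:E)%E.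
Proof.
move=> Lf t0.
have [i1 e1] := @sas_int_moment f 1 Lf (introT andP (conj ltr01 alpha1)).
pose A := [set w | t <= `|I f w|].
have mI := sas_int_measurable Lf.
have mA : measurable A.
  rewrite (_ : A = [set: T] `&` (fun w => `|I f w|) @^-1` `[t, +oo[); last first.
    by apply/seteqP; split => w /=; rewrite /A/= in_itv/= andbT => // -[].
  exact: (measurableT_comp (@normr_measurable _ _) mI).
have -> : P A = (fine (P A))%:E by rewrite fineK// fin_num_measure.
rewrite lee_fin ler_pdivlMr// -[Lalpha_norm _ _]powRr1 ?Lalpha_norm_ge0// -e1.
have ii : intg (fun w => \1_A w : R).
  apply: (integrable_le _ (integrable_cst P 1)); first exact: measurable_indic.
  by move=> w; rewrite normr1 indicE; case: (_ \in _); rewrite ?normr1 ?normr0.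
have -> : fine (P A) * t = Ex (fun w => t * \1_A w).
  by rewrite RintegralZl// mulrC /Rintegral integral_indic// setIT.
apply: le_Rintegral => //; first exact: integrableZR.
move=> w _; rewrite powRr1// indicE; case: (boolP (w \in A)); rewrite ?(mulr0, mulr1)//.
by rewrite inE.
Qed.

End stable_integral.

(** * Fluctuations of power sums with frozen Hurst parameter *)

Section ae.
Context d (T : measurableType d) (R : realType) (P : probability T R).

Lemma ae_measure_le (A B : set T) : measurable A -> measurable B ->
  {ae P, forall w, A w -> B w} -> (P A <= P B)%E.
Proof.
move=> mA mB [Nn [mN N0 hN]].
apply: (@le_trans _ _ (P (B `|` Nn))).
  apply: le_measure; rewrite ?inE//; first exact: measurableU.
  move=> w Aw; have [Bw|nB] := pselect (B w); [by left|right].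
  by apply: hN => /= h; exact/nB/h.
apply: (le_trans (measureU2 _ _ _)) => //.
by rewrite -[leRHS]adde0; apply: leeD2l; rewrite -[X in (_ <= X)%E]N0; exact: lexx.
Qed.

Lemma measurable_ge_norm (W : T -> R) (t : R) : measurable_fun [set: T] W ->
  measurable [set w | t <= `|W w|].
Proof.
move=> mW.
rewrite (_ : [set w | _] = [set: T] `&` (fun w => `|W w|) @^-1` `[t, +oo[); last first.
  by apply/seteqP; split => w /=; rewrite in_itv/= andbT => // -[].
exact: (measurableT_comp (@normr_measurable _ _) mW).
Qed.
End ae.

Lemma dist_le (R : realType) (x y z : R) : x <= y + z -> y <= x + z -> `|y - x| <= z.
Proof. by move=> h1 h2; rewrite ler_norml; apply/andP; split; lra. Qed.

Section fluctuation.
Context d (T : measurableType d) (R : realType) (P : probability T R).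
Variables (alpha : R) (Z : set R -> T -> R) (I : (R -> R) -> T -> R).
Hypotheses (alpha1 : 1 < alpha) (alpha2 : alpha <= 2).
Hypothesis hI : sas_integral P alpha Z I.
Variables (h1 h2 beta : R) (L : nat).
Hypotheses (h1a : alpha^-1 < h1) (h12 : h1 <= h2) (h21 : h2 < 1).
Hypotheses (beta0 : 0 < beta) (beta4 : beta <= 4^-1).
Hypotheses (L2 : (2 <= L)%N) (Lbeta : 2 / beta + 1 < L%:R).
Local Notation intg f := (P.-integrable [set: T] (EFin \o f)).
Local Notation Ex f := (\int[P]_w (f w)).
Local Notation cst g := (@stable_moment_const R alpha g).
Local Notation nrm := (Lalpha_norm alpha).

Let b4 : 0 < 4 * beta < alpha.
Proof. by have := (alpha1, beta0, beta4) => -[[? ?] ?]; apply/andP; split; lra. Qed.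
Let b1 : 0 < beta < alpha.
Proof. by have := (alpha1, beta0, beta4) => -[[? ?] ?]; apply/andP; split; lra. Qed.
Let b01 : 0 < beta <= 1.
Proof. by have := (alpha1, beta0, beta4) => -[[? ?] ?]; apply/andP; split; lra. Qed.

Let pow4b (x : R) : (`|x| `^ beta) ^+ 4 = `|x| `^ (4 * beta).
Proof. by rewrite mulrC powRrM powR_mulrn// powR_ge0. Qed.

Lemma centered_power_moment (f : R -> R) : f \in Lalpha alpha ->
  let Y w := `|I f w| `^ beta - cst beta * nrm f `^ beta in
  [/\ intg (fun w => Y w ^+ 4), Ex Y = 0 &
      Ex (fun w => Y w ^+ 4) <= 8 * (cst (4 * beta) + cst beta ^+ 4) * (nrm f `^ beta) ^+ 4].
Proof.
move=> Lf Y.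
have [i1 e1] := sas_int_moment alpha2 hI Lf b1.
have [i4 e4] := sas_int_moment alpha2 hI Lf b4.
set c := cst beta * nrm f `^ beta.
pose G w := 8 * (`|I f w| `^ (4 * beta) + c ^+ 4).
have iG : intg G.
  by apply: integrableZR; apply: integrableDR => //; exact: integrable_cst.
have YG w : Y w ^+ 4 <= G w.
  apply: (le_trans (pow4_add_le _ _)).
  by rewrite /G -/c pow4b exprNn -signr_odd/= mul1r.
have mY : measurable_fun [set: T] Y.
  by apply: measurable_funB => //; apply: measurable_norm_powR; exact: (sas_int_measurable hI).
have iY : intg (fun w => Y w ^+ 4).
  apply: integrable_le iG _; first exact: measurable_funX.
  by move=> w; rewrite ger0_norm ?exprn_even_ge0// (le_trans (YG w))// ler_norm.
split => //.
  rewrite /Y RintegralB//; last exact: integrable_cst.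
  rewrite e1 Rintegral_cst// (_ : fine (P [set: T]) = 1); last by rewrite probability_setT.
  by rewrite mulr1 subrr.
apply: (le_trans (le_Rintegral measurableT iY iG (fun w _ => YG w))).
rewrite /G RintegralZl//; last by apply: integrableDR => //; exact: integrable_cst.
rewrite RintegralD//; last exact: integrable_cst.
rewrite e4 Rintegral_cst// (_ : fine (P [set: T]) = 1); last by rewrite probability_setT.
have E : nrm f `^ (4 * beta) = (nrm f `^ beta) ^+ 4.
  by rewrite mulrC powRrM powR_mulrn// powR_ge0.
rewrite le_eqVlt; apply/orP; left; apply/eqP; rewrite mulr1 /c exprMn E.
by move: (_ ^+ 4) (_ ^+ 4) (cst _) => u1 u2 u3; ring.
Qed.

(** For beta <= 1 both x |-> |x|^beta and the norm raised to beta are subadditive,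
    so the change caused by adding [g] is controlled by [g] alone. *)
Lemma perturbed_power_moment (f g h : R -> R) : f \in Lalpha alpha -> g \in Lalpha alpha ->
  h \in Lalpha alpha -> (forall s, f s + g s = h s) ->
  let Y w := (`|I f w + I g w| `^ beta - `|I f w| `^ beta) +
     cst beta * (nrm f `^ beta - nrm h `^ beta) in
  [/\ measurable_fun [set: T] Y, intg (fun w => Y w ^+ 4) &
      Ex (fun w => Y w ^+ 4) <= 8 * (cst (4 * beta) + cst beta ^+ 4) * (nrm g `^ beta) ^+ 4].
Proof.
move=> Lf Lg Lh fgh Y.
have [i4 e4] := sas_int_moment alpha2 hI Lg b4.
have cb0 : 0 <= cst beta by rewrite ltW// stable_moment_const_gt0.
set c := cst beta * nrm g `^ beta.
pose G w := 8 * (`|I g w| `^ (4 * beta) + c ^+ 4).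
have iG : intg G.
  by apply: integrableZR; apply: integrableDR => //; exact: integrable_cst.
have nfh : `|nrm f `^ beta - nrm h `^ beta| <= nrm g `^ beta.
  (* the reverse triangle inequality of the norm, through h - g = f *)
  have nN : nrm (fun s => (-1) * g s) = nrm g.
    have pN : pow_integral alpha (fun s => (-1) * g s) = pow_integral alpha g.
      by apply: eq_integral => s _; rewrite mulN1r normrN.
    by rewrite !Lalpha_normE pN.
  have Lg' : (fun s => (-1) * g s) \in Lalpha alpha.
    have mg' : measurable_fun [set: R] (fun s => (-1) * g s).
      by apply: measurable_funM => //; exact: Lalpha_measurable Lg.
    by apply: (proj1 (Lalpha_dominated alpha1 ler01 mg' Lg _)) => s; rewrite mulN1r normrN mul1r.
  have H1 : nrm h <= nrm f + nrm g.
    by rewrite (_ : h = (fun s => f s + g s)); [exact: Lalpha_normD|apply/funext => s; rewrite fgh].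
  have H2 : nrm f <= nrm h + nrm g.
    rewrite -nN; have <- : (fun s => h s + -1 * g s) = f; last exact: Lalpha_normD.
    by apply/funext => s; rewrite -fgh mulN1r addrK.
  have n0 k : 0 <= nrm k by exact: Lalpha_norm_ge0.
  have bb := ltW beta0.
  have K1 : nrm h `^ beta <= nrm f `^ beta + nrm g `^ beta.
    by apply: le_trans (powR_subadd (n0 f) (n0 g) b01); apply: ge0_ler_powR; rewrite ?nnegrE ?addr_ge0.
  have K2 : nrm f `^ beta <= nrm h `^ beta + nrm g `^ beta.
    by apply: le_trans (powR_subadd (n0 h) (n0 g) b01); apply: ge0_ler_powR; rewrite ?nnegrE ?addr_ge0.
  exact: dist_le.
have YG w : Y w ^+ 4 <= G w.
  apply: (le_trans (pow4_add_le _ _)); rewrite /G ler_wpM2l// -pow4b lerD//.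
    rewrite -[leLHS]ger0_norm ?exprn_even_ge0// normrX lerXn2r ?nnegrE ?powR_ge0//.
    apply: (le_trans (powR_dist _ _ b01)); by rewrite addrAC subrr add0r.
  have c0 : 0 <= c by exact: (mulr_ge0 cb0 (powR_ge0 _ _)).
  rewrite -[leLHS]ger0_norm ?exprn_even_ge0// normrX lerXn2r ?nnegrE//.
  by rewrite normrM (ger0_norm cb0) /c ler_wpM2l.
have mf := sas_int_measurable hI Lf. have mg := sas_int_measurable hI Lg.
have mY : measurable_fun [set: T] Y.
  apply: measurable_funD => //; apply: measurable_funB; apply: measurable_norm_powR => //.
  exact: measurable_funD.
have iY : intg (fun w => Y w ^+ 4).
  apply: integrable_le iG _; first exact: measurable_funX.
  by move=> w; rewrite ger0_norm ?exprn_even_ge0// (le_trans (YG w))// ler_norm.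
split => //.
apply: (le_trans (le_Rintegral measurableT iY iG (fun w _ => YG w))).
rewrite /G RintegralZl//; last by apply: integrableDR => //; exact: integrable_cst.
rewrite RintegralD//; last exact: integrable_cst.
rewrite e4 Rintegral_cst// (_ : fine (P [set: T]) = 1); last by rewrite probability_setT.
have E : nrm g `^ (4 * beta) = (nrm g `^ beta) ^+ 4.
  by rewrite mulrC powRrM powR_mulrn// powR_ge0.
rewrite le_eqVlt; apply/orP; left; apply/eqP; rewrite mulr1 /c exprMn E.
by move: (_ ^+ 4) (_ ^+ 4) (cst _) => u1 u2 u3; ring.
Qed.

Lemma sum_pad (n m : nat) (F : nat -> R) : (n <= m)%N ->
  \sum_(k < m) (if (k < n)%N then F k else 0) = \sum_(k < n) F k.
Proof.
move=> nm; rewrite -(big_mkord xpredT (fun k => if (k < n)%N then F k else 0)).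
rewrite (@big_cat_nat _ _ _ n)//= [X in _ + X]big1_seq ?addr0.
  by rewrite big_mkord; apply: eq_bigr => k _; rewrite ltn_ord.
by move=> k /=; rewrite mem_index_iota => /andP[nk _]; rewrite ltnNge nk.
Qed.

Let K1 : R := Phi_bound L * nrm (envelope (tail_exponent alpha h2) L%:R).
Let K10 : 0 <= K1. Proof. by rewrite mulr_ge0 ?Phi_bound_ge0 ?Lalpha_norm_ge0. Qed.
Let Q : R := 8 * (cst (4 * beta) + cst beta ^+ 4).
Let Q0 : 0 <= Q.
Proof.
by rewrite mulr_ge0// addr_ge0 ?exprn_ge0// ltW// stable_moment_const_gt0.
Qed.

Section one_interval.
Variables (N p0 n M : nat) (v : nat -> R) (mu : R).
Hypotheses (N0 : (0 < N)%N) (M0 : (0 < M)%N) (hv : forall k, h1 <= v k <= h2) (mu0 : 0 < mu).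
Hypothesis hmu : forall k, (k < n)%N -> (N%:R `^ (- v (p0 + k)%N)) `^ beta <= mu.

Let f k := rescaled alpha (@Phi R alpha L) N (p0 + k) (v (p0 + k)%N).
Let fi k := rescaled alpha (@Phi_in R alpha L M) N (p0 + k) (v (p0 + k)%N).
Let fo k := rescaled alpha (@Phi_out R alpha L M) N (p0 + k) (v (p0 + k)%N).

Let Lf k : f k \in Lalpha alpha.
Proof. by have [] := rescaled_Lalpha alpha1 (p0 + k) N0 (Phi_Lalpha alpha1 h1a h12 h21 L2 (hv (p0 + k)%N)).1. Qed.

Let Lfi k : fi k \in Lalpha alpha /\ nrm (fi k) <= N%:R `^ (- v (p0 + k)%N) * K1.
Proof.
have [L1 E1] := Phi_in_Lalpha alpha1 h1a h12 h21 L2 M (hv (p0 + k)%N).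
have [_ E2] := Phi_Lalpha alpha1 h1a h12 h21 L2 (hv (p0 + k)%N).
have [L3 E3] := rescaled_Lalpha alpha1 (p0 + k) N0 L1; split => //.
by rewrite /fi E3 ler_wpM2l ?powR_ge0// (le_trans E1).
Qed.

Let Lfo k : fo k \in Lalpha alpha /\
  nrm (fo k) <= N%:R `^ (- v (p0 + k)%N) * (K1 * M%:R ^- (L - 2)).
Proof.
have [L1 E1] := Phi_out_Lalpha alpha1 h1a h12 h21 L2 (hv (p0 + k)%N) M0.
have [L3 E3] := rescaled_Lalpha alpha1 (p0 + k) N0 L1; split => //.
by rewrite /fo E3 ler_wpM2l ?powR_ge0// (le_trans E1)// /K1 mulrAC.
Qed.

Let fif k s : fi k s + fo k s = f k s.
Proof. exact: rescaled_split. Qed.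

Let bb : 0 <= beta. Proof. exact: ltW. Qed.

(** The inner parts at distance at least L + M have disjoint supports, so the
    stable integrals of each residue class modulo L + M are independent.  The sum
    is padded with zeros to a length that is a multiple of the modulus. *)
Lemma window_moment (q m : nat) (s : R) : q = (L + M)%N -> (n <= q * m)%N -> 0 < s ->
  Q * (K1 `^ beta) ^+ 4 * mu ^+ 4 <= s ^+ 2 ->
  intg (fun w => (\sum_(k < n) (`|I (fi k) w| `^ beta - cst beta * nrm (fi k) `^ beta)) ^+ 4) /\
  Ex (fun w => (\sum_(k < n) (`|I (fi k) w| `^ beta - cst beta * nrm (fi k) `^ beta)) ^+ 4) <=
    q%:R ^+ 4 * (3 * m%:R ^+ 2 * s ^+ 2).
Proof.
move=> qE nqm s0 hs.
pose phi (k : nat) (x : R) : R := if (k < n)%N then `|x| `^ beta - cst beta * nrm (fi k) `^ beta else 0.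
have E : (fun w => (\sum_(k < n) (`|I (fi k) w| `^ beta - cst beta * nrm (fi k) `^ beta)) ^+ 4) =
   (fun w => (\sum_(k < q * m) phi k (I (fi k) w)) ^+ 4).
  by apply/funext => w; rewrite /phi (@sum_pad n (q * m) (fun k => `|I (fi k) w| `^ beta - cst beta * nrm (fi k) `^ beta)).
rewrite E; apply: (@fourth_moment_mdep _ _ _ P (fun k => I (fi k)) phi) => //.
- by move=> i; exact: (sas_int_measurable hI (Lfi i).1).
- move=> i; rewrite (_ : phi i = if (i < n)%N then (fun x => `|x| `^ beta - cst beta * nrm (fi i) `^ beta) else (fun=> 0)); last first.
    by apply/funext => x; rewrite /phi; case: ifP.
  case: ifP => // _; by apply: measurable_funB => //; exact: measurable_norm_powR.
- move=> r n' rq n'm; apply: (sas_int_indep hI) => [i|i j ij]; first exact: (Lfi _).1.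
  apply: aeW => x; have [ltij|ltji|eqij] := ltngtP i j.
  + apply: (@rescaled_in_disjoint _ alpha L M).
    have : (i.+1 * q <= j * q)%N by rewrite leq_mul2r ltij orbT.
    by rewrite mulSn; move: qE; clear; lia.
  + rewrite mulrC; apply: (@rescaled_in_disjoint _ alpha L M).
    have : (j.+1 * q <= i * q)%N by rewrite leq_mul2r ltji orbT.
    by rewrite mulSn; move: qE; clear; lia.
  + by move: ij; rewrite -val_eqE/= eqij eqxx.
- move=> k kqm; rewrite /phi; have [kn|kn] := ltnP k n; last first.
    split; first by rewrite (_ : (fun w : T => 0 ^+ 4) = (fun=> 0)); [exact: integrable_cst|apply/funext => w; rewrite expr0n].
    + by rewrite Rintegral_cst// mul0r.
    + by rewrite expr0n/= Rintegral_cst// mul0r sqr_ge0.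
  have [i4 e0 e4] := centered_power_moment (Lfi k).1; split => //.
  apply: (le_trans e4); apply: le_trans hs; rewrite -[leRHS]mulrA -exprMn.
  apply: ler_wpM2l; first exact: Q0.
  rewrite lerXn2r ?nnegrE ?mulr_ge0 ?powR_ge0 ?(ltW mu0)//.
  apply: (@le_trans _ _ ((N%:R `^ (- v (p0 + k)%N) * K1) `^ beta)).
    apply: ge0_ler_powR; [exact: bb|by rewrite nnegrE Lalpha_norm_ge0| |exact: (Lfi k).2].
    by rewrite nnegrE (mulr_ge0 (powR_ge0 _ _) K10).
  by rewrite powRM ?powR_ge0// mulrC ler_wpM2l ?powR_ge0// hmu.
Qed.

(** No independence is left for the outer parts, but their size compensates for
    the crude bound by n^4. *)
Lemma tail_moment :
  let Y k w := (`|I (fi k) w + I (fo k) w| `^ beta - `|I (fi k) w| `^ beta) +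
     cst beta * (nrm (fi k) `^ beta - nrm (f k) `^ beta) in
  [/\ forall k, measurable_fun [set: T] (Y k),
   intg (fun w => (\sum_(k < n) Y k w) ^+ 4) &
  Ex (fun w => (\sum_(k < n) Y k w) ^+ 4) <=
    n%:R ^+ 4 * (Q * (K1 `^ beta) ^+ 4 * mu ^+ 4 * ((M%:R ^- (L - 2)) `^ beta) ^+ 4)].
Proof.
move=> Y.
have H k := perturbed_power_moment (Lfi k).1 (Lfo k).1 (Lf k) (fif k).
have mY k : measurable_fun [set: T] (Y k) by have [] := H k.
have [] := @fourth_moment_sum _ _ _ P n Y (Q * (K1 `^ beta) ^+ 4 * mu ^+ 4 * ((M%:R ^- (L - 2)) `^ beta) ^+ 4) mY; last by split.
  by move=> k _; have [] := H k.
move=> k kn; have [_ _ e4] := H k; apply: (le_trans e4).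
rewrite (_ : Q * _ * _ * _ = Q * (K1 `^ beta * mu * (M%:R ^- (L - 2)) `^ beta) ^+ 4); last first.
  by rewrite !exprMn !mulrA.
rewrite ler_wpM2l//.
have M1 : 0 <= M%:R ^- (L - 2) :> R by rewrite invr_ge0 exprn_ge0.
rewrite lerXn2r ?nnegrE ?mulr_ge0 ?powR_ge0 ?(ltW mu0)//.
apply: (@le_trans _ _ ((N%:R `^ (- v (p0 + k)%N) * (K1 * M%:R ^- (L - 2))) `^ beta)).
  apply: ge0_ler_powR; [exact: bb|by rewrite nnegrE Lalpha_norm_ge0| |exact: (Lfo k).2].
  by rewrite nnegrE (mulr_ge0 (powR_ge0 _ _) (mulr_ge0 K10 M1)).
rewrite powRM; [|exact: powR_ge0|exact: (mulr_ge0 K10 M1)].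
rewrite (powRM _ K10 M1) mulrA ler_wpM2r ?powR_ge0// mulrC ler_wpM2l ?powR_ge0// hmu//.
Qed.

End one_interval.

(** Here the assumption on L enters: 4 beta (L - 2) > 4 (2 - beta) >= 6. *)
Lemma tail_rate (r : R) (M : nat) : 1 <= r -> r <= M%:R ->
  ((M%:R ^- (L - 2)) `^ beta) ^+ 4 <= r ^- 6.
Proof.
move=> r1 rM; have r0 : 0 < r by exact: lt_le_trans r1.
have M0 : 0 < M%:R :> R by exact: lt_le_trans rM.
have -> : ((M%:R ^- (L - 2)) `^ beta) ^+ 4 = M%:R `^ (- ((L - 2)%:R * (beta * 4))).
  by rewrite -powR_mulrn ?powR_ge0// -powRrM -powR_invn ?(ltW M0)// -powRrM mulNr.
rewrite -(powR_invn _ (ltW r0)) !powRN lef_pV2 ?posrE ?powR_gt0//.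
have H : 6 <= (L - 2)%:R * (beta * 4) :> R.
  have hb := beta0; have hb4 := beta4; have hL := Lbeta.
  have h : 2 + beta < L%:R * beta.
    have -> : 2 + beta = (2 / beta + 1) * beta by field; rewrite gt_eqF.
    by rewrite ltr_pM2r.
  rewrite natrB//; lra.
apply: (@le_trans _ _ (r `^ ((L - 2)%:R * (beta * 4)))); first exact: ler_powR.
by apply: ge0_ler_powR; rewrite ?nnegrE ?(ltW r0) ?(ltW M0)// (le_trans _ H).
Qed.

(** With r = N^(1/4), M ~ r and q = L + M, the inner sum has fourth moment of
    order q^4 (n/q)^2 mu^4 <= r^10 mu^4, and the outer one of order
    n^4 r^(-6) mu^4 <= r^10 mu^4, where r^10 = N^(5/2). *)
Lemma fluctuation : exists2 C : R, 0 <= C &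
  forall (N p0 n : nat) (v : nat -> R) (mu t : R), (0 < N)%N -> (n <= N)%N ->
  (forall k, h1 <= v k <= h2) -> 0 < mu ->
  (forall k, (k < n)%N -> (N%:R `^ (- v (p0 + k)%N)) `^ beta <= mu) -> 0 < t ->
  let A := [set w | t <= `|\sum_(k < n) (`|I (rescaled alpha (@Phi R alpha L) N (p0 + k) (v (p0 + k)%N)) w| `^ beta
      - cst beta * nrm (rescaled alpha (@Phi R alpha L) N (p0 + k) (v (p0 + k)%N)) `^ beta)|] in
  measurable A /\ (P A <= (C * mu ^+ 4 * N%:R `^ (5 / 2) / t ^+ 4)%:E)%E.
Proof.
pose KQ := Q * (K1 `^ beta) ^+ 4.
have KQ0 : 0 <= KQ by rewrite mulr_ge0 ?Q0// exprn_ge0// powR_ge0.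
pose S0 := 1 + KQ.
have S01 : 1 <= S0 by rewrite lerDl.
have S00 : 0 <= S0 by rewrite (le_trans ler01).
pose C := 8 * (3 * S0 ^+ 2 * (L.+2%:R ^+ 2 * L.+3%:R ^+ 2) + S0).
have C0 : 0 <= C.
  apply: mulr_ge0 => //; apply: addr_ge0 => //; apply: mulr_ge0; first by rewrite mulr_ge0// sqr_ge0.
  by rewrite mulr_ge0// sqr_ge0.
exists C => // N p0 n v mu t N0 nN hv mu0 hmu t0 A.
(* the cut N^(1/4) balances the inner and the outer contribution *)
pose r : R := N%:R `^ (4^-1).
have N1 : 1 <= N%:R :> R by rewrite ler1n.
have r1 : 1 <= r by rewrite -(powRr0 N%:R) /r ler_powR// invr_ge0.
have r0 : 0 < r by exact: lt_le_trans r1.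
have r4 : r ^+ 4 = N%:R.
  by rewrite /r -powR_mulrn ?powR_ge0// -powRrM mulVf ?pnatr_eq0// powRr1.
have rN : N%:R `^ (5 / 2) = r ^+ 10.
  rewrite /r -powR_mulrn ?powR_ge0// -powRrM; congr (_ `^ _); by field.
pose M := (Num.truncn r).+1.
have rM : r <= M%:R by rewrite ltW// truncnS_gt.
have Mr : M%:R <= r + 1 by rewrite -natr1 lerD2r Num.Theory.truncn_le// ltW.
pose q := (L + M)%N.
pose m := (n %/ q).+1.
have q0 : (0 < q)%N by rewrite /q addnS.
have nqm : (n <= q * m)%N by rewrite ltnW// mulnC ltn_ceil.
have qmn : (q * m <= n + q)%N by rewrite /m mulnS addnC leq_add2r mulnC leq_trunc_div.
pose s := S0 * mu ^+ 2.
have s0 : 0 < s by rewrite mulr_gt0 ?exprn_gt0// (lt_le_trans ltr01).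
have hs : Q * (K1 `^ beta) ^+ 4 * mu ^+ 4 <= s ^+ 2.
  rewrite /s exprMn -exprM ler_wpM2r ?exprn_ge0 ?(ltW mu0)//.
  apply: (@le_trans _ _ S0); first by rewrite /S0 /KQ lerDr.
  by rewrite expr2 -[leLHS]mulr1 ler_wpM2l.
have M0 : (0 < M)%N by [].
have [iW1 eW1] := window_moment N0 hv mu0 hmu (erefl q) nqm s0 hs.
have [mY iW2 eW2] := tail_moment N0 M0 hv mu0 hmu.
set fi := (fun k => rescaled alpha (Phi_in alpha L M) N (p0 + k) (v (p0 + k)%N)).
set fo := (fun k => rescaled alpha (Phi_out alpha L M) N (p0 + k) (v (p0 + k)%N)).
pose f := (fun k => rescaled alpha (@Phi R alpha L) N (p0 + k) (v (p0 + k)%N)).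
pose W1 w := \sum_(k < n) (`|I (fi k) w| `^ beta - cst beta * nrm (fi k) `^ beta).
pose Y k w := (`|I (fi k) w + I (fo k) w| `^ beta - `|I (fi k) w| `^ beta) +
     cst beta * (nrm (fi k) `^ beta - nrm (f k) `^ beta).
pose W2 w := \sum_(k < n) Y k w.
have Lin k : fi k \in Lalpha alpha.
  by have [] := rescaled_Lalpha alpha1 (p0 + k) N0 (Phi_in_Lalpha alpha1 h1a h12 h21 L2 M (hv (p0 + k)%N)).1.
have Lout k : fo k \in Lalpha alpha.
  by have [] := rescaled_Lalpha alpha1 (p0 + k) N0 (Phi_out_Lalpha alpha1 h1a h12 h21 L2 (hv (p0 + k)%N) M0).1.
have Lf k : f k \in Lalpha alpha.
  by have [] := rescaled_Lalpha alpha1 (p0 + k) N0 (Phi_Lalpha alpha1 h1a h12 h21 L2 (hv (p0 + k)%N)).1.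
have mW1 : measurable_fun [set: T] W1.
  apply: measurable_sum => k; apply: measurable_funB => //.
  by apply: measurable_norm_powR; exact: (sas_int_measurable hI (Lin k)).
have mW2 : measurable_fun [set: T] W2 by apply: measurable_sum => k; exact: (mY k).
pose W w := W1 w + W2 w.
have mW : measurable_fun [set: T] W by exact: measurable_funD.
have mA : measurable A.
  apply: measurable_ge_norm; apply: measurable_sum => k; apply: measurable_funB => //.
  by apply: measurable_norm_powR; exact: (sas_int_measurable hI (Lf k)).
split => //.
apply: (@le_trans _ _ (P [set w | t <= `|W w|])).
  apply: ae_measure_le => //; first exact: measurable_ge_norm.
  have ae k : {ae P, forall w, I (f k) w = I (fi k) w + I (fo k) w}.
    have := sas_int_add hI (Lin k) (Lout k).
    rewrite (_ : (fun s => fi k s + fo k s) = f k)//.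
    by apply/funext => x; exact: rescaled_split.
  apply: filterS (ae_foralln ae) => w hw; rewrite /A/=.
  suff -> : \sum_(k < n) (`|I (f k) w| `^ beta - cst beta * nrm (f k) `^ beta) = W w by [].
  rewrite /W /W1 /W2 -big_split/=; apply: eq_bigr => k _; rewrite hw /Y.
  by ring.
pose G w := 8 * (W1 w ^+ 4 + W2 w ^+ 4).
have iG : intg G by apply: integrableZR; exact: integrableDR.
have WG w : W w ^+ 4 <= G w by exact: pow4_add_le.
have iW : intg (fun w => W w ^+ 4).
  apply: integrable_le iG _; first exact: measurable_funX.
  by move=> w; rewrite ger0_norm ?exprn_even_ge0// (le_trans (WG w))// ler_norm.
apply: (le_trans (markov4 mW t0 iW)); rewrite lee_fin ler_wpM2r ?invr_ge0 ?exprn_ge0 ?(ltW t0)//.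
apply: (le_trans (le_Rintegral measurableT iW iG (fun w _ => WG w))).
rewrite /G RintegralZl//; last exact: integrableDR.
rewrite RintegralD// rN.
rewrite [leRHS](_ : _ = 8 * ((3 * S0 ^+ 2 * (L.+2%:R ^+ 2 * L.+3%:R ^+ 2) + S0) * (mu ^+ 4 * r ^+ 10))); last by rewrite /C !mulrA.
rewrite ler_wpM2l//.
have E1 : q%:R ^+ 4 * (3 * m%:R ^+ 2 * s ^+ 2) <= 3 * S0 ^+ 2 * (L.+2%:R ^+ 2 * L.+3%:R ^+ 2) * (mu ^+ 4 * r ^+ 10).
  have Lr : 0 <= L%:R :> R by [].
  have qr : q%:R <= L.+2%:R * r.
    rewrite /q natrD -natr1 -natr1 (_ : (L%:R + 1 + 1) * r = L%:R * r + (r + r)); last by ring.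
    by apply: lerD; [rewrite ler_peMr|lra].
  have qmr : (q * m)%:R <= L.+3%:R * r ^+ 4.
    apply: (@le_trans _ _ (n%:R + q%:R)); first by rewrite -natrD ler_nat.
    rewrite -natr1 mulrDl mul1r addrC; apply: lerD.
      apply: (le_trans qr); rewrite ler_wpM2l//.
      by rewrite exprS ler_peMr ?(ltW r0)// exprn_ege1.
    by rewrite r4 ler_nat.
  have -> : q%:R ^+ 4 * (3 * m%:R ^+ 2 * s ^+ 2) = (3 * s ^+ 2) * (q%:R ^+ 2 * (q * m)%:R ^+ 2) by rewrite natrM; ring.
  have -> : 3 * S0 ^+ 2 * (L.+2%:R ^+ 2 * L.+3%:R ^+ 2) * (mu ^+ 4 * r ^+ 10) =
     (3 * s ^+ 2) * ((L.+2%:R * r) ^+ 2 * (L.+3%:R * r ^+ 4) ^+ 2) by rewrite /s; ring.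
  have q3 : 0 <= 3 * s ^+ 2 by apply: mulr_ge0 => //; exact: sqr_ge0.
  apply: (ler_wpM2l q3).
  apply: ler_pM; rewrite ?sqr_ge0//.
    by rewrite lerXn2r ?nnegrE ?mulr_ge0// ltW.
  by rewrite lerXn2r ?nnegrE// mulr_ge0 ?exprn_ge0 ?(ltW r0).
have E2 : n%:R ^+ 4 * (Q * (K1 `^ beta) ^+ 4 * mu ^+ 4 * ((M%:R ^- (L - 2)) `^ beta) ^+ 4) <=
    S0 * (mu ^+ 4 * r ^+ 10).
  apply: (@le_trans _ _ (N%:R ^+ 4 * (S0 * mu ^+ 4 * r ^- 6))).
    have A1 : 0 <= Q * (K1 `^ beta) ^+ 4 * mu ^+ 4.
      by apply: mulr_ge0; [exact: KQ0|exact: (exprn_ge0 _ (ltW mu0))].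
    have A2 : 0 <= ((M%:R ^- (L - 2)) `^ beta) ^+ 4 :> R by exact: (exprn_ge0 _ (powR_ge0 _ _)).
    apply: ler_pM; [exact: exprn_ge0|exact: (mulr_ge0 A1 A2)| |].
      by rewrite lerXn2r ?nnegrE// ler_nat.
    apply: ler_pM; [exact: A1|exact: A2| |exact: tail_rate].
    apply: ler_wpM2r; first exact: (exprn_ge0 _ (ltW mu0)).
    by rewrite /S0 /KQ lerDr.
  rewrite -r4 le_eqVlt; apply/orP; left; apply/eqP.
  by field; rewrite gt_eqF.
by rewrite mulrDl; exact: (lerD (le_trans eW1 E1) (le_trans eW2 E2)).
Qed.

End fluctuation.

(** * Freezing the Hurst parameter of the path *)

Section rates.
Context {R : realType}.

Lemma powR_small (e c : R) : 0 < e -> 0 < c ->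
  exists N0 : nat, forall N, (N0 <= N)%N -> (N%:R : R) `^ (- e) <= c.
Proof.
move=> e0 c0; pose x : R := (c^-1) `^ (e^-1).
exists (Num.truncn x).+1 => N xN.
have xN' : x <= N%:R by apply: (le_trans (ltW (truncnS_gt x))); rewrite ler_nat.
have x0 : 0 < x by rewrite powR_gt0 ?invr_gt0.
have N0 : 0 < N%:R :> R by exact: lt_le_trans xN'.
rewrite powRN -[leRHS]invrK lef_pV2 ?posrE ?powR_gt0 ?invr_gt0//.
have -> : c^-1 = x `^ e by rewrite /x -powRrM mulVf ?gt_eqF// powRr1 ?invr_ge0 ?(ltW c0).
by apply: ge0_ler_powR; rewrite ?nnegrE ?(ltW e0) ?(ltW x0) ?(ltW N0).
Qed.

Lemma continuous_compact_bounded (f : R * R -> R) (A : set (R * R)) : compact A ->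
  {within A, continuous f} -> exists B : R, forall x, A x -> `|f x| <= B.
Proof.
move=> cA cf; have := continuous_compact cf cA.
move=> /compact_bounded [M [_ hM]]; exists (M + 1) => x Ax.
by apply: (hM (M + 1)); [rewrite ltrDl|exists x].
Qed.

End rates.

Section perturbation.
Context d (T : measurableType d) (R : realType) (P : probability T R).
Variables (alpha : R) (Z : set R -> T -> R) (I : (R -> R) -> T -> R) (X : R -> R -> T -> R) (H : R -> R).
Hypotheses (alpha1 : 1 < alpha) (alpha2 : alpha <= 2).
Hypothesis hI : sas_integral P alpha Z I.
Hypothesis hX : lmsm_field P alpha I X.
Variables (h1 h2 : R) (L : nat).
Hypotheses (h1a : alpha^-1 < h1) (h12 : h1 <= h2) (h21 : h2 < 1) (L2 : (2 <= L)%N).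
Hypothesis hH : forall t, 0 <= t <= 1 -> h1 <= H t <= h2.
Local Notation cst g := (@stable_moment_const R alpha g).
Local Notation nrm := (Lalpha_norm alpha).
Local Notation h3 := ((h2 + 1) / 2).

Let kp : [/\ alpha^-1 < h1, h1 <= h2, h2 < 1 & 0 < alpha^-1].
Proof. by split => //; rewrite invr_gt0 (lt_trans ltr01). Qed.

Lemma measurable_kernel u v : measurable_fun [set: R] (lmsm_kernel alpha u v).
Proof.
have m1 : measurable_fun [set: R] ((fun x : R => pos_pow x (v - alpha^-1)) \o (fun s => u - s)).
  by apply: measurableT_comp; [exact: measurable_pos_pow|exact: measurable_funB].
have m2 : measurable_fun [set: R] ((fun x : R => pos_pow x (v - alpha^-1)) \o (fun s => - s)).
  by apply: measurableT_comp; [exact: measurable_pos_pow|exact: measurable_funN].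
exact: (measurable_funB m1 m2).
Qed.

Let D1 := envelope (tail_exponent alpha h2) 1.

Lemma envelope1_Lalpha : D1 \in Lalpha alpha.
Proof. by apply: envelope_Lalpha => //; exact: (tail_exponent_gt alpha1 h1a h12 h21). Qed.

Lemma kernel_Lalpha u v : 0 <= u <= 1 -> h1 <= v <= h3 -> lmsm_kernel alpha u v \in Lalpha alpha.
Proof.
move=> hu hv; apply: (proj1 (Lalpha_dominated (C := 4) alpha1 _ (measurable_kernel u v) envelope1_Lalpha _)) => // s.
rewrite (ger0_norm (envelope_ge0 _ _ _)); exact: (kernel_le_envelope alpha1 h1a h12 h21).
Qed.

Lemma field_integral u v : 0 <= u <= 1 -> h1 <= v <= h3 ->
  {ae P, forall w, X u v w = I (lmsm_kernel alpha u v) w}.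
Proof.
move=> hu /andP[hv1 hv2]; have [? ? ? ?] := kp.
apply: (lmsm_field_integral hX); rewrite in_itv/=//.
by apply/andP; split; lra.
Qed.

(** This is the only use of the continuity of the paths; the compact interval
    of exponents has to contain all interpolation nodes. *)
Lemma field_bounded w : exists B : R, forall u v, 0 <= u <= 1 -> h1 <= v <= h3 -> `|X u v w| <= B.
Proof.
have [? ? ? ?] := kp.
pose A : set (R * R) := `[0, 1]%classic `*` `[h1, h3]%classic.
have cA : compact A by apply: compact_setX; exact: segment_compact.
have cf : {within A, continuous (fun uv : R * R => X uv.1 uv.2 w)}.
  have AB : A `<=` `[0%R, 1%R]%classic `*` `]alpha^-1%R, 1%R[%classic.
    move=> [u v] [/= hu hv]; split => //=; move: hv; rewrite /= !in_itv/= => /andP[a b].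
    by apply/andP; split; lra.
  have cX := @lmsm_field_continuous _ _ _ _ _ _ _ hX w.
  exact: (continuous_subspaceW AB cX).
have [B hB] := continuous_compact_bounded cA cf.
by exists B => u v hu hv; apply: (hB (u, v)); split; rewrite /= in_itv/=.
Qed.

Lemma increment_integral N k v : (0 < N)%N -> (k + L <= N)%N -> h1 <= v <= h2 ->
  {ae P, forall w, I (rescaled alpha (@Phi R alpha L) N k v) w =
     \sum_(l < L.+1) fd_coef L l * I (lmsm_kernel alpha ((k + l)%:R / N%:R) v) w}.
Proof.
move=> N0 kN hv; have [? ? ? ?] := kp.
have hv3 : h1 <= v <= h3 by case/andP: hv => a b; apply/andP; split; lra.
have [|_] := @sas_int_comb _ _ _ P alpha Z I alpha1 hI L.+1 (fd_coef L)
  (fun l => lmsm_kernel alpha ((k + l)%:R / N%:R) v) _.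
  move=> l lL; apply: kernel_Lalpha => //.
  rewrite divr_ge0//= ler_pdivrMr ?ltr0n// mul1r ler_nat (leq_trans _ kN)// leq_add2l -ltnS//.
apply: filterS => w <-; congr (I _ w); apply/funext => s.
exact: rescaled_PhiE.
Qed.

Variables (v : nat -> nat -> R) (cv rho eps : R).
Hypotheses (eps0 : 0 < eps) (epsrho : eps < rho) (rho1 : rho <= 1) (cv0 : 0 <= cv).
Hypothesis hv : forall N k, h1 <= v N k <= h2.
Hypothesis hvH : forall N k l, (0 < N)%N -> (k + l <= N)%N -> (l <= L)%N ->
  `|H ((k + l)%:R / N%:R) - v N k| <= cv * N%:R `^ (- rho).

(** The path is expressed through the interpolation nodes, X(t, H(t)) =
    X(t, v) + sum_i (c_i - [i = 0]) X(t, v + i delta) + remainder, where the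
    remainder is the stable integral of the interpolation error.  As the path is
    bounded on compact sets, the middle sum is at most a random constant times
    the size of c_i - [i = 0]. *)
Lemma perturbation : {ae P, forall w, exists A : R, exists N1 : nat,
  forall N k, (N1 <= N)%N -> (k + L <= N)%N ->
   `|gen_increment L (fun s => lmsm X H s w) N k - I (rescaled alpha (@Phi R alpha L) N k (v N k)) w|
     <= A * N%:R `^ (- (rho - eps))}.
Proof.
have [? ? ? ?] := kp; have rho1' := rho1; have eps0' := eps0; have epsrho' := epsrho.
have h23 : h2 <= h3 by lra.
(* so many nodes that delta^(m + 1) <= N^(-4) *)
pose m := Num.truncn (4 / eps).
have hm : 4 <= eps * m.+1%:R.
  by rewrite mulrC -ler_pdivrMr// ltW// truncnS_gt.
have [C [d0 [C0 d00 hC]]] := kernel_interp alpha1 h1a h12 h21 m.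
pose del (N : nat) : R := N%:R `^ (- eps).
have [Na [Na0 hNa]] : exists Na : nat, (0 < Na)%N /\ forall N, (Na <= N)%N ->
    [/\ del N <= d0, m.+1%:R * del N <= (1 - h2) / 2 & cv * N%:R `^ (- rho) <= del N].
  have [n1 H1] := powR_small eps0 d00.
  have [|n2 H2] := @powR_small R eps ((1 - h2) / 2 / m.+1%:R) eps0.
    by rewrite divr_gt0// divr_gt0// subr_gt0.
  have [||n3 H3] := @powR_small R (rho - eps) ((cv + 1)^-1).
  - by rewrite subr_gt0.
  - by rewrite invr_gt0 ltr_wpDl.
  exists (n1 + n2 + n3).+1; split => // N hN.
  have N0 : 0 < N%:R :> R by rewrite ltr0n; move: hN; clear; lia.
  split.
  - by apply: H1; move: hN; clear; lia.
  - by rewrite mulrC -ler_pdivlMr//; apply: H2; move: hN; clear; lia.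
  - have -> : N%:R `^ (- rho) = N%:R `^ (- (rho - eps)) * del N.
      by rewrite -gt0_powRD//; congr (_ `^ _); ring.
    rewrite mulrA ler_piMl ?powR_ge0//.
    apply: (@le_trans _ _ (cv * (cv + 1)^-1)); first by rewrite ler_wpM2l//; apply: H3; move: hN; clear; lia.
    by rewrite ler_pdivrMr ?mul1r ?lerDl// ltr_wpDl.
pose t (N k l : nat) : R := (k + l)%:R / N%:R.
pose good (N k l : nat) := [&& (Na <= N)%N, (k + l <= N)%N & (l <= L)%N].
have tgood N k l : good N k l -> 0 <= t N k l <= 1.
  move=> /and3P[NN kl lL]; rewrite divr_ge0//= ler_pdivrMr ?mul1r ?ler_nat// ltr0n.
  exact: leq_trans NN.
(* choose the interpolation coefficients for all (N, k, l) at once, so that the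
   random remainders are countably many *)
have hcc0 (z : nat * nat * nat) : exists c : nat -> R, good z.1.1 z.1.2 z.2 ->
  (forall i, (i < m.+1)%N -> `|c i - (i == 0)%:R| <= C * (`|H (t z.1.1 z.1.2 z.2) - v z.1.1 z.1.2| / del z.1.1)) /\
  forall s, `|lmsm_kernel alpha (t z.1.1 z.1.2 z.2) (H (t z.1.1 z.1.2 z.2)) s -
      \sum_(i < m.+1) c i * lmsm_kernel alpha (t z.1.1 z.1.2 z.2) (v z.1.1 z.1.2 + i%:R * del z.1.1) s|
     <= C * del z.1.1 ^+ m.+1 * D1 s.
  case: z => -[N k] l /=.
  have [g|/negP ng] := boolP (good N k l); last by exists (fun=> 0).
  have /and3P[NN kl lL] := g; have [e1 e2 e3] := hNa N NN.
  have N0 : (0 < N)%N by exact: leq_trans NN.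
  have [||c [Hc1 Hc2]] := hC (v N k) (H (t N k l)) (del N) (hv N k).
  - by rewrite powR_gt0 ?ltr0n//=.
  - exact: le_trans (hvH N0 kl lL) e3.
  by exists c => _; split => // s; apply: Hc2; exact: tgood.
have [cc hcc] := boolp.choice hcc0.
(* the interpolation error, as an integrand *)
pose rk (N k l : nat) (s : R) : R := (-1) * (\sum_(i < m.+1) cc (N, k, l) i * lmsm_kernel alpha (t N k l) (v N k + i%:R * del N) s)
   + lmsm_kernel alpha (t N k l) (H (t N k l)) s.
have vnode N k l i : good N k l -> (i < m.+1)%N -> h1 <= v N k + i%:R * del N <= h3.
  move=> /and3P[NN _ _] im; have [_ e2 _] := hNa N NN; have /andP[a b] := hv N k.
  have i0 : 0 <= i%:R * del N by rewrite mulr_ge0// powR_ge0.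
  have i1 : i%:R * del N <= (1 - h2) / 2.
    by apply: le_trans e2; rewrite ler_wpM2r ?powR_ge0// ler_nat ltnW.
  have -> : h3 = h2 + (1 - h2) / 2 by field.
  by rewrite (le_trans a) ?lerDl//= lerD.
have hH3 N k l : good N k l -> h1 <= H (t N k l) <= h3.
  by move=> g; have /andP[a b] := hH (tgood _ _ _ g); rewrite a (le_trans b).
have nodeL N k l i : good N k l -> (i < m.+1)%N -> lmsm_kernel alpha (t N k l) (v N k + i%:R * del N) \in Lalpha alpha.
  by move=> g im; apply: kernel_Lalpha; [exact: tgood|exact: (vnode N k l)].
have HL N k l : good N k l -> lmsm_kernel alpha (t N k l) (H (t N k l)) \in Lalpha alpha.
  by move=> g; apply: kernel_Lalpha; [exact: tgood|exact: hH3].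
have combL N k l (g : good N k l) := @sas_int_comb _ _ _ P alpha Z I alpha1 hI m.+1 (cc (N, k, l))
  (fun i => lmsm_kernel alpha (t N k l) (v N k + i%:R * del N)) (fun i im => nodeL N k l i g im).
have rkL N k l : good N k l -> rk N k l \in Lalpha alpha /\
    nrm (rk N k l) <= C * del N ^+ m.+1 * nrm D1.
  move=> g; have [_ Hc2] := hcc (N, k, l) g.
  apply: Lalpha_dominated => //.
  - by rewrite mulr_ge0// exprn_ge0// powR_ge0.
  - apply: measurable_funD; last exact: measurable_kernel.
    apply: measurable_funM => //; apply: measurable_sum => i; apply: measurable_funM => //.
    exact: measurable_kernel.
  - exact: envelope1_Lalpha.
  move=> s; rewrite (ger0_norm (envelope_ge0 _ _ _)) /rk mulN1r addrC; exact: Hc2.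
have aeR N k l : {ae P, forall w, good N k l -> I (rk N k l) w =
    X (t N k l) (H (t N k l)) w - \sum_(i < m.+1) cc (N, k, l) i * X (t N k l) (v N k + i%:R * del N) w}.
  have [g|/negP ng] := boolP (good N k l); last by apply: aeW => w.
  have [L1 E1] := combL N k l g.
  have E2 := sas_int_linear hI (-1) L1 (HL N k l g).
  have E3 := field_integral (tgood _ _ _ g) (hH3 _ _ _ g).
  have E4 : {ae P, forall w, forall i, (i < m.+1)%N ->
      X (t N k l) (v N k + i%:R * del N) w = I (lmsm_kernel alpha (t N k l) (v N k + i%:R * del N)) w}.
    apply: ae_foralln => i; have [im|im] := ltnP i m.+1; last by apply: aeW => w.
    by have := field_integral (tgood _ _ _ g) (vnode _ _ _ _ g im); apply: filterS => w.
  near=> w => _.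
  have e1 : I (fun s => \sum_(i < m.+1) cc (N, k, l) i * lmsm_kernel alpha (t N k l) (v N k + i%:R * del N) s) w =
    \sum_(i < m.+1) cc (N, k, l) i * I (lmsm_kernel alpha (t N k l) (v N k + i%:R * del N)) w by near: w; exact: E1.
  have e2 : I (rk N k l) w = (-1) * I (fun s => \sum_(i < m.+1) cc (N, k, l) i * lmsm_kernel alpha (t N k l) (v N k + i%:R * del N) s) w + I (lmsm_kernel alpha (t N k l) (H (t N k l))) w by near: w; exact: E2.
  have e3 : X (t N k l) (H (t N k l)) w = I (lmsm_kernel alpha (t N k l) (H (t N k l))) w by near: w; exact: E3.
  have e4 : forall i, (i < m.+1)%N ->
      X (t N k l) (v N k + i%:R * del N) w = I (lmsm_kernel alpha (t N k l) (v N k + i%:R * del N)) w by near: w; exact: E4.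
  rewrite e2 e1 e3 mulN1r addrC; congr (_ - _); apply: eq_bigr => i _; rewrite e4//.
have aeI N k : {ae P, forall w, (Na <= N)%N -> (k + L <= N)%N ->
    I (rescaled alpha (@Phi R alpha L) N k (v N k)) w = \sum_(l < L.+1) fd_coef L l * X (t N k l) (v N k) w}.
  have [NN|NN] := leqP Na N; last by apply: aeW => w.
  have [kN|kN] := leqP (k + L) N; last by apply: aeW => w.
  have N0 : (0 < N)%N by exact: leq_trans NN.
  have E1 := increment_integral N0 kN (hv N k).
  have E2 : {ae P, forall w, forall l, (l < L.+1)%N -> X (t N k l) (v N k) w = I (lmsm_kernel alpha (t N k l) (v N k)) w}.
    apply: ae_foralln => l; have [lL|lL] := ltnP l L.+1; last by apply: aeW => w.
    have g : good N k l by apply/and3P; split => //; move: kN lL; clear; lia.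
    have h : h1 <= v N k <= h3 by have /andP[a b] := hv N k; rewrite a (le_trans b).
    by have := field_integral (tgood _ _ _ g) h; apply: filterS => w.
  apply: filterS2 E1 E2 => w e1 e2 _ _; rewrite e1; apply: eq_bigr => l _.
  by rewrite e2.
pose bad1 N k l : set T := if good N k l then [set w | N%:R^-1 <= `|I (rk N k l) w|] else set0.
have mbad1 N k l : measurable (bad1 N k l).
  rewrite /bad1; case: ifP => // g; apply: measurable_ge_norm.
  exact: (sas_int_measurable hI (rkL _ _ _ g).1).
pose bad N : set T := \big[setU/set0]_(k < N.+1) \big[setU/set0]_(l < L.+1) bad1 N k l.
have mbad2 N k : measurable (\big[setU/set0]_(l < L.+1) bad1 N k l) by exact: bigsetU_measurable.
have mbad N : measurable (bad N) by exact: bigsetU_measurable.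
have c10 : 0 <= cst 1 by rewrite ltW// stable_moment_const_gt0// ltr01.
pose K := cst 1 * (C * nrm D1).
have K0 : 0 <= K by apply: (mulr_ge0 c10); apply: mulr_ge0 => //; exact: Lalpha_norm_ge0.
have Pbad N : (Na <= N)%N -> (P (bad N) <= (2 * L.+1%:R * K * N%:R `^ (- 2))%:E)%E.
  move=> NN; have N0 : (0 < N)%N by exact: leq_trans NN.
  have Nr : 0 < N%:R :> R by rewrite ltr0n.
  have N1 : 1 <= N%:R :> R by rewrite ler1n.
  pose pb := K * N%:R `^ (- 3).
  have P1 k l : (P (bad1 N k l) <= pb%:E)%E.
    rewrite /bad1; case: ifP => g; last first.
      by rewrite measure0 lee_fin mulr_ge0// powR_ge0.
    have [L1 E1] := rkL _ _ _ g.
    have Ni : 0 < N%:R^-1 :> R by rewrite invr_gt0.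
    apply: (le_trans (sas_int_markov alpha1 alpha2 hI L1 Ni)); rewrite lee_fin invrK.
    apply: (@le_trans _ _ (cst 1 * (C * del N ^+ m.+1 * nrm D1) * N%:R)).
      by rewrite ler_wpM2r// ler_wpM2l.
    rewrite (_ : cst 1 * _ * _ = K * (del N ^+ m.+1 * N%:R)); last by rewrite /K; ring.
    rewrite ler_wpM2l// /del -powR_mulrn ?powR_ge0// -powRrM.
    rewrite -{2}[N%:R]powRr1 ?(ltW Nr)// -gt0_powRD// ler_powR//; lra.
  have P2 k : (P (\big[setU/set0]_(l < L.+1) bad1 N k l) <= (L.+1%:R * pb)%:E)%E.
    apply: (le_trans (Boole_inequality P (fun l _ => mbad1 N k l))).
    apply: (@le_trans _ _ (\sum_(l < L.+1) pb%:E)%E); first by apply: lee_sum => l _; exact: P1.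
    by rewrite sumEFin sumr_const card_ord mulr_natl.
  apply: (le_trans (Boole_inequality P (fun k _ => mbad2 N k))).
  apply: (@le_trans _ _ (\sum_(k < N.+1) (L.+1%:R * pb)%:E)%E); first by apply: lee_sum => k _; exact: P2.
  rewrite sumEFin sumr_const card_ord lee_fin -[leLHS]mulr_natl /pb.
  have -> : N%:R `^ (-3) = N%:R `^ (-2) * N%:R^-1 :> R.
    by rewrite -[N%:R^-1]powR_inv1 ?(ltW Nr)// -gt0_powRD//; congr (_ `^ _); ring.
  rewrite [leLHS](_ : _ = (N.+1%:R / N%:R) * (L.+1%:R * K * N%:R `^ (-2))); last by ring.
  rewrite [leRHS](_ : _ = 2 * (L.+1%:R * K * N%:R `^ (-2))); last by ring.
  have KK : 0 <= L.+1%:R * K * N%:R `^ (-2).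
    by apply: mulr_ge0; [exact: (mulr_ge0 (ler0n _ _) K0)|exact: powR_ge0].
  apply: (ler_wpM2r KK).
  by rewrite ler_pdivrMr// -natr1; lra.
have BC := @borel_cantelli_powR _ _ _ P bad (2 * L.+1%:R * K) 2 Na _ _ mbad Pbad.
have {}BC : {ae P, forall w, exists N1, forall N, (N1 <= N)%N -> ~ bad N w}.
  by apply: BC; [rewrite ltr1n|exact: (mulr_ge0 _ K0)].
have AR : {ae P, forall w, forall N k l, good N k l -> I (rk N k l) w =
    X (t N k l) (H (t N k l)) w - \sum_(i < m.+1) cc (N, k, l) i * X (t N k l) (v N k + i%:R * del N) w}.
  by do 3 apply: ae_foralln => ?; exact: aeR.
have AI : {ae P, forall w, forall N k, (Na <= N)%N -> (k + L <= N)%N ->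
    I (rescaled alpha (@Phi R alpha L) N k (v N k)) w = \sum_(l < L.+1) fd_coef L l * X (t N k l) (v N k) w}.
  by do 2 apply: ae_foralln => ?; exact: aeI.
apply: filterS3 BC AR AI => w [N1 hN1] hR hAI.
have [B hB] := field_bounded w.
have B0 : 0 <= B.
  apply: le_trans (hB 0 h1 _ _) => //; first by rewrite lexx ler01.
  by rewrite lexx (le_trans h12).
pose Q := 1 + m.+1%:R * (C * cv * B).
pose SL : R := \sum_(l < L.+1) `|fd_coef L l|.
exists (SL * Q), (maxn N1 Na) => N k; rewrite geq_max => /andP[NN1 NNa] kN.
have N0 : (0 < N)%N by exact: leq_trans NNa.
have Nr : 0 < N%:R :> R by rewrite ltr0n.
have Nr1 : 1 <= N%:R :> R by rewrite ler1n.
rewrite hAI// /gen_increment /lmsm.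
have -> : \sum_(l < L.+1) (-1) ^+ (L - l) * 'C(L, l)%:R * X ((k + l)%:R / N%:R) (H ((k + l)%:R / N%:R)) w -
   \sum_(l < L.+1) fd_coef L l * X (t N k l) (v N k) w =
   \sum_(l < L.+1) fd_coef L l * (X (t N k l) (H (t N k l)) w - X (t N k l) (v N k) w).
  by rewrite -sumrB; apply: eq_bigr => l _; rewrite mulrBr.
apply: (le_trans (ler_norm_sum _ _ _)); rewrite -mulrA /SL mulr_suml; apply: ler_sum => l _.
rewrite normrM ler_wpM2l//.
have g : good N k l by apply/and3P; split => //; [have := ltn_ord l; move: kN; clear; lia|rewrite -ltnS].
have hRw := hR N k l g.
have [Hc1 _] := hcc (N, k, (l : nat)) g; rewrite /= in Hc1.
have nb : `|I (rk N k l) w| < N%:R^-1.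
  rewrite ltNge; apply/negP => hb; apply: (hN1 N NN1).
  have kN1 : (k < N.+1)%N by move: kN; clear; lia.
  rewrite /bad (bigD1 (Ordinal kN1))//=; left.
  rewrite (bigD1 l)//=; left.
  by rewrite /bad1 g.
have x0 : v N k + 0%:R * del N = v N k by rewrite mul0r addr0.
have E : X (t N k l) (H (t N k l)) w - X (t N k l) (v N k) w = I (rk N k l) w +
   \sum_(i < m.+1) (cc (N, k, (l : nat)) i - (i == 0 :> nat)%:R) * X (t N k l) (v N k + i%:R * del N) w.
  have -> : \sum_(i < m.+1) (cc (N, k, (l : nat)) i - (i == 0 :> nat)%:R) * X (t N k l) (v N k + i%:R * del N) w =
     \sum_(i < m.+1) cc (N, k, (l : nat)) i * X (t N k l) (v N k + i%:R * del N) w - X (t N k l) (v N k) w.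
    under eq_bigr do rewrite mulrBl.
    rewrite sumrB; congr (_ - _); rewrite big_ord_recl/= x0 mul1r big1 ?addr0// => i _.
    by rewrite mul0r.
  by rewrite hRw addrA subrK.
rewrite E; apply: (le_trans (ler_normD _ _)); rewrite /Q mulrDl mul1r; apply: lerD.
  apply: (le_trans (ltW nb)); rewrite -[leLHS]powR_inv1 ?(ltW Nr)// ler_powR// lerN2.
  by rewrite lerBlDr (le_trans rho1')// lerDl ltW.
apply: (le_trans (ler_norm_sum _ _ _)).
apply: (@le_trans _ _ (\sum_(i < m.+1) (C * cv * B) * N%:R `^ (- (rho - eps)))); last first.
  by rewrite sumr_const card_ord -[leLHS]mulr_natl !mulrA.
apply: ler_sum => i _; rewrite normrM.
have h : `|cc (N, k, (l : nat)) i - (i == 0 :> nat)%:R| <= C * cv * N%:R `^ (- (rho - eps)).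
  apply: (le_trans (Hc1 i (ltn_ord i))); rewrite -mulrA ler_wpM2l//.
  have kl : (k + l <= N)%N by case/and3P: g.
  have lL : (l <= L)%N by case/and3P: g.
  rewrite ler_pdivrMr ?powR_gt0//.
  apply: (le_trans (hvH N0 kl lL)); rewrite -mulrA ler_wpM2l// /del -gt0_powRD//.
  by rewrite ler_powR//; lra.
rewrite (_ : C * cv * B * _ = (C * cv * N%:R `^ (- (rho - eps))) * B); last by ring.
apply: ler_pM => //; apply: hB; first exact: tgood.
exact: (vnode N k l).
Unshelve. all: by end_near.
Qed.

End perturbation.

(** * Concentration of the power sums of the path *)

Lemma sum_nat_shift (R : realType) (s q : nat) (F : nat -> R) :
  \sum_(s <= k < s + q) F k = \sum_(i < q) F (s + i)%N.
Proof.
rewrite (_ : \sum_(s <= k < s + q) F k = \sum_(0 + s <= k < q + s) F k); last first.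
  by rewrite add0n addnC.
rewrite big_addn addnK big_mkord; by apply: eq_bigr => i _; rewrite addnC.
Qed.

Section dominance.
Context {R : realType}.

Lemma ln_le_powR (N : nat) (e : R) : 0 < e -> (0 < N)%N -> ln N%:R <= e^-1 * N%:R `^ e.
Proof.
move=> e0 N0; have Nr : 0 < N%:R :> R by rewrite ltr0n.
rewrite ler_pdivlMl// -ln_powR.
have := expR_ge1Dx (ln (N%:R `^ e) : R); rewrite lnK ?posrE ?powR_gt0// => h.
by apply: le_trans h; rewrite lerDr.
Qed.

(** The exponent decays faster than 1 / log N, so the power tends to 1. *)
Lemma powR_near1 (K e : R) : 0 <= K -> 0 < e ->
  exists N0 : nat, forall N, (N0 <= N)%N -> (N%:R : R) `^ (K * N%:R `^ (- e)) <= 2.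
Proof.
move=> K0 e0; pose h := e / 2.
have h0 : 0 < h by rewrite divr_gt0.
have l2 : 0 < ln 2 :> R by rewrite ln_gt0// ltr1n.
have [|n1 H1] := @powR_small R h (h * ln 2 / (K + 1)) h0.
  by rewrite divr_gt0 ?mulr_gt0// ltr_wpDl.
exists n1.+1 => N nN.
have N0 : (0 < N)%N by exact: leq_trans nN.
have Nr : 0 < N%:R :> R by rewrite ltr0n.
rewrite /powR gt_eqF// -[leRHS]lnK ?posrE// ler_expR.
rewrite -/(powR _ _).
have -> : expR (- e * ln N%:R) = N%:R `^ (- h) * N%:R `^ (- h).
  by rewrite /powR gt_eqF// -expRD; congr expR; rewrite /h; field.
apply: (@le_trans _ _ (K * (N%:R `^ (- h) * N%:R `^ (- h)) * (h^-1 * N%:R `^ h))).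
  by rewrite ler_wpM2l ?ln_le_powR// !mulr_ge0// powR_ge0.
have -> : K * (N%:R `^ (- h) * N%:R `^ (- h)) * (h^-1 * N%:R `^ h) = K * h^-1 * N%:R `^ (- h).
  have E : N%:R `^ (- h) * N%:R `^ h = 1 by rewrite -gt0_powRD// addNr powRr0.
  rewrite (_ : _ * _ = (K * h^-1 * N%:R `^ (- h)) * (N%:R `^ (- h) * N%:R `^ h)); last by ring.
  by rewrite E mulr1.
apply: (@le_trans _ _ (K * h^-1 * (h * ln 2 / (K + 1)))).
  rewrite ler_wpM2l//; first by rewrite mulr_ge0// invr_ge0 ltW.
  by apply: H1; exact: ltnW.
have K1 : 0 < K + 1 by rewrite ltr_wpDl.
rewrite (_ : _ * _ = ln 2 * (K / (K + 1))); last by field; rewrite !gt_eqF.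
rewrite -[leRHS]mulr1 ler_wpM2l ?(ltW l2)//.
by rewrite ler_pdivrMr// mul1r lerDl.
Qed.

Variables (H : R -> R) (c cv rho beta : R) (v : nat -> nat -> R) (L : nat).
Hypotheses (rho0 : 0 < rho) (beta0 : 0 < beta) (c0 : 0 <= c) (cv0 : 0 <= cv).
Hypothesis hH : forall t1 t2, 0 <= t1 <= 1 -> 0 <= t2 <= 1 -> `|H t1 - H t2| <= c * `|t1 - t2| `^ rho.
Hypothesis hv : forall N k, (0 < N)%N -> (k <= N)%N -> `|H (k%:R / N%:R) - v N k| <= cv * N%:R `^ (- rho).

(** The terms at distance O(N^(1 - e0)) from [k'] are all comparable to the
    one at [k'], since the exponents v vary there by O(N^(- e0 rho)); at least
    N^(1 - e0) of them lie in the interval. *)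
Lemma no_dominant_term (e0 : R) : 0 < e0 < 1 -> exists N1 : nat, forall N p n k', (N1 <= N)%N ->
  (p + n <= N.+1)%N -> N%:R `^ (1 - e0) + 1 <= n%:R -> (k' <= N)%N -> (p <= k' + L + 1)%N ->
  (k' <= p + n + L + 1)%N ->
  (N%:R `^ (- v N k')) `^ beta <= 2 * N%:R `^ (e0 - 1) * \sum_(k < n) (N%:R `^ (- v N (p + k)%N)) `^ beta.
Proof.
move=> /andP[e00 e01].
pose K := c * L.+3%:R `^ rho + 2 * cv.
have K0 : 0 <= K by rewrite addr_ge0 ?mulr_ge0 ?powR_ge0.
have er0 : 0 < e0 * rho by rewrite mulr_gt0.
have [|n1 H1] := @powR_near1 (beta * K) (e0 * rho) _ er0; first by rewrite mulr_ge0// ltW.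
exists n1.+1 => N p n k' nN pnN hn k'N pk kp.
have N0 : (0 < N)%N by exact: leq_trans nN.
have Nr : 0 < N%:R :> R by rewrite ltr0n.
have N1 : 1 <= N%:R :> R by rewrite ler1n.
pose x : R := N%:R `^ (1 - e0).
have x1 : 1 <= x.
  have := @ler_powR R N%:R N1 0 (1 - e0); rewrite powRr0; apply.
  by rewrite subr_ge0 ltW.
pose q := (Num.truncn x).+1.
have xq : x <= q%:R by rewrite ltW// truncnS_gt.
have qx : q%:R <= x + 1 by rewrite -natr1 lerD2r Num.Theory.truncn_le// (le_trans ler01).
have qn : (q <= n)%N by rewrite -(ler_nat R); apply: le_trans hn.
(* a window of q indices inside [p, p + n) and as close to k' as possible *)
pose s := maxn p (minn k' (p + n - q)).
have sp : (p <= s)%N by rewrite leq_maxl.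
have sq : (s + q <= p + n)%N by rewrite /s; move: qn; clear; lia.
have close i : (i < q)%N -> (k' <= s + i + (q + L + 1))%N /\ (s + i <= k' + (q + L + 1))%N.
  by rewrite /s; move: qn pk kp; clear; lia.
have wle i : (i < q)%N -> (N%:R `^ (- v N k')) `^ beta <= 2 * (N%:R `^ (- v N (s + i)%N)) `^ beta.
  move=> iq; have [c1 c2] := close i iq.
  have siN : (s + i <= N)%N by move: sq pnN iq; clear; lia.
  have dk : `|(s + i)%:R / N%:R - k'%:R / N%:R| <= L.+3%:R * N%:R `^ (- e0) :> R.
    rewrite -mulrBl normrM normfV (gtr0_norm Nr) ler_pdivrMr// -mulrA.
    have -> : N%:R `^ (- e0) * N%:R = x.
      by rewrite -[X in _ * X]powRr1 ?(ltW Nr)// -gt0_powRD//; congr (_ `^ _); ring.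
    apply: (@le_trans _ _ (q + L + 1)%:R).
      rewrite ler_norml; apply/andP; split.
        by rewrite lerNl opprB lerBlDr -natrD ler_nat; move: c1; clear; lia.
      by rewrite lerBlDr -natrD ler_nat; move: c2; clear; lia.
    rewrite !natrD -natr1 -natr1 -natr1 !mulrDl !mul1r.
    have Lx : L%:R <= L%:R * x by rewrite ler_peMr.
    lra.
  have u01 j : (j <= N)%N -> 0 <= (j%:R / N%:R : R) <= 1.
    by move=> jN; rewrite divr_ge0//= ler_pdivrMr// mul1r ler_nat.
  have gap : `|v N (s + i)%N - v N k'| <= K * N%:R `^ (- (e0 * rho)).
    have g1 := hv N0 siN; have g2 := hv N0 k'N.
    have g3 := hH (u01 _ siN) (u01 _ k'N).
    have g4 : c * `|(s + i)%:R / N%:R - k'%:R / N%:R| `^ rho <= c * L.+3%:R `^ rho * N%:R `^ (- (e0 * rho)).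
      have -> : N%:R `^ (- (e0 * rho)) = (N%:R `^ (- e0)) `^ rho by rewrite -powRrM mulNr.
      rewrite -mulrA ler_wpM2l// -powRM ?powR_ge0//.
      by apply: ge0_ler_powR; rewrite ?nnegrE ?(ltW rho0)// mulr_ge0// powR_ge0.
    have g5 : cv * N%:R `^ (- rho) <= cv * N%:R `^ (- (e0 * rho)).
      by rewrite ler_wpM2l// ler_powR// lerN2 ger_pMl// ltW.
    rewrite (_ : v N (s + i)%N - v N k' = (H ((s + i)%:R / N%:R) - H (k'%:R / N%:R)) -
      (H ((s + i)%:R / N%:R) - v N (s + i)%N) + (H (k'%:R / N%:R) - v N k')); last by ring.
    apply: (le_trans (ler_normD _ _)).
    apply: (@le_trans _ _ ((c * L.+3%:R `^ rho * N%:R `^ (- (e0 * rho)) + cv * N%:R `^ (- (e0 * rho))) + cv * N%:R `^ (- (e0 * rho)))).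
      apply: lerD; last exact: le_trans g2 g5.
      apply: (le_trans (ler_normB _ _)); apply: lerD; [exact: le_trans g3 g4|exact: le_trans g1 g5].
    by rewrite /K; rewrite le_eqVlt; apply/orP; left; apply/eqP; ring.
  rewrite -!powRrM.
  have -> : - v N k' * beta = (v N (s + i)%N - v N k') * beta + (- v N (s + i)%N * beta) by ring.
  rewrite gt0_powRD// ler_wpM2r ?powR_ge0//.
  apply: (@le_trans _ _ (N%:R `^ (beta * K * N%:R `^ (- (e0 * rho))))); last first.
    by apply: H1; exact: ltnW.
  rewrite ler_powR// mulrC -mulrA ler_wpM2l ?(ltW beta0)//.
  by apply: le_trans gap; exact: ler_norm.
set W := \sum_(k < n) _.
have sumq : x * (N%:R `^ (- v N k')) `^ beta <= 2 * W.
  apply: (@le_trans _ _ (\sum_(i < q) (N%:R `^ (- v N k')) `^ beta)).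
    by rewrite sumr_const card_ord -[leRHS]mulr_natl ler_wpM2r ?powR_ge0.
  apply: (@le_trans _ _ (\sum_(i < q) 2 * (N%:R `^ (- v N (s + i)%N)) `^ beta)).
    by apply: ler_sum => i _; exact: wle.
  rewrite -mulr_sumr ler_wpM2l//.
  pose F k := (N%:R `^ (- v N k)) `^ beta.
  have F0 k : 0 <= F k by exact: powR_ge0.
  have -> : \sum_(i < q) (N%:R `^ (- v N (s + i)%N)) `^ beta = \sum_(s <= k < s + q) F k.
    by rewrite sum_nat_shift.
  have -> : W = \sum_(p <= k < p + n) F k by rewrite sum_nat_shift.
  rewrite (@big_cat_nat _ _ _ s p (p + n))//=; last by move: sq; clear; lia.
  rewrite [X in _ <= _ + X](@big_cat_nat _ _ _ (s + q))//=; last by move: sq; clear; lia.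
  rewrite addrCA -[leLHS]addr0 lerD2l addr_ge0//; exact: sumr_ge0.
have xx : x * N%:R `^ (e0 - 1) = 1.
  by rewrite /x -gt0_powRD// (_ : _ + _ = 0) ?powRr0//; ring.
rewrite -[leLHS]mulr1 -[X in _ * X <= _]xx mulrA (mulrC 2) -[leRHS]mulrA [leRHS]mulrC.
by rewrite ler_wpM2r ?powR_ge0// mulrC.
Qed.

End dominance.

Lemma markov_ratio_algebra (R : realType) (C a b z k e : R) : a != 0 -> k != 0 -> e != 0 ->
  C * (2 * b * e) ^+ 4 * z / (a / 2 * (k * e)) ^+ 4 = C * (4 / k) ^+ 4 * ((b / a) ^+ 4 * z).
Proof. by move=> a0 k0 e0; field; rewrite a0 k0 e0. Qed.

Lemma half_fraction (R : realType) (a k : R) : 0 <= a -> 0 <= k -> a * (k / 2 / (a + 1)) <= 2^-1 * k.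
Proof.
move=> a0 k0; have a1 : 0 < a + 1 by rewrite ltr_wpDl.
have -> : a * (k / 2 / (a + 1)) = 2^-1 * k * a / (a + 1) by field; rewrite gt_eqF.
rewrite ler_pdivrMr//; apply: ler_wpM2l; last by rewrite lerDl.
by apply: mulr_ge0 => //; rewrite invr_ge0.
Qed.

Lemma perturbation_power (R : realType) (x A N rho h2 v beta : R) : 1 <= N -> 0 < beta ->
  v <= h2 -> `|x| <= A * N `^ (- (rho - (rho - h2) / 2)) ->
  `|x| `^ beta <= `|A| `^ beta * N `^ (- ((rho - h2) / 2 * beta)) * (N `^ (- v)) `^ beta.
Proof.
move=> N1 b0 vh h; have N0 : 0 < N by exact: lt_le_trans N1.
apply: (@le_trans _ _ ((`|A| * N `^ (- (rho - (rho - h2) / 2))) `^ beta)).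
  apply: ge0_ler_powR; rewrite ?nnegrE ?(ltW b0)//.
    by apply: mulr_ge0 => //; exact: powR_ge0.
  by apply: (le_trans h); apply: ler_wpM2r; [exact: powR_ge0|exact: ler_norm].
rewrite (powRM _ (normr_ge0 A) (powR_ge0 N _)) -[leRHS]mulrA.
apply: ler_wpM2l; first exact: powR_ge0.
rewrite -(powRrM N (- v)) -(powRrM N (- _)) -gt0_powRD//; apply: ler_powR => //.
have -> : - ((rho - h2) / 2 * beta) + - v * beta = - (((rho - h2) / 2 + v) * beta) by ring.
rewrite mulNr lerN2; apply: ler_wpM2r; [exact: ltW|lra].
Qed.

Section concentration.
Context d (T : measurableType d) (R : realType) (P : probability T R).
Variables (alpha : R) (Z : set R -> T -> R) (I : (R -> R) -> T -> R) (X : R -> R -> T -> R) (H : R -> R).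
Hypotheses (alpha1 : 1 < alpha) (alpha2 : alpha <= 2).
Hypothesis hI : sas_integral P alpha Z I.
Hypothesis hX : lmsm_field P alpha I X.
Variables (h1 h2 beta : R) (L : nat).
Hypotheses (h1a : alpha^-1 < h1) (h12 : h1 <= h2) (h21 : h2 < 1).
Hypotheses (beta0 : 0 < beta) (beta4 : beta <= 4^-1).
Hypotheses (L2 : (2 <= L)%N) (Lbeta : 2 / beta + 1 < L%:R).
Hypothesis hH : forall t, 0 <= t <= 1 -> h1 <= H t <= h2.
Variables (c rho : R).
Hypotheses (c0 : 0 <= c) (h2rho : h2 < rho) (rho1 : rho <= 1).
Hypothesis hHol : forall t1 t2, 0 <= t1 <= 1 -> 0 <= t2 <= 1 -> `|H t1 - H t2| <= c * `|t1 - t2| `^ rho.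
Local Notation cst g := (@stable_moment_const R alpha g).
Local Notation nrm := (Lalpha_norm alpha).
Local Notation Gk N k v := (rescaled alpha (@Phi R alpha L) N k v).

Variables (v : nat -> nat -> R) (cv e0 : R) (nc : nat -> nat) (p n : nat -> nat -> nat) (Nb : nat).
Hypothesis cv0 : 0 <= cv.
Hypothesis hv : forall N k, h1 <= v N k <= h2.
Hypothesis hvH : forall N k l, (0 < N)%N -> (k + l <= N)%N -> (l <= L)%N ->
  `|H ((k + l)%:R / N%:R) - v N k| <= cv * N%:R `^ (- rho).
Hypotheses (e00 : 0 < e0) (e064 : e0 <= 64^-1) (e0b : e0 < beta * ((rho - h2) / 2)).
Hypothesis fam : forall N, (Nb <= N)%N -> (nc N)%:R <= (N%:R : R) `^ e0 /\
  forall i, (i < nc N)%N -> (p N i + n N i + L <= N.+1)%N /\ (N%:R : R) `^ (1 - e0) + 1 <= (n N i)%:R.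

(** By [sas_moment], the expectation of the power sum of the [n] increments from
    index [p] on, frozen at [w]. *)
Definition mean_sum (w : nat -> R) (N p n : nat) : R :=
  \sum_(k < n) cst beta * nrm (Gk N (p + k) (w (p + k)%N)) `^ beta.

(** The number of cells is at most N^(e0), and a deviation on one cell has
    probability O(N^(8 e0 - 3/2)), so the exceptional events at level N have
    total probability O(N^(-5/4)).  The rest of the error comes from freezing:
    by subadditivity it is at most the sum of the beta-th powers of the bounds of
    [perturbation]. *)
Lemma level_concentration : {ae P, forall w, exists N1 : nat, forall N i, (N1 <= N)%N -> (i < nc N)%N ->
  `|\sum_(k < n N i) `|gen_increment L (fun s => lmsm X H s w) N (p N i + k)| `^ beta
      - mean_sum (v N) N (p N i) (n N i)| <= N%:R `^ (- e0) * mean_sum (v N) N (p N i) (n N i)}.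
Proof.
have h2rho' := h2rho; have rho1' := rho1; have beta0' := beta0; have beta4' := beta4.
have alpha1' := alpha1; have e064' := e064; have e00' := e00.
have ai0 : 0 < alpha^-1 by rewrite invr_gt0 (lt_trans ltr01).
have h20 : 0 < h2 by rewrite (lt_le_trans _ h12)// (lt_trans ai0).
have rho0 : 0 < rho by exact: lt_trans h2rho.
have bb : 0 <= beta by exact: ltW.
have [C C0 hC] := fluctuation alpha1 alpha2 hI h1a h12 h21 beta0 beta4 L2 Lbeta.
(* half of the margin between rho and the largest exponent *)
pose eps := (rho - h2) / 2.
have eps0 : 0 < eps by rewrite divr_gt0// subr_gt0.
have epsrho : eps < rho by rewrite /eps; lra.
have hpert := perturbation alpha1 alpha2 hI hX h1a h12 h21 L2 hH eps0 epsrho rho1 cv0 hv hvH.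
have hvH0 N k : (0 < N)%N -> (k <= N)%N -> `|H (k%:R / N%:R) - v N k| <= cv * N%:R `^ (- rho).
  by move=> N0 kN; have := @hvH N k 0 N0; rewrite addn0; apply.
have [|Nn hdom] := @no_dominant_term R H c cv rho beta v L rho0 beta0 c0 cv0 hHol hvH0 e0.
  by rewrite e00/=; lra.
pose wk N k := (N%:R `^ (- v N k)) `^ beta.
pose Ew N i := \sum_(k < n N i) wk N (p N i + k)%N.
pose kap := cst beta * 8^-1 `^ beta.
have b01 : 0 < beta <= 1 by apply/andP; split; lra.
have b1 : 0 < beta < alpha by apply/andP; split; lra.
have cb0 : 0 < cst beta by exact: stable_moment_const_gt0.
have kap0 : 0 < kap by apply: mulr_gt0 => //; rewrite powR_gt0.
have EwE N i : (0 < N)%N -> kap * Ew N i <= mean_sum (v N) N (p N i) (n N i).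
  move=> N0; rewrite /mean_sum /Ew mulr_sumr; apply: ler_sum => k _.
  rewrite /kap -mulrA; apply: ler_wpM2l; first exact: ltW.
  have hvk := hv N (p N i + k)%N.
  have [_ ->] := rescaled_Lalpha alpha1 (p N i + k) N0 (Phi_Lalpha alpha1 h1a h12 h21 L2 hvk).1.
  rewrite powRM ?powR_ge0 ?Lalpha_norm_ge0// mulrC ler_wpM2l ?powR_ge0//.
  apply: ge0_ler_powR => //; rewrite ?nnegrE ?Lalpha_norm_ge0//.
  exact: (Phi_norm_ge alpha1 h1a h12 h21 L2 hvk).
pose mu N i := 2 * N%:R `^ (e0 - 1) * Ew N i.
(* threshold: half of the relative error allowed, the other half is for freezing *)
pose t N i := N%:R `^ (- e0) / 2 * (kap * Ew N i).
pose N2 := (Nb + Nn).+1.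
have N2gt N : (N2 <= N)%N -> [/\ (0 < N)%N, (Nb <= N)%N & (Nn <= N)%N].
  by rewrite /N2; clear; move=> ?; split; lia.
have Ew0 N i : (N2 <= N)%N -> (i < nc N)%N -> 0 < Ew N i.
  move=> /N2gt[N0 NNb _] inc; have [_ /(_ i inc) [_ h]] := fam NNb.
  have n0 : (0 < n N i)%N.
    by rewrite -(ltr_nat R); apply: lt_le_trans h; rewrite ltr_wpDl// powR_ge0.
  rewrite /Ew (bigD1 (Ordinal n0))//= ltr_pwDl//.
    by rewrite /wk !powR_gt0// ltr0n.
  by apply: sumr_ge0 => k _; exact: powR_ge0.
pose A N i : set T := [set w | t N i <= `|\sum_(k < n N i) (`|I (Gk N (p N i + k) (v N (p N i + k)%N)) w| `^ beta
      - cst beta * nrm (Gk N (p N i + k) (v N (p N i + k)%N)) `^ beta)|].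
have HA N i : (N2 <= N)%N -> (i < nc N)%N ->
    measurable (A N i) /\ (P (A N i) <= (C * (4 / kap) ^+ 4 * N%:R `^ (8 * e0 - 3 / 2))%:E)%E.
  move=> NN2 inc; have [N0 NNb NNn] := N2gt _ NN2.
  have Nr : 0 < N%:R :> R by rewrite ltr0n.
  have [_ /(_ i inc) [f1 f2]] := fam NNb.
  have E0 := Ew0 _ _ NN2 inc.
  have mu0 : 0 < mu N i by rewrite mulr_gt0// mulr_gt0// powR_gt0.
  have t0 : 0 < t N i by rewrite mulr_gt0 ?divr_gt0 ?powR_gt0// mulr_gt0.
  have nN : (n N i <= N)%N by move: f1 L2; clear; lia.
  have hmu k : (k < n N i)%N -> (N%:R `^ (- v N (p N i + k)%N)) `^ beta <= mu N i.
    move=> kn; apply: hdom => //; move: f1 kn L2; clear; lia.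
  have [mA PA] := hC N (p N i) (n N i) (v N) (mu N i) (t N i) N0 nN (hv N) mu0 hmu t0.
  split => //; apply: (le_trans PA); rewrite lee_fin le_eqVlt; apply/orP; left; apply/eqP.
  have -> : N%:R `^ (8 * e0 - 3 / 2) = (N%:R `^ (e0 - 1) / N%:R `^ (- e0)) ^+ 4 * N%:R `^ (5 / 2).
    rewrite -powRN -gt0_powRD// -powR_mulrn ?powR_ge0// -powRrM -gt0_powRD//; congr (_ `^ _); by field.
  rewrite /mu /t.
  have q1 : N%:R `^ (- e0) != 0 by rewrite gt_eqF// powR_gt0.
  have q2 : kap != 0 by rewrite gt_eqF.
  have q3 : Ew N i != 0 by rewrite gt_eqF.
  exact: markov_ratio_algebra.
pose A' N i : set T := if (N2 <= N)%N && (i < nc N)%N then A N i else set0.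
have mA' N i : measurable (A' N i).
  by rewrite /A'; case: ifP => // /andP[h1' h2']; exact: (HA _ _ h1' h2').1.
pose bad N : set T := \big[setU/set0]_(i < nc N) A' N i.
have mbad N : measurable (bad N) by exact: bigsetU_measurable.
pose K := C * (4 / kap) ^+ 4.
have K0 : 0 <= K by apply: (mulr_ge0 C0); apply: exprn_ge0; exact: divr_ge0 (ltW kap0).
have Pbad N : (N2 <= N)%N -> (P (bad N) <= (K * N%:R `^ (- (5 / 4)))%:E)%E.
  move=> NN2; have [N0 NNb NNn] := N2gt _ NN2.
  have Nr : 0 < N%:R :> R by rewrite ltr0n.
  have N1 : 1 <= N%:R :> R by rewrite ler1n.
  apply: (le_trans (Boole_inequality P (fun i _ => mA' N i))).
  apply: (@le_trans _ _ (\sum_(i < nc N) (K * N%:R `^ (8 * e0 - 3 / 2))%:E)%E).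
    apply: lee_sum => i _; rewrite /A' NN2 ltn_ord/=.
    exact: (HA _ _ NN2 (ltn_ord i)).2.
  rewrite sumEFin sumr_const card_ord lee_fin -[leLHS]mulr_natl.
  have [h _] := fam NNb.
  apply: (@le_trans _ _ (N%:R `^ e0 * (K * N%:R `^ (8 * e0 - 3 / 2)))).
    by apply: ler_wpM2r => //; apply: (mulr_ge0 K0); exact: powR_ge0.
  rewrite mulrCA; apply: (ler_wpM2l K0); rewrite -gt0_powRD// ler_powR//; lra.
have BC : {ae P, forall w, exists N1, forall N, (N1 <= N)%N -> ~ bad N w}.
  apply: (@borel_cantelli_powR _ _ _ P bad K (5 / 4) N2) => //; lra.
apply: filterS2 hpert BC => w [A0 [Np hp]] [N3 hN3].
have [||N4 hN4] := @powR_small R (eps * beta - e0) (kap / 2 / (`|A0| `^ beta + 1)).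
- by rewrite subr_gt0 mulrC.
- by rewrite divr_gt0 ?divr_gt0// ltr_wpDl// powR_ge0.
exists (N2 + N3 + N4 + Np)%N => N i NN inc.
have [NN2 NN3 NN4 NNp] : [/\ (N2 <= N)%N, (N3 <= N)%N, (N4 <= N)%N & (Np <= N)%N].
  by move: NN; clear => ?; split; lia.
have [N0 NNb NNn] := N2gt _ NN2.
have Nr : 0 < N%:R :> R by rewrite ltr0n.
have N1 : 1 <= N%:R :> R by rewrite ler1n.
have [_ /(_ i inc) [f1 f2]] := fam NNb.
have E0 := Ew0 _ _ NN2 inc.
set S := \sum_(k < n N i) _.
set M := mean_sum _ _ _ _.
pose G := \sum_(k < n N i) `|I (Gk N (p N i + k) (v N (p N i + k)%N)) w| `^ beta.
have GM : `|G - M| <= t N i.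
  rewrite leNgt; apply/negP => /ltW h; apply: (hN3 N NN3).
  rewrite /bad (bigD1 (Ordinal inc))//=; left; rewrite /A' NN2 inc/= /A/=.
  by move: h; rewrite /G /M /mean_sum -sumrB.
have SG : `|S - G| <= t N i.
  rewrite /S /G -sumrB; apply: (le_trans (ler_norm_sum _ _ _)).
  apply: (@le_trans _ _ (\sum_(k < n N i) (`|A0| `^ beta * N%:R `^ (- (eps * beta))) * wk N (p N i + k)%N)).
    apply: ler_sum => k _.
    apply: (le_trans (powR_dist _ _ b01)).
    have kL : (p N i + k + L <= N)%N by have := ltn_ord k; move: f1; clear; lia.
    have hk := hp N (p N i + k)%N NNp kL.
    have /andP[_ vh] := hv N (p N i + k)%N.
    exact: perturbation_power N1 beta0 vh hk.
  rewrite -mulr_sumr -/(Ew N i) /t mulrA; apply: ler_wpM2r; first exact: ltW.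
  have h4 := hN4 N NN4.
  have -> : N%:R `^ (- (eps * beta)) = N%:R `^ (- (eps * beta - e0)) * N%:R `^ (- e0).
    by rewrite -gt0_powRD//; congr (_ `^ _); ring.
  rewrite mulrA -[leRHS]mulrA [leRHS]mulrC; apply: ler_wpM2r; first exact: powR_ge0.
  have a0 : 0 <= `|A0| `^ beta by exact: powR_ge0.
  apply: (@le_trans _ _ (`|A0| `^ beta * (kap / 2 / (`|A0| `^ beta + 1)))); first exact: ler_wpM2l.
  exact: half_fraction a0 (ltW kap0).
have -> : S - M = (S - G) + (G - M) by ring.
apply: (le_trans (ler_normD _ _)); apply: (le_trans (lerD SG GM)).
have -> : t N i + t N i = N%:R `^ (- e0) * (kap * Ew N i) by rewrite /t; field.
by apply: ler_wpM2l; [exact: powR_ge0|exact: EwE].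
Qed.

End concentration.

(** * From power sums to the Hurst exponent *)

Section ratio.
Context {R : realType}.
Implicit Types x y r : R.

Lemma ln_close x y r : 0 < y -> 0 <= r <= 2^-1 -> `|x - y| <= r * y ->
  0 < x /\ `|ln x - ln y| <= 2 * r.
Proof.
move=> y0 /andP[r0 r2] /ler_normlP[h1 h2].
have hx : (1 - r) * y <= x by lra.
have hx' : x <= (1 + r) * y by lra.
have r1 : 0 < 1 - r by lra.
have x0 : 0 < x by apply: lt_le_trans hx; exact: mulr_gt0.
split => //; rewrite -ln_div ?posrE//.
have q0 : 0 < x / y by exact: divr_gt0.
have up : x / y <= expR r.
  by apply: (@le_trans _ _ (1 + r)); [rewrite ler_pdivrMr|exact: expR_ge1Dx].
have lo : expR (- (2 * r)) <= x / y.
  apply: (@le_trans _ _ (1 - r)); last by rewrite ler_pdivlMr.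
  rewrite expRN -[leRHS]invrK lef_pV2 ?posrE ?expR_gt0 ?invr_gt0//.
  apply: (@le_trans _ _ (1 + 2 * r)); last exact: expR_ge1Dx.
  rewrite -[leLHS]mul1r ler_pdivrMr// -subr_ge0.
  have -> : (1 + 2 * r) * (1 - r) - 1 = r * (1 - 2 * r) by ring.
  by apply: mulr_ge0 => //; lra.
apply/ler_normlP; split.
- by rewrite lerNl -[leLHS]expRK ler_ln ?posrE ?expR_gt0.
- apply: (@le_trans _ _ r); last lra.
  by rewrite -[leRHS]expRK ler_ln ?posrE ?expR_gt0.
Qed.

(** Truncating ln u to the interval [beta/2 ln 2, beta ln 2], which contains
    beta h ln 2, does not increase the distance to that point. *)
Lemma log2_truncate (beta h u D : R) : 0 < beta -> 2^-1 <= h <= 1 -> 0 < u ->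
  `|ln u - beta * h * ln 2| <= D ->
  `|beta^-1 * log2 (truncate beta u) - h| <= D / (beta * ln 2).
Proof.
move=> b0 /andP[h1 h2] u0 hD.
have l2 : 0 < ln 2 :> R by rewrite ln_gt0// ltr1n.
have bl : 0 < beta * ln 2 by exact: mulr_gt0.
have p0 s : 0 < 2 `^ s :> R by exact: powR_gt0.
have t0 : 0 < truncate beta u by rewrite /truncate lt_min p0 lt_max u0.
have e1 : ln (truncate beta u) <= beta * ln 2.
  by rewrite -ln_powR ler_ln ?posrE// /truncate ge_min lexx.
have hb : 2 `^ (beta / 2) <= 2 `^ beta :> R.
  by apply: ler_powR; rewrite ?ler1n// ler_pdivrMr// ler_peMr ?ler1n// ltW.
have e2 : beta / 2 * ln 2 <= ln (truncate beta u).
  by rewrite -ln_powR ler_ln ?posrE// /truncate le_min hb le_max lexx orbT.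
have e3 : ln (truncate beta u) <= ln u \/ ln (truncate beta u) <= beta / 2 * ln 2.
  case: (leP u (2 `^ (beta / 2))) => hu.
    right; rewrite -ln_powR ler_ln ?posrE// /truncate ge_min; apply/orP; right.
    by rewrite ge_max hu lexx.
  left; rewrite ler_ln ?posrE// /truncate ge_min; apply/orP; right.
  by rewrite ge_max lexx (ltW hu).
have e4 : ln u <= ln (truncate beta u) \/ beta * ln 2 <= ln (truncate beta u).
  case: (leP u (2 `^ beta)) => hu.
    by left; rewrite ler_ln ?posrE// /truncate le_min hu le_max lexx.
  right; rewrite -ln_powR ler_ln ?posrE// /truncate le_min lexx/= le_max.
  by rewrite (ltW hu).
have -> : beta^-1 * log2 (truncate beta u) - h = (ln (truncate beta u) - beta * h * ln 2) / (beta * ln 2).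
  by rewrite /log2; field; rewrite !gt_eqF.
rewrite normrM [`|_^-1|]gtr0_norm ?invr_gt0// ler_pM2r ?invr_gt0//.
set l := ln (truncate _ _) in e1 e2 e3 e4 *.
have f1 : beta / 2 * ln 2 <= beta * h * ln 2.
  by apply: ler_wpM2r; [exact: ltW|apply: ler_wpM2l => //; exact: ltW].
have f2 : beta * h * ln 2 <= beta * ln 2.
  by apply: ler_wpM2r; [exact: ltW|rewrite ler_piMr// ltW].
have D0 : 0 <= D by apply: le_trans hD.
move: hD => /ler_normlP[g1 g2]; apply/ler_normlP; clear -e3 e4 e1 e2 f1 f2 g1 g2 D0; split.
- case: e4 => e4; lra.
- case: e3 => e3; lra.
Qed.

(** All relative errors are additive in the logarithm.  The bounds beta <= 1/4 and
    h, om <= 1 ensure 2^(-beta (h + om)) >= 1/2, so that E1 <= B and an error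
    relative to E1 is also one relative to B. *)
Lemma ratio_bound (beta h om K r S1 E1 S2 E2 B n n2 : R) :
  0 < beta <= 4^-1 -> 2^-1 <= h <= 1 -> 0 <= om <= 1 -> 1 <= K -> 0 <= r -> K * r <= 2^-1 ->
  0 < E1 -> 0 < n -> `|S1 - E1| <= r * E1 -> `|S2 - E2| <= r * E2 ->
  2 `^ (- (beta * (h + om))) * (2 * E1) <= B -> B <= 2 `^ (- (beta * (h - om))) * (2 * E1) ->
  `|E2 - B| <= K * r * E1 -> `|n2 - 2 * n| <= K * r * n ->
  `|beta^-1 * log2 (truncate beta ((n^-1 * S1) / (n2^-1 * S2))) - h|
    <= om + 8 * K / (beta * ln 2) * r.
Proof.
move=> /andP[b0 b4] hh /andP[om0 om1] K1 r0 Kr E10 n0 h1 h2 hB1 hB2 h3 h4.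
have l2 : 0 < ln 2 :> R by rewrite ln_gt0// ltr1n.
have rK : r <= K * r by rewrite ler_peMl.
have K0 : 0 <= K * r by exact: le_trans rK.
have r2 : 0 <= r <= 2^-1 by rewrite r0 (le_trans rK).
have Kr2 : 0 <= K * r <= 2^-1 by rewrite K0.
have [S10 g1] := ln_close E10 r2 h1.
have [hh1 hh2] := andP hh.
have BE : E1 <= B.
  apply: le_trans hB1; rewrite mulrA -[leLHS]mul1r ler_pM2r//.
  have -> : 2 `^ (- (beta * (h + om))) * 2 = 2 `^ (1 - beta * (h + om)) :> R.
    by rewrite [1 - _]addrC gt0_powRD ?powRr1.
  have e : 0 <= 1 - beta * (h + om).
    have : beta * (h + om) <= 4^-1 * 2.
      apply: ler_pM => //; [exact: ltW|lra|lra].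
    lra.
  by have := @ler_powR R 2 (ler1n _ 2) _ _ e; rewrite powRr0.
have B0 : 0 < B by exact: lt_le_trans BE.
have [E20 g3] : 0 < E2 /\ `|ln E2 - ln B| <= 2 * (K * r).
  by apply: ln_close => //; apply: (le_trans h3); apply: ler_wpM2l.
have [S20 g2] := ln_close E20 r2 h2.
have n20 : 0 < 2 * n by exact: mulr_gt0.
have [n2p g4] : 0 < n2 /\ `|ln n2 - ln (2 * n)| <= 2 * (K * r).
  apply: ln_close => //; apply: (le_trans h4); apply: ler_wpM2l => //; lra.
have gB : `|ln B - ln (2 * E1) + beta * h * ln 2| <= beta * om * ln 2.
  have E20' : 0 < 2 * E1 by exact: mulr_gt0.
  have p0 s : 0 < 2 `^ s :> R by exact: powR_gt0.
  have i1 : ln (2 `^ (- (beta * (h + om))) * (2 * E1)) <= ln B by rewrite ler_ln ?posrE ?mulr_gt0.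
  have i2 : ln B <= ln (2 `^ (- (beta * (h - om))) * (2 * E1)) by rewrite ler_ln ?posrE ?mulr_gt0.
  move: i1 i2; rewrite !lnM ?posrE// !ln_powR => i1 i2.
  apply/ler_normlP; split; lra.
have -> : om + 8 * K / (beta * ln 2) * r = (beta * om * ln 2 + 8 * K * r) / (beta * ln 2).
  by field; rewrite !gt_eqF.
apply: log2_truncate => //; first by rewrite divr_gt0// mulr_gt0 ?invr_gt0.
rewrite ln_div ?posrE ?mulr_gt0 ?invr_gt0// !lnM ?posrE ?invr_gt0// !lnV ?posrE//.
move: gB g4; rewrite !lnM ?posrE//.
move: g1 g2 g3 => /ler_normlP[? ?] /ler_normlP[? ?] /ler_normlP[? ?] /ler_normlP[? ?] /ler_normlP[? ?].
by apply/ler_normlP; split; lra.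
Qed.

End ratio.

Section integer_interval.
Context {R : realType}.

Definition nceil (z : R) : nat := `|Num.ceil z|%N.

Lemma nceil_le (z : R) (k : nat) : 0 <= z -> (nceil z <= k)%N = (z <= k%:R).
Proof.
move=> z0; rewrite -(ler_nat R) /nceil.
have c0 : 0 <= Num.ceil z by rewrite ceil_ge0 (lt_le_trans _ z0)// ltrN10.
rewrite natr_absz ger0_norm//.
apply/idP/idP => h.
  by apply: le_trans h; exact: ceil_ge.
rewrite (_ : k%:R = k%:Z%:~R)// ler_int ceil_le_int//.
Qed.

Lemma truncn_lt (z : R) (k : nat) : 0 <= z -> (k < (Num.truncn z).+1)%N = (k%:R <= z).
Proof. by move=> z0; rewrite ltnS truncn_ge_nat. Qed.

Variable (L : nat).

Definition first_index (N : nat) (x : R) : nat := nceil (x * N%:R).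
(** One past the last index, so that a cell is a half-open range of indices; the
    minimum is there because the last increment of order [L] starts at N - L. *)
Definition end_index (N : nat) (y : R) : nat := minn (Num.truncn (y * N%:R)).+1 (N - L).+1.

Lemma sum_nu (N : nat) (x y : R) (F : nat -> R) : (0 < N)%N -> 0 <= x -> 0 <= y ->
  \sum_(k in nu L N `[x, y]) F k = \sum_(first_index N x <= k < end_index N y) F k.
Proof.
move=> N0 x0 y0; have Nr : 0 < N%:R :> R by rewrite ltr0n.
rewrite (eq_bigl (fun k : 'I_(N - L).+1 => (first_index N x <= k < (Num.truncn (y * N%:R)).+1)%N)).
  rewrite -(big_mkord (fun k => (first_index N x <= k < (Num.truncn (y * N%:R)).+1)%N) F).
  rewrite [in RHS]big_nat_cond [in LHS]big_nat_cond.
  rewrite [in LHS](big_nat_widen _ _ (maxn (N - L).+1 (end_index N y))) ?leq_maxl//.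
  rewrite [in RHS](big_nat_widenl _ 0)// [in RHS](big_nat_widen _ _ (maxn (N - L).+1 (end_index N y))) ?leq_maxr//.
  apply: eq_bigl => k; rewrite /end_index; lia.
move=> k; rewrite inE in_itv/= ler_pdivlMr// ler_pdivrMr// truncn_lt ?nceil_le ?mulr_ge0//.
Qed.

Lemma card_nu (N : nat) (x y : R) : (0 < N)%N -> 0 <= x -> 0 <= y ->
  #|nu L N `[x, y]| = (end_index N y - first_index N x)%N.
Proof.
move=> N0 x0 y0; apply/eqP; rewrite -(eqr_nat R); apply/eqP.
transitivity (\sum_(k in nu L N `[x, y]) (1 : R)); first by rewrite sumr_const.
by rewrite (sum_nu (fun=> 1))// sumr_const_nat.
Qed.

(** The boundary indices at level 2N are twice those at level N, up to a bounded
    correction; this and [end_index_double] control the terms at the two ends of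
    a cell that have no counterpart at level N. *)
Lemma first_index_double (N : nat) (x : R) : 0 <= x ->
  (first_index (2 * N) x <= 2 * first_index N x <= (first_index (2 * N) x).+1)%N.
Proof.
move=> x0; have x1 := mulr_ge0 x0 (ler0n R N); have x2 := mulr_ge0 x0 (ler0n R (2 * N)).
rewrite /first_index; apply/andP; split.
  have := leqnn (nceil (x * N%:R)); rewrite nceil_le// nceil_le// !natrM => h.
  lra.
have := leqnn (nceil (x * (2 * N)%:R)); rewrite nceil_le// natrM => h.
set m := nceil (x * (2 * N%:R)) in h *.
have : (nceil (x * N%:R) <= uphalf m)%N.
  rewrite nceil_le//; have : (m <= 2 * uphalf m)%N by lia.
  rewrite -(ler_nat R) natrM => h'; lra.
lia.
Qed.

Lemma end_index_double (N : nat) (y : R) : 0 <= y -> (0 < L <= N)%N ->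
  (2 * end_index N y <= (end_index (2 * N) y).+1)%N /\
  (end_index (2 * N) y <= 2 * end_index N y + L)%N.
Proof.
move=> y0 /andP[L0 LN]; have y1 := mulr_ge0 y0 (ler0n R N); have y2 := mulr_ge0 y0 (ler0n R (2 * N)).
set f := Num.truncn (y * N%:R); set f2 := Num.truncn (y * (2 * N)%:R).
have h1 : (f + f <= f2)%N.
  have := leqnn f; rewrite -ltnS truncn_lt// => h.
  rewrite -ltnS truncn_lt// natrD natrM; lra.
have h2 : (f2 <= f + f + 1)%N.
  have := leqnn f2; rewrite -ltnS truncn_lt// natrM => h.
  have : (f2./2 <= f)%N.
    rewrite -ltnS truncn_lt//; have : (f2./2 + f2./2 <= f2)%N by lia.
    rewrite -(ler_nat R) natrD => h'; lra.
  lia.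
by rewrite /end_index -/f -/f2; clear -h1 h2 L0 LN; lia.
Qed.

End integer_interval.

(** * Comparison of the two sampling levels on a cell *)

Section index_count.
Context {R : realType}.

Lemma index_count (L N : nat) (x y : R) : 0 <= x -> 0 <= y <= 1 -> (L <= N)%N ->
  (y - x) * N%:R - L.+1%:R <= (end_index L N y - first_index N x)%N%:R.
Proof.
move=> x0 /andP[y0 y1] LN.
have x1 := mulr_ge0 x0 (ler0n R N); have y2 := mulr_ge0 y0 (ler0n R N).
have hp : (first_index N x)%:R <= x * N%:R + 1.
  have : (first_index N x <= (Num.truncn (x * N%:R)).+1)%N.
    by rewrite nceil_le// ltW// truncnS_gt.
  rewrite -(ler_nat R) => h; apply: (le_trans h); rewrite -natr1 lerD2r.
  by rewrite -truncn_lt.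
have he : y * N%:R - L%:R <= (end_index L N y)%:R.
  rewrite /end_index /minn; case: ifP => _.
    apply: (@le_trans _ _ (y * N%:R)); first by rewrite gerBl.
    exact/ltW/truncnS_gt.
  rewrite -natr1 natrB//.
  have : y * N%:R <= 1 * N%:R by apply: ler_wpM2r.
  lra.
rewrite -natr1; case: (leqP (first_index N x) (end_index L N y)) => h.
  rewrite natrB//; lra.
rewrite (_ : (_ - _)%N = 0%N); last by apply/eqP; rewrite subn_eq0 ltnW.
have : ((end_index L N y)%:R : R) <= (first_index N x)%:R by rewrite ler_nat ltnW.
lra.
Qed.

Lemma sum_pairs (F : nat -> R) (p n : nat) :
  \sum_(2 * p <= j < 2 * (p + n)) F j = \sum_(k < n) (F (2 * (p + k))%N + F (2 * (p + k)).+1).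
Proof.
elim: n => [|n IH]; first by rewrite addn0 big_geq// big_ord0.
rewrite big_ord_recr/= -IH (_ : (2 * (p + n.+1))%N = (2 * (p + n)).+2); last by lia.
rewrite !big_nat_recr/= ?addrA//; lia.
Qed.

(** Only boundary terms differ between the two ranges: at most one at the left
    end and at most [L] at the right end. *)
Lemma sum_edges (F : nat -> R) (L p n p2 e2 : nat) (M : R) : (0 < n)%N ->
  (p2 <= 2 * p <= p2.+1)%N -> (2 * (p + n) <= e2.+1)%N -> (e2 <= 2 * (p + n) + L)%N ->
  (forall j, (p2 <= j < maxn e2 (2 * (p + n)))%N -> 0 <= F j <= M) ->
  `|\sum_(p2 <= j < e2) F j - \sum_(k < n) (F (2 * (p + k))%N + F (2 * (p + k)).+1)| <= L.+2%:R * M.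
Proof.
move=> n0 /andP[h1 h2] h3 h4 hF.
have M0 : 0 <= M.
  have /andP[a b] : 0 <= F (2 * p)%N <= M by apply: hF; lia.
  exact: le_trans b.
have part s e : (p2 <= s)%N -> (e <= maxn e2 (2 * (p + n)))%N -> `|\sum_(s <= j < e) F j| <= (e - s)%:R * M.
  move=> ps ee; apply: (le_trans (ler_norm_sum _ _ _)).
  rewrite mulr_natl -sumr_const_nat [leLHS]big_nat [leRHS]big_nat; apply: ler_sum => j /andP[sj je].
  have /andP[a b] : 0 <= F j <= M by apply: hF; lia.
  by rewrite ger0_norm.
rewrite -sum_pairs.
have pe : (2 * p <= e2)%N by lia.
rewrite (big_cat_nat h1 pe)/=.
have q1 : `|\sum_(p2 <= j < 2 * p) F j| <= M.
  apply: (le_trans (part _ _ _ _)); [lia|lia|].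
  by rewrite ler_piMl// (_ : 1 = 1%:R)// ler_nat; lia.
case: (leqP (2 * (p + n)) e2) => he.
  have pn : (2 * p <= 2 * (p + n))%N by lia.
  rewrite (big_cat_nat pn he)/=.
  have q2 : `|\sum_(2 * (p + n) <= j < e2) F j| <= L%:R * M.
    apply: (le_trans (part _ _ _ _)); [lia|lia|].
    by apply: ler_wpM2r => //; rewrite ler_nat; lia.
  rewrite (_ : _ - _ = \sum_(p2 <= j < 2 * p) F j + \sum_(2 * (p + n) <= j < e2) F j); last by ring.
  apply: (le_trans (ler_normD _ _)); apply: (le_trans (lerD q1 q2)).
  rewrite -!natr1 !mulrDl; lra.
rewrite (big_cat_nat pe (ltnW he))/=.
have q2 : `|\sum_(e2 <= j < 2 * (p + n)) F j| <= M.
  apply: (le_trans (part _ _ _ _)); [lia|lia|].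
  by rewrite ler_piMl// (_ : 1 = 1%:R)// ler_nat; lia.
rewrite (_ : _ - _ = \sum_(p2 <= j < 2 * p) F j - \sum_(e2 <= j < 2 * (p + n)) F j); last by ring.
apply: (le_trans (ler_normB _ _)); apply: (le_trans (lerD q1 q2)).
have := mulr_ge0 (ler0n R L) M0; rewrite -!natr1 !mulrDl; lra.
Qed.

End index_count.

Section mean_terms.
Context {R : realType}.
Variables (alpha h1 h2 beta : R) (L : nat).
Hypotheses (alpha1 : 1 < alpha) (alpha2 : alpha <= 2).
Hypotheses (h1a : alpha^-1 < h1) (h12 : h1 <= h2) (h21 : h2 < 1).
Hypotheses (beta0 : 0 < beta) (beta4 : beta <= 4^-1) (L2 : (2 <= L)%N).
Local Notation cst g := (@stable_moment_const R alpha g).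
Local Notation nrm := (Lalpha_norm alpha).
Local Notation Gk N k v := (rescaled alpha (@Phi R alpha L) N k v).

Lemma mean_cst_gt0 : 0 < cst beta.
Proof. by have b4 := beta4; have a1 := alpha1; apply: stable_moment_const_gt0 => //; rewrite beta0/=; lra. Qed.

Lemma mean_term_bounds : exists2 kap : R * R, 0 < kap.1 /\ 0 < kap.2 &
  forall N k v, (0 < N)%N -> h1 <= v <= h2 ->
  kap.1 * (N%:R `^ (- v)) `^ beta <= cst beta * nrm (Gk N k v) `^ beta <= kap.2 * (N%:R `^ (- v)) `^ beta.
Proof.
have c0 := mean_cst_gt0.
have hh : h1 <= h1 <= h2 by rewrite lexx.
set KD := @Phi_bound R L * nrm (envelope (tail_exponent alpha h2) L%:R).
have KD0 : 0 < KD.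
  have [_ h] := Phi_Lalpha alpha1 h1a h12 h21 L2 hh.
  by apply: lt_le_trans h; apply: lt_le_trans (Phi_norm_ge alpha1 h1a h12 h21 L2 hh).
exists (cst beta * 8^-1 `^ beta, cst beta * KD `^ beta).
  by split; apply: mulr_gt0 => //; apply: powR_gt0.
move=> N k v N0 hv /=.
have [LP uP] := Phi_Lalpha alpha1 h1a h12 h21 L2 hv.
have lP := Phi_norm_ge alpha1 h1a h12 h21 L2 hv.
have [_ ->] := rescaled_Lalpha alpha1 k N0 LP.
rewrite (powRM _ (powR_ge0 _ _) (Lalpha_norm_ge0 _ _)).
rewrite -!(mulrA (cst beta)) ![_ `^ beta * (_ `^ (- v)) `^ beta]mulrC.
have m s s' : 0 <= s -> s <= s' -> cst beta * ((N%:R `^ (- v)) `^ beta * s `^ beta)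
   <= cst beta * ((N%:R `^ (- v)) `^ beta * s' `^ beta).
  move=> s0 ss; apply: (ler_wpM2l (ltW c0)); apply: ler_wpM2l; first exact: powR_ge0.
  by apply: ge0_ler_powR; rewrite ?nnegrE ?(ltW beta0)// (le_trans s0).
by apply/andP; split; apply: m => //; apply: Lalpha_norm_ge0.
Qed.

(** The norm of the unscaled kernel does not depend on the level or on the index. *)
Lemma double_term N k k' v : (0 < N)%N -> h1 <= v <= h2 ->
  cst beta * nrm (Gk (2 * N) k v) `^ beta = 2 `^ (- (beta * v)) * (cst beta * nrm (Gk N k' v) `^ beta).
Proof.
move=> N0 hv; have [LP uP] := Phi_Lalpha alpha1 h1a h12 h21 L2 hv.
have N20 : (0 < 2 * N)%N by rewrite muln_gt0.
have [_ ->] := rescaled_Lalpha alpha1 k N20 LP; have [_ ->] := rescaled_Lalpha alpha1 k' N0 LP.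
rewrite natrM (powRM (- v) (ler0n R 2) (ler0n R N)) -mulrA.
rewrite (powRM beta (powR_ge0 2 (- v)) (mulr_ge0 (powR_ge0 N%:R (- v)) (Lalpha_norm_ge0 _ _))).
by rewrite -powRrM mulNr [v * _]mulrC mulrCA.
Qed.

End mean_terms.

Lemma dist_between (R : realType) (x y s t : R) : x <= s <= y -> x <= t <= y -> `|s - t| <= y - x.
Proof. by move=> /andP[? ?] /andP[? ?]; apply/ler_normlP; split; lra. Qed.

Section estimator_rate.
Context d (T : measurableType d) (R : realType) (P : probability T R).
Variables (alpha : R) (Z : set R -> T -> R) (I : (R -> R) -> T -> R) (X : R -> R -> T -> R) (H : R -> R).
Hypotheses (alpha1 : 1 < alpha) (alpha2 : alpha <= 2).
Hypothesis hI : sas_integral P alpha Z I.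
Hypothesis hX : lmsm_field P alpha I X.
Variables (h1 h2 beta : R) (L : nat).
Hypotheses (h1a : alpha^-1 < h1) (h12 : h1 <= h2) (h21 : h2 < 1).
Hypotheses (beta0 : 0 < beta) (beta4 : beta <= 4^-1).
Hypotheses (L2 : (2 <= L)%N) (Lbeta : 2 / beta + 1 < L%:R).
Hypothesis hH : forall t, 0 <= t <= 1 -> h1 <= H t <= h2.
Variables (c rho : R).
Hypotheses (c0 : 0 <= c) (h2rho : h2 < rho) (rho1 : rho <= 1).
Hypothesis hHol : forall t1 t2, 0 <= t1 <= 1 -> 0 <= t2 <= 1 -> `|H t1 - H t2| <= c * `|t1 - t2| `^ rho.
Local Notation cst g := (@stable_moment_const R alpha g).
Local Notation nrm := (Lalpha_norm alpha).
Local Notation Gk N k v := (rescaled alpha (@Phi R alpha L) N k v).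

(** The minimum keeps the argument of [H] inside [0, 1] for every index, so that
    bounds on the frozen values need no side condition. *)
Definition frozen (N k : nat) : R := H ((minn k N)%:R / N%:R).
(** At level 2N the increments 2k and 2k+1 are both frozen at the value used for
    the increment k at level N, see [frozen_double]. *)
Definition frozen_even (N k : nat) : R := frozen N (2 * k./2).

Lemma ratio01 (a b : nat) : (a <= b)%N -> 0 <= (a%:R / b%:R : R) <= 1.
Proof.
case: b => [|b] ab; first by rewrite invr0 mulr0 lexx ler01.
by rewrite divr_ge0//= ler_pdivrMr ?ltr0n// mul1r ler_nat.
Qed.

Lemma frozen_range N k : h1 <= frozen N k <= h2.
Proof. by apply: hH; apply: ratio01; rewrite geq_minr. Qed.

Lemma close_points N a b m : (0 < N)%N -> (a <= N)%N -> (b <= N)%N -> (a <= b + m)%N -> (b <= a)%N ->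
  `|H (a%:R / N%:R) - H (b%:R / N%:R)| <= c * m%:R `^ rho * N%:R `^ (- rho).
Proof.
move=> N0 aN bN ab ba; have Nr : 0 < N%:R :> R by rewrite ltr0n.
have rho0 : 0 <= rho by apply: ltW; apply: lt_trans h2rho; apply: lt_le_trans h12; apply: lt_trans h1a;
  rewrite invr_gt0; exact: lt_trans alpha1.
apply: (le_trans (hHol (ratio01 aN) (ratio01 bN))); rewrite -mulrA; apply: (ler_wpM2l c0).
have -> : N%:R `^ (- rho) = N%:R^-1 `^ rho :> R.
  by rewrite -powR_inv1 ?ler0n// -powRrM mulN1r.
rewrite -(powRM rho (ler0n R m)) ?invr_ge0//.
apply: ge0_ler_powR; rewrite ?nnegrE//.
rewrite -mulrBl normrM [`|_^-1|]ger0_norm ?invr_ge0//; apply: ler_wpM2r; first by rewrite invr_ge0.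
rewrite -natrB// ger0_norm// ler_nat; by move: ab; clear; lia.
Qed.

Variables (e0 : R) (nc : nat -> nat) (x y : nat -> nat -> R) (Nb : nat).
Hypotheses (e00 : 0 < e0) (e064 : e0 <= 64^-1) (e0b : e0 < beta * ((rho - h2) / 2)).
Hypothesis fam : forall N, (Nb <= N)%N -> (nc N)%:R <= (N%:R : R) `^ e0 /\
  forall i, (i < nc N)%N -> [/\ 0 <= x N i, y N i <= 1, 2 * (N%:R : R) `^ (- e0) <= y N i - x N i &
    c * (y N i - x N i) `^ rho <= 1].

Let p1 N i := first_index N (x N i).
Let n1 N i := (end_index L N (y N i) - p1 N i)%N.
(** An odd level is never the double of another one, so it carries no cell. *)
Let nc2 M := if odd M then 0%N else nc M./2.
Let p2 M i := first_index M (x M./2 i).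
Let n2 M i := (end_index L M (y M./2 i) - p2 M i)%N.

(** A cell contains many more sampling points than the boundary corrections
    remove, at both levels. *)
Lemma cell_indices : exists N1 : nat, forall N i, (N1 <= N)%N -> (i < nc N)%N ->
  [/\ (Nb <= N)%N, (L <= N)%N, N%:R `^ (1 - e0) + 1 <= (n1 N i)%:R :> R,
   [/\ (p1 N i + n1 N i = end_index L N (y N i))%N, (p1 N i + n1 N i + L <= N.+1)%N & (0 < n1 N i)%N] &
   [/\ (2 * n1 N i <= (n2 (2 * N) i).+1)%N, (n2 (2 * N) i <= 2 * n1 N i + L.+1)%N,
      (p2 (2 * N) i + n2 (2 * N) i = end_index L (2 * N) (y N i))%N,
      (p2 (2 * N) i + n2 (2 * N) i + L <= (2 * N).+1)%N &
      (2 * N)%:R `^ (1 - e0) + 1 <= (n2 (2 * N) i)%:R :> R]].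
Proof.
have e064' := e064; have e00' := e00; have L2' := L2.
have e1 : 0 < 1 - e0 by lra.
have [|Ns hNs] := @powR_small R (1 - e0) L.+3%:R^-1 e1; first by rewrite invr_gt0.
exists (Nb + L + Ns).+1 => N i hN inc.
have [NNb LN NNs N0] : [/\ (Nb <= N)%N, (L <= N)%N, (Ns <= N)%N & (0 < N)%N].
  by move: hN; clear => ?; split; lia.
have Nr : 0 < N%:R :> R by rewrite ltr0n.
have big : L.+3%:R <= N%:R `^ (1 - e0) :> R.
  have := hNs N NNs; rewrite powRN lef_pV2 ?posrE ?powR_gt0//.
have [_ /(_ i inc) [x0 y1 xy _]] := fam NNb.
have y0 : 0 <= y N i.
  by have := powR_ge0 (N%:R : R) (- e0); lra.
have h := @index_count R L N (x N i) (y N i) x0 _ LN.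
rewrite -/(p1 N i) -/(n1 N i) y0 y1 in h.
have hn : N%:R `^ (1 - e0) + 1 <= (n1 N i)%:R :> R.
  have hE : 2 * N%:R `^ (1 - e0) <= (y N i - x N i) * N%:R.
    apply: (@le_trans _ _ (2 * N%:R `^ (- e0) * N%:R)); last by rewrite ler_pM2r.
    by rewrite -mulrA [1 - e0]addrC gt0_powRD// powRr1.
  have := h isT; rewrite -!natr1 in big *; lra.
have n0 : (0 < n1 N i)%N.
  by rewrite -(ltr_nat R); have := powR_ge0 (N%:R : R) (1 - e0); lra.
have s1 : (p1 N i + n1 N i = end_index L N (y N i))%N.
  by move: n0; rewrite /n1; clear; lia.
have e1N : (end_index L N (y N i) <= (N - L).+1)%N by exact: geq_minr.
have hlf : (2 * N)./2 = N by rewrite mul2n doubleK.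
have /andP[d1 d2] := @first_index_double R N (x N i) x0.
have [d3 d4] : (2 * end_index L N (y N i) <= (end_index L (2 * N) (y N i)).+1)%N /\
  (end_index L (2 * N) (y N i) <= 2 * end_index L N (y N i) + L)%N.
  by apply: end_index_double => //; move: LN L2; clear; lia.
have e2N : (end_index L (2 * N) (y N i) <= (2 * N - L).+1)%N by exact: geq_minr.
have q2 : p2 (2 * N) i = first_index (2 * N) (x N i) by rewrite /p2 hlf.
have q3 : n2 (2 * N) i = (end_index L (2 * N) (y N i) - first_index (2 * N) (x N i))%N by rewrite /n2 q2 hlf.
have q4 : (2 * n1 N i <= (n2 (2 * N) i).+1)%N.
  by rewrite q3; move: d1 d3 s1 n0; rewrite -/(p1 N i); clear; lia.
split => //; split => //.
- by rewrite s1; move: e1N LN; clear; lia.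
- by rewrite q3; move: d2 d4 s1 n0; rewrite -/(p1 N i); clear; lia.
- by rewrite q2 q3; move: q4 n0; rewrite q3; clear; lia.
- by rewrite q2 q3; move: q4 n0 e2N LN; rewrite q3; clear; lia.
- have q5 : (2 * n1 N i)%:R <= (n2 (2 * N) i).+1%:R :> R by rewrite ler_nat.
  have q6 : (2 * N)%:R `^ (1 - e0) <= 2 * N%:R `^ (1 - e0) :> R.
    rewrite natrM powRM//; apply: ler_wpM2r; first exact: powR_ge0.
    rewrite -[leRHS]powRr1//; apply: ler_powR; rewrite ?ler1n//; lra.
  rewrite -natr1 natrM in q5; lra.
Qed.

Lemma frozen_close N k l : (0 < N)%N -> (k + l <= N)%N -> (l <= L)%N ->
  `|H ((k + l)%:R / N%:R) - frozen N k| <= c * L.+1%:R `^ rho * N%:R `^ (- rho).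
Proof.
move=> N0 kl lL; apply: (close_points N0 kl (geq_minr k N)); last first.
  by apply: leq_trans (geq_minl k N) (leq_addr _ _).
rewrite (minn_idPl (leq_trans (leq_addr l k) kl)) leq_add2l; exact: leqW.
Qed.

Lemma frozen_even_close N k l : (0 < N)%N -> (k + l <= N)%N -> (l <= L)%N ->
  `|H ((k + l)%:R / N%:R) - frozen_even N k| <= c * L.+1%:R `^ rho * N%:R `^ (- rho).
Proof.
move=> N0 kl lL; have kk : (2 * k./2 <= k)%N by clear; lia.
have kN : (2 * k./2 <= N)%N by move: kl kk; clear; lia.
apply: (close_points N0 kl (geq_minr _ N)); rewrite (minn_idPl kN); last by move: kk; clear; lia.
by move: lL; clear; lia.
Qed.

Lemma frozen_double N j : (j <= 2 * N)%N -> frozen_even (2 * N) j = frozen N j./2.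
Proof.
move=> jN; rewrite /frozen_even /frozen (minn_idPl (_ : (2 * j./2 <= 2 * N)%N)); last by move: jN; clear; lia.
rewrite (minn_idPl (_ : (j./2 <= N)%N)); last by move: jN; clear; lia.
case: N jN => [|N] _; first by rewrite muln0 !invr0 !mulr0.
by rewrite !natrM; congr H; field; rewrite -(natrD _ 1 N) pnatr_eq0.
Qed.

(** Pairing the increments 2k and 2k+1 with k, the mean at level 2N is
    2 sum_k 2^(-beta v_k) a_k up to boundary terms, where the a_k are the terms at
    level N; the boundary terms are negligible by [no_dominant_term]. *)
Lemma mean_sum_double : exists2 K : R, 1 <= K & exists N1 : nat, forall N i, (N1 <= N)%N -> (i < nc N)%N ->
  [/\ 0 < mean_sum alpha beta L (frozen N) N (p1 N i) (n1 N i),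
   `|(n2 (2 * N) i)%:R - 2 * (n1 N i)%:R| <= K * N%:R `^ (- e0) * (n1 N i)%:R :> R &
   forall h om, (forall k, (k < n1 N i)%N -> `|frozen N (p1 N i + k) - h| <= om) ->
   exists B, [/\ 2 `^ (- (beta * (h + om))) * (2 * mean_sum alpha beta L (frozen N) N (p1 N i) (n1 N i)) <= B,
     B <= 2 `^ (- (beta * (h - om))) * (2 * mean_sum alpha beta L (frozen N) N (p1 N i) (n1 N i)) &
     `|mean_sum alpha beta L (frozen_even (2 * N)) (2 * N) (p2 (2 * N) i) (n2 (2 * N) i) - B|
       <= K * N%:R `^ (- e0) * mean_sum alpha beta L (frozen N) N (p1 N i) (n1 N i)]].
Proof.
have beta4' := beta4; have e064' := e064; have e00' := e00.
have [[kap K2] /= [kap0 K20] hterm] := mean_term_bounds alpha1 alpha2 h1a h12 h21 beta0 beta4 L2.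
(* ratio of the largest boundary term to the mean, relative to N^(e0 - 1) *)
pose Kr := 2 * K2 / kap.
have Kr0 : 0 < Kr by rewrite divr_gt0// mulr_gt0.
have cv0 : 0 <= c * L.+1%:R `^ rho by apply: (mulr_ge0 c0); exact: powR_ge0.
have rho0 : 0 < rho.
  apply: lt_trans h2rho; apply: lt_le_trans h12; apply: lt_trans h1a.
  by rewrite invr_gt0; exact: lt_trans alpha1.
have hv0 N k : (0 < N)%N -> (k <= N)%N ->
    `|H (k%:R / N%:R) - frozen N k| <= c * L.+1%:R `^ rho * N%:R `^ (- rho).
  by move=> N0 kN; have := @frozen_close N k 0 N0; rewrite addn0; apply.
have [|Nn hdom] := @no_dominant_term R H c _ rho beta frozen L rho0 beta0 c0 cv0 hHol hv0 e0.
  by rewrite e00/=; lra.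
have [Nc hc] := cell_indices.
exists (L.+2%:R * (Kr + 1)).
  have a : 0 <= L%:R * (Kr + 1) :> R by apply: mulr_ge0 => //; lra.
  by rewrite -!natr1 !mulrDl; lra.
exists (Nn + Nc).+1 => N i hN inc.
have [NNn NNc N0] : [/\ (Nn <= N)%N, (Nc <= N)%N & (0 < N)%N].
  by move: hN; clear => ?; split; lia.
have Nr : 1 <= N%:R :> R by rewrite ler1n.
have Nr0 : 0 < N%:R :> R by rewrite ltr0n.
have [NNb LN hn [pE pn n0] [q1 q2 q3 q4 _]] := hc N i NNc inc.
set E := mean_sum _ _ _ _ _ _ _.
set p := p1 N i in pE pn E *; set n := n1 N i in pE pn q1 q2 hn n0 E *.
pose w k := (N%:R `^ (- frozen N k)) `^ beta.
have Ew : kap * \sum_(k < n) w (p + k)%N <= E.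
  rewrite mulr_sumr; apply: ler_sum => k _.
  by have /andP[] := hterm N (p + k)%N _ N0 (frozen_range N (p + k)).
have E0 : 0 < E.
  apply: lt_le_trans Ew; apply: mulr_gt0 => //.
  rewrite (bigD1 (Ordinal n0))//= ltr_pwDl//; first by rewrite !powR_gt0.
  by apply: sumr_ge0 => k _; exact: powR_ge0.
have r0 : 0 < N%:R `^ (- e0) :> R by exact: powR_gt0.
have Krl : L.+1%:R <= L.+2%:R * (Kr + 1).
  have a : 0 <= L.+2%:R * Kr by apply: mulr_ge0 => //; exact: ltW.
  by rewrite mulrDr mulr1 -[L.+2%:R]natr1; rewrite -[L.+2%:R]natr1 in a; lra.
split => //.
  have a : `|(n2 (2 * N) i)%:R - 2 * n%:R| <= L.+1%:R :> R.
    have b1 : (2 * n)%:R <= (n2 (2 * N) i + L.+1)%:R :> R by rewrite ler_nat; move: q1; clear; lia.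
    have b2 : (n2 (2 * N) i)%:R <= (2 * n + L.+1)%:R :> R by rewrite ler_nat.
    rewrite natrD natrM in b1; rewrite natrD natrM in b2.
    by rewrite ler_distl lerBlDr b1 b2.
  apply: (le_trans a); rewrite -mulrA -[leLHS]mulr1; apply: ler_pM => //.
  apply: (@le_trans _ _ (N%:R `^ (- e0) * N%:R `^ (1 - e0))).
    rewrite -gt0_powRD// -[leLHS](powRr0 N%:R); apply: ler_powR => //; lra.
  by apply: ler_wpM2l; [exact: ltW|lra].
move=> h om hom.
pose F j := cst beta * nrm (Gk (2 * N) j (frozen_even (2 * N) j)) `^ beta.
pose a k := cst beta * nrm (Gk N k (frozen N k)) `^ beta.
have FE j : (j <= 2 * N)%N -> F j = 2 `^ (- (beta * frozen N j./2)) * a j./2.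
  move=> jN; rewrite /F frozen_double//.
  exact: (double_term beta alpha1 h1a h12 h21 L2 j j./2 N0 (frozen_range N j./2)).
have a0 k : 0 <= a k.
  have /andP[u _] := hterm N k _ N0 (frozen_range N k); apply: le_trans u.
  by apply: (mulr_ge0 (ltW kap0)); exact: powR_ge0.
have kN k : (k < n)%N -> (2 * (p + k) <= 2 * N)%N /\ ((2 * (p + k)).+1 <= 2 * N)%N.
  by move: pn L2; clear => ? ? ?; split; lia.
have FE2 k : (k < n)%N -> F (2 * (p + k))%N + F (2 * (p + k)).+1 =
    2 * (2 `^ (- (beta * frozen N (p + k))) * a (p + k)%N).
  move=> kn; have [u1 u2] := kN k kn; rewrite (FE _ u1) (FE _ u2).
  have -> : ((2 * (p + k)).+1./2 = p + k)%N by clear; lia.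
  have -> : ((2 * (p + k))./2 = p + k)%N by clear; lia.
  by rewrite mulr_natl mulr2n.
exists (\sum_(k < n) (F (2 * (p + k))%N + F (2 * (p + k)).+1)); split.
- rewrite [leLHS]mulrCA /E /mean_sum !mulr_sumr; apply: ler_sum => k _.
  rewrite FE2//; apply: ler_wpM2l => //; apply: ler_wpM2r; first exact: a0.
  apply: ler_powR; rewrite ?ler1n// lerN2; apply: ler_wpM2l; first exact: ltW.
  by have := hom k (ltn_ord k); rewrite ler_distl => /andP[].
- rewrite [leRHS]mulrCA /E /mean_sum !mulr_sumr; apply: ler_sum => k _.
  rewrite FE2//; apply: ler_wpM2l => //; apply: ler_wpM2r; first exact: a0.
  apply: ler_powR; rewrite ?ler1n// lerN2; apply: ler_wpM2l; first exact: ltW.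
  by have := hom k (ltn_ord k); rewrite ler_distl => /andP[].
have -> : mean_sum alpha beta L (frozen_even (2 * N)) (2 * N) (p2 (2 * N) i) (n2 (2 * N) i) =
    \sum_(p2 (2 * N) i <= j < p2 (2 * N) i + n2 (2 * N) i) F j by rewrite sum_nat_shift.
have hlf : (2 * N)./2 = N by rewrite mul2n doubleK.
have [_ /(_ i inc) [x0 y1 xy _]] := fam NNb.
have y0 : 0 <= y N i.
  by apply: (le_trans x0); rewrite -subr_ge0; apply: le_trans xy; apply: mulr_ge0 => //; exact: ltW.
have d12 : (p2 (2 * N) i <= 2 * p <= (p2 (2 * N) i).+1)%N.
  by rewrite /p2 hlf; exact: first_index_double.
have [|d3 d4] := @end_index_double R L N (y N i) y0; first by move: LN L2; clear; lia.
rewrite -pE -q3 in d3 d4.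
pose M := K2 * (2 * N%:R `^ (e0 - 1) * \sum_(k < n) w (p + k)%N).
apply: (@le_trans _ _ (L.+2%:R * M)); last first.
  rewrite -!mulrA; apply: ler_wpM2l => //.
  have s1 : N%:R `^ (e0 - 1) <= N%:R `^ (- e0) :> R by apply: ler_powR => //; lra.
  have s2 : \sum_(k < n) w (p + k)%N <= E / kap by rewrite ler_pdivlMr// mulrC.
  have s0 : 0 <= \sum_(k < n) w (p + k)%N by apply: sumr_ge0 => k _; exact: powR_ge0.
  apply: (@le_trans _ _ (Kr * (N%:R `^ (- e0) * E))); last first.
    by apply: ler_wpM2r; [apply: mulr_ge0; exact: ltW|rewrite lerDl].
  have -> : Kr * (N%:R `^ (- e0) * E) = K2 * (2 * N%:R `^ (- e0) * (E / kap)).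
    by rewrite /Kr; field; rewrite gt_eqF.
  apply: (ler_wpM2l (ltW K20)); apply: ler_pM => //; exact: ler_wpM2l.
apply: sum_edges => //.
move=> j /andP[jp je].
have jN : (j <= 2 * N)%N by move: je q4 pn L2; rewrite /maxn; case: ifP; clear; lia.
have hj : (j./2 <= N)%N by move: jN; clear; lia.
rewrite FE//; apply/andP; split; first by apply: mulr_ge0; [exact: powR_ge0|exact: a0].
have pj : (p <= j./2 + L + 1)%N by move: jp d12; clear; lia.
have jpn : (j./2 <= p + n + L + 1)%N by move: je d4; rewrite /maxn; case: ifP; clear; lia.
have /andP[_ u] := hterm N j./2 _ N0 (frozen_range N j./2).
apply: (@le_trans _ _ (a j./2)).
  apply: ler_piMl; first exact: a0.
  have /andP[v1 _] := frozen_range N j./2.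
  have v0 : 0 <= frozen N j./2 by apply: le_trans v1; apply: ltW; apply: lt_trans h1a; rewrite invr_gt0; exact: lt_trans alpha1.
  rewrite -[leRHS](powRr0 2); apply: ler_powR; rewrite ?ler1n// oppr_le0.
  by apply: mulr_ge0 => //; exact: ltW.
apply: (le_trans u); apply: (ler_wpM2l (ltW K20)).
apply: hdom => //; move: pn L2; clear; lia.
Qed.

(** Concentration at the levels N and 2N, the comparison of the two means, and
    the oscillation c |J|^rho of [H] over a cell J, put together by
    [ratio_bound]. *)
Lemma estimator_rate : exists2 C : R, 0 <= C & {ae P, forall w, exists N1 : nat,
  forall N i t, (N1 <= N)%N -> (i < nc N)%N -> x N i <= t <= y N i ->
  `|hurst_est L beta (fun s => lmsm X H s w) N `[x N i, y N i] - H t|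
     <= c * (y N i - x N i) `^ rho + C * N%:R `^ (- e0)}.
Proof.
have beta4' := beta4; have e064' := e064; have e00' := e00; have alpha2' := alpha2; have h12' := h12; have h21' := h21.
have a0 : 0 < alpha by exact: lt_trans alpha1.
have ai : 2^-1 <= alpha^-1 by rewrite lef_pV2 ?posrE.
have h12a : 2^-1 <= h1 by exact/ltW/(le_lt_trans ai).
have rho0 : 0 < rho by have h2rho' := h2rho; lra.
have [K K1 [Nm hm]] := mean_sum_double.
have [Nc hc] := cell_indices.
have cv0 : 0 <= c * L.+1%:R `^ rho by apply: (mulr_ge0 c0); exact: powR_ge0.
have K0 : 0 < K by exact: lt_le_trans K1.
have [|Nk hk] := @powR_small R e0 (2 * K)^-1 e00; first by rewrite invr_gt0 mulr_gt0.
have fr2 N k : h1 <= frozen_even N k <= h2 by exact: frozen_range.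
have fam1 N : (Nc + Nb <= N)%N -> (nc N)%:R <= (N%:R : R) `^ e0 /\
    forall i, (i < nc N)%N -> (p1 N i + n1 N i + L <= N.+1)%N /\ (N%:R : R) `^ (1 - e0) + 1 <= (n1 N i)%:R.
  move=> NN; have [NNc NNb] : (Nc <= N)%N /\ (Nb <= N)%N by move: NN; clear => ?; split; lia.
  split; first by have [] := fam NNb.
  by move=> i inc; have [_ _ hn [_ pn _] _] := hc N i NNc inc.
have fam2 N : (2 * (Nc + Nb) <= N)%N -> (nc2 N)%:R <= (N%:R : R) `^ e0 /\
    forall i, (i < nc2 N)%N -> (p2 N i + n2 N i + L <= N.+1)%N /\ (N%:R : R) `^ (1 - e0) + 1 <= (n2 N i)%:R.
  move=> NN; rewrite /nc2; case: (boolP (odd N)) => oN; first by split => //; exact: powR_ge0.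
  have EN : N = (2 * N./2)%N by rewrite mul2n even_halfK.
  have [NNc NNb] : (Nc <= N./2)%N /\ (Nb <= N./2)%N by move: NN; clear => ?; split; lia.
  split.
    have [h _] := fam NNb; apply: (le_trans h); apply: ge0_ler_powR; rewrite ?nnegrE ?(ltW e00)//.
    by rewrite ler_nat; clear; lia.
  by move=> i inc; have [_ _ _ _ [_ _ _]] := hc N./2 i NNc inc; rewrite -EN.
have conc1 := level_concentration alpha1 alpha2 hI hX h1a h12 h21 beta0 beta4 L2 Lbeta hH c0 h2rho rho1 hHol
   cv0 frozen_range frozen_close e00 e064 e0b fam1.
have conc2 := level_concentration alpha1 alpha2 hI hX h1a h12 h21 beta0 beta4 L2 Lbeta hH c0 h2rho rho1 hHol
   cv0 fr2 frozen_even_close e00 e064 e0b fam2.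
exists (8 * K / (beta * ln 2)).
  by apply: divr_ge0; [apply: mulr_ge0 => //; exact: ltW|apply: mulr_ge0; [exact: ltW|rewrite ln_ge0// ler1n]].
apply: filterS2 conc1 conc2 => w [Na ha] [Nb' hb].
exists (Na + Nb' + Nm + Nk + Nc + 1)%N => N i t NN inc ht.
have [[NNa NNb' NNm] [NNk NNc N0]] : [/\ (Na <= N)%N, (Nb' <= 2 * N)%N & (Nm <= N)%N] /\ [/\ (Nk <= N)%N, (Nc <= N)%N & (0 < N)%N].
  by move: NN; clear => ?; split; split; lia.
have Nr0 : 0 < N%:R :> R by rewrite ltr0n.
have r0 : 0 < N%:R `^ (- e0) :> R by exact: powR_gt0.
have [NNb LN hn [pE pn n0] [q1 q2 q3 q4 _]] := hc N i NNc inc.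
have [E0 nn2 hB] := hm N i NNm inc.
have [_ /(_ i inc) [x0 y1 xy om1]] := fam NNb.
have y0 : 0 <= y N i.
  by apply: (le_trans x0); rewrite -subr_ge0; apply: le_trans xy; apply: mulr_ge0 => //; exact: ltW.
have om0 : 0 <= c * (y N i - x N i) `^ rho by apply: (mulr_ge0 c0); exact: powR_ge0.
have /andP[ht1 ht2] := ht.
have t01 : 0 <= t <= 1 by rewrite (le_trans x0 ht1) (le_trans ht2 y1).
have /andP[Ht1 Ht2] := hH t01.
have hom k : (k < n1 N i)%N -> `|frozen N (p1 N i + k) - H t| <= c * (y N i - x N i) `^ rho.
  move=> kn; rewrite /frozen.
  have kN : (p1 N i + k <= N)%N by move: pn kn L2; clear; lia.
  rewrite (minn_idPl kN); apply: (le_trans (hHol (ratio01 kN) t01)); apply: (ler_wpM2l c0).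
  apply: ge0_ler_powR; rewrite ?nnegrE ?(ltW rho0)//; first by rewrite subr_ge0 (le_trans ht1).
  have k1 : x N i <= (p1 N i + k)%:R / N%:R.
    by rewrite ler_pdivlMr// -nceil_le ?mulr_ge0// /p1 leq_addr.
  have k2 : (p1 N i + k)%:R / N%:R <= y N i.
    rewrite ler_pdivrMr// -truncn_lt ?mulr_ge0//.
    have : (p1 N i + k < end_index L N (y N i))%N by rewrite -pE ltn_add2l.
    by rewrite /end_index leq_min => /andP[].
  by apply: dist_between => //; rewrite k1.
have [B [B1 B2 B3]] := hB (H t) _ hom.
have hlf : (2 * N)./2 = N by rewrite mul2n doubleK.
have inc2 : (i < nc2 (2 * N))%N by rewrite /nc2 mul2n odd_double -mul2n hlf.
have C1 := ha N i NNa inc.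
have C2 := hb (2 * N)%N i NNb' inc2.
have N20 : (0 < 2 * N)%N by rewrite muln_gt0.
have pv M z (a := first_index M (x N i)) (m := (end_index L M (y N i) - a)%N) : (0 < M)%N ->
    (a + m = end_index L M (y N i))%N ->
    power_variation L beta z M `[x N i, y N i] = m%:R^-1 * \sum_(k < m) `|gen_increment L z M (a + k)| `^ beta.
  move=> M0 am; rewrite /power_variation card_nu// -/a -/m; congr (_ * _).
  rewrite (sum_nu L (fun k => `|gen_increment L z M k| `^ beta) M0 x0 y0) -/a -am.
  exact: sum_nat_shift.
rewrite /hurst_est.
rewrite (pv N _ N0) -/(p1 N i) -/(n1 N i)//.
have p2E : p2 (2 * N) i = first_index (2 * N) (x N i) by rewrite /p2 hlf.
have n2E : n2 (2 * N) i = (end_index L (2 * N) (y N i) - first_index (2 * N) (x N i))%N by rewrite /n2 p2E hlf.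
rewrite (pv (2 * N)%N _ N20); last by rewrite -n2E -p2E.
rewrite -n2E -p2E.
have C2' : `|\sum_(k < n2 (2 * N) i) `|gen_increment L (fun s => lmsm X H s w) (2 * N) (p2 (2 * N) i + k)| `^ beta
    - mean_sum alpha beta L (frozen_even (2 * N)) (2 * N) (p2 (2 * N) i) (n2 (2 * N) i)|
  <= N%:R `^ (- e0) * mean_sum alpha beta L (frozen_even (2 * N)) (2 * N) (p2 (2 * N) i) (n2 (2 * N) i).
  apply: (le_trans C2); apply: ler_wpM2r.
    by apply: sumr_ge0 => k _; apply: mulr_ge0; [exact/ltW/mean_cst_gt0|exact: powR_ge0].
  rewrite !powRN lef_pV2 ?posrE ?powR_gt0 ?ltr0n//.
  apply: ge0_ler_powR; rewrite ?nnegrE ?(ltW e00)// ler_nat; clear; lia.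
have Kr : K * N%:R `^ (- e0) <= 2^-1.
  have := hk N NNk; rewrite invfM => u.
  by rewrite mulrC -ler_pdivlMr// mulrC; apply: (le_trans u); rewrite mulrC.
have nr0 : 0 < (n1 N i)%:R :> R by rewrite ltr0n.
have hbeta : 0 < beta <= 4^-1 by rewrite beta0.
have hHt : 2^-1 <= H t <= 1 by rewrite (le_trans h12a Ht1) (le_trans Ht2 (ltW h21)).
have hom1 : 0 <= c * (y N i - x N i) `^ rho <= 1 by rewrite om0.
move: C1 C2' nn2 B1 B2 B3 E0 nr0 Kr.
move: (mean_sum _ _ _ (frozen_even _) _ _ _) (mean_sum _ _ _ (frozen N) _ _ _) => E2 E1.
move: (\sum_(k < n2 (2 * N) i) _) (\sum_(k < n1 N i) _) => S2 S1.
move: (n1 N i)%:R (n2 (2 * N) i)%:R => m1 m2.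
move=> C1 C2' nn2 B1 B2 B3 E0 nr0 Kr.
exact: (ratio_bound hbeta hHt hom1 K1 (ltW r0) Kr E0 nr0 C1 C2' B1 B2 B3 nn2).
Qed.

End estimator_rate.

(** * Cells of logarithmic length *)

Section theta.
Context {R : realType}.
Variable L : nat.

(** With [Llog2N_small], this shows that kappa0 / log N is the dominant term of
    theta. *)
Lemma ln_large (a : R) : exists N1 : nat, forall N, (N1 <= N)%N -> a <= ln (N%:R : R).
Proof.
exists (Num.truncn (expR a)).+1 => N hN.
have h : expR a <= N%:R by apply: (le_trans (ltW (truncnS_gt _))); rewrite ler_nat.
by rewrite -[leLHS]expRK ler_ln ?posrE ?expR_gt0// (lt_le_trans _ h) ?expR_gt0.
Qed.

Lemma Llog2N_small (e : R) : 0 < e -> exists N1 : nat, forall N, (N1 <= N)%N ->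
  Llog2N R L N * ln (N%:R : R) <= e.
Proof.
move=> e0; pose K : R := L.+1%:R * 6 ^+ 3.
have K0 : 0 < K by rewrite mulr_gt0 ?exprn_gt0.
have [||N1 h1] := @powR_small R 2^-1 (e / K); [by rewrite invr_gt0|by rewrite divr_gt0|].
exists N1.+1 => N hN; have N0 : (0 < N)%N by exact: leq_trans hN.
have Nr : 0 < N%:R :> R by rewrite ltr0n.
have l0 : 0 <= ln N%:R :> R by rewrite ln_ge0// ler1n.
have ll : ln N%:R <= 6 * N%:R `^ 6^-1 :> R.
  by have := @ln_le_powR R N 6^-1; rewrite invrK; apply; rewrite ?invr_gt0.
have l3 : ln N%:R ^+ 3 <= 6 ^+ 3 * N%:R `^ 2^-1 :> R.
  have -> : N%:R `^ 2^-1 = (N%:R `^ 6^-1) ^+ 3 :> R.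
    by rewrite -powR_mulrn ?powR_ge0// -powRrM; congr (_ `^ _); field.
  by rewrite -exprMn; apply: lerXn2r; rewrite ?nnegrE.
have -> : Llog2N R L N * ln N%:R = L.+1%:R * (N%:R^-1 * ln N%:R ^+ 3) by rewrite /Llog2N; ring.
apply: (@le_trans _ _ (L.+1%:R * (N%:R^-1 * (6 ^+ 3 * N%:R `^ 2^-1)))).
  by apply: ler_wpM2l => //; apply: ler_wpM2l => //; rewrite invr_ge0.
have -> : N%:R^-1 * (6 ^+ 3 * N%:R `^ 2^-1) = 6 ^+ 3 * N%:R `^ (- 2^-1) :> R.
  rewrite -powR_inv1// mulrCA -gt0_powRD//; congr (_ * _ `^ _); by field.
rewrite mulrA -/K mulrC -ler_pdivlMr//; apply: h1; exact: ltnW.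
Qed.

Lemma Llog2N_ge0 N : 0 <= Llog2N R L N.
Proof. by rewrite /Llog2N mulr_ge0 ?sqr_ge0// mulr_ge0// invr_ge0. Qed.

(** The definition of [N0] by choice is meaningful because its condition holds for
    large N, hence for a least N. *)
Lemma kappa0_gt0 : 0 < kappa0 R L.
Proof.
have [N1 h1] := @Llog2N_small 9^-1 (ltac:(by rewrite invr_gt0)).
have [N2 h2] := ln_large 1.
pose N := (N1 + N2).+2.
have hN : N0_cond R L N.
  have g1 : Llog2N R L N * ln (N%:R : R) <= 9^-1 by apply: h1; rewrite /N; clear; lia.
  have g2 : 1 <= ln (N%:R : R) by apply: h2; rewrite /N; clear; lia.
  have p : 0 < Llog2N R L N.
    by rewrite /Llog2N !mulr_gt0 ?exprn_gt0 ?invr_gt0 ?ltr0n// (lt_le_trans _ g2).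
  rewrite /N0_cond; apply/andP; split; first by rewrite mulr_gt0.
  rewrite -ler_pdivlMl// mulr1; apply: le_trans g1; by rewrite ler_peMr// ltW.
have [M [M1 M2]] : exists M : nat, N0_cond R L M /\ forall M', N0_cond R L M' -> (M <= M')%N.
  have ex : exists M, N0_cond R L M by exists N.
  by case: (ex_minnP ex) => M a1 a2; exists M.
have [+ _] : [set N : nat | N0_cond R L N /\ forall M : nat, N0_cond R L M -> (N <= M)%N] (N0 R L).
  by rewrite /N0; apply: (@xgetPex _ 0%N); exists M.
rewrite /N0_cond => /andP[h _]; rewrite /kappa0 mulr_gt0 ?invr_gt0//.
by rewrite pmulr_rgt0 in h.
Qed.

Lemma theta_bounds : exists N1 : nat, forall N, (N1 <= N)%N ->
  [/\ 1 <= ln (N%:R : R), kappa0 R L / ln N%:R <= theta R L N & theta R L N <= 2 * kappa0 R L / ln N%:R].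
Proof.
have k0 := kappa0_gt0.
have [|N1 h1] := @Llog2N_small (kappa0 R L / 4); first by rewrite divr_gt0.
have [N2 h2] := ln_large 1.
exists (N1 + N2)%N => N hN.
have [n1 n2] : (N1 <= N)%N /\ (N2 <= N)%N by move: hN; clear => ?; split; lia.
have l1 := h2 _ n2; have l0 : 0 < ln (N%:R : R) by exact: lt_le_trans l1.
split => //; rewrite /theta.
  by rewrite lerDl mulr_ge0// Llog2N_ge0.
have -> : 2 * kappa0 R L / ln N%:R = kappa0 R L / ln N%:R + kappa0 R L / ln N%:R by field; rewrite gt_eqF.
rewrite lerD2l ler_pdivlMr//; have := h1 _ n1; lra.
Qed.

Lemma theta_small (e : R) : 0 < e -> exists N1 : nat, forall N, (N1 <= N)%N ->
  0 < theta R L N <= e.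
Proof.
move=> e0; have k0 := kappa0_gt0; have [N1 h1] := theta_bounds.
have [N2 h2] := ln_large (2 * kappa0 R L / e).
exists (N1 + N2)%N => N hN.
have [n1 n2] : (N1 <= N)%N /\ (N2 <= N)%N by move: hN; clear => ?; split; lia.
have [l1 t1 t2] := h1 _ n1; have l0 : 0 < ln (N%:R : R) by exact: lt_le_trans l1.
apply/andP; split; first by apply: lt_le_trans t1; rewrite divr_gt0.
apply: (le_trans t2); rewrite ler_pdivrMr// -ler_pdivrMl// mulrC; exact: h2.
Qed.

Lemma theta_powR (e : R) : 0 < e -> exists N1 : nat, forall N, (N1 <= N)%N ->
  2 * (N%:R : R) `^ (- e) <= theta R L N.
Proof.
move=> e0; have k0 := kappa0_gt0; have [N1 h1] := theta_bounds.
have e20 : 0 < e / 2 by rewrite divr_gt0.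
have [|N2 h2] := @powR_small R (e / 2) (kappa0 R L * e / 4) e20; first by rewrite divr_gt0// mulr_gt0.
exists (N1 + N2).+1 => N hN.
have [n1 n2 N0] : [/\ (N1 <= N)%N, (N2 <= N)%N & (0 < N)%N] by move: hN; clear => ?; split; lia.
have [l1 t1 t2] := h1 _ n1; have l0 : 0 < ln (N%:R : R) by exact: lt_le_trans l1.
have Nr : 0 < N%:R :> R by rewrite ltr0n.
apply: le_trans t1; rewrite ler_pdivlMr//.
apply: (@le_trans _ _ (2 * N%:R `^ (- e) * ((e / 2)^-1 * N%:R `^ (e / 2)))).
  by apply: ler_wpM2l; [apply: mulr_ge0 => //; exact: powR_ge0|exact: ln_le_powR].
have -> : 2 * N%:R `^ (- e) * ((e / 2)^-1 * N%:R `^ (e / 2)) = 4 / e * N%:R `^ (- (e / 2)) :> R.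
  have -> : N%:R `^ (- (e / 2)) = N%:R `^ (- e) * N%:R `^ (e / 2) :> R.
    by rewrite -gt0_powRD//; congr (_ `^ _); field.
  by field; rewrite gt_eqF.
rewrite mulrC -ler_pdivlMr ?divr_gt0//; apply: (le_trans (h2 _ n2)).
by rewrite invf_div mulrA.
Qed.

End theta.

Section cells.
Context {R : realType}.
Implicit Types th t : R.

Definition cell_left th (i : nat) : R := i%:R * th.
Definition cell_right th (i : nat) : R := if (i < (ncells th).-1)%N then i.+1%:R * th else 1.

Lemma cellE th i : cell th i = `[cell_left th i, cell_right th i].
Proof. by rewrite /cell /cell_left /cell_right; case: ifP. Qed.

Lemma ncells_bounds th : 0 < th -> (ncells th)%:R * th <= 1 < (ncells th).+1%:R * th.
Proof.
move=> t0; rewrite -ler_pdivlMr// -ltr_pdivrMr// mul1r truncnS_gt andbT.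
by rewrite -truncn_lt// invr_ge0 ltW.
Qed.

Lemma ncells_gt0 th : 0 < th <= 1 -> (0 < ncells th)%N.
Proof.
by move=> /andP[t0 t1]; rewrite /ncells truncn_gt0 invf_ge1.
Qed.

(** The last cell absorbs the remainder, and is shorter than two ordinary cells. *)
Lemma cell_geometry th i : 0 < th -> (i < ncells th)%N ->
  [/\ 0 <= cell_left th i, cell_right th i <= 1 &
    th <= cell_right th i - cell_left th i <= 2 * th].
Proof.
move=> t0 hi; have /andP[b1 b2] := ncells_bounds t0.
rewrite /cell_left /cell_right; split.
- by apply: mulr_ge0 => //; exact: ltW.
- case: ifP => // h; apply: le_trans b1; rewrite ler_pM2r// ler_nat.
  by move: h; clear; lia.
case: ifP => h.
  by rewrite -natr1; apply/andP; split; lra.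
have e : ncells th = i.+1 by move: h hi; clear; lia.
rewrite e -!natr1 in b1 b2; rewrite -?natr1; apply/andP; split; lra.
Qed.

End cells.

(** * Hoelder norm of the interpolated error *)

Section hoelder.
Context {R : realType}.
Variables (th c rho b D : R) (e : nat -> R) (H : R -> R).
Hypotheses (th0 : 0 < th) (th1 : th <= 1) (c0 : 0 <= c) (b0 : 0 < b) (brho : b < rho) (b1 : b <= 1).
Hypothesis hHol : forall t1 t2, 0 <= t1 <= 1 -> 0 <= t2 <= 1 -> `|H t1 - H t2| <= c * `|t1 - t2| `^ rho.
Hypothesis he : forall i t, (i < ncells th)%N -> cell_left th i <= t <= cell_right th i -> `|e i - H t| <= D.

Let last := (ncells th).-1.

Definition interpolant (t : R) : R :=
  if last%:R * th <= t then e last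
  else (1 - th^-1 * (t - (Num.truncn (t / th))%:R * th)) * e (Num.truncn (t / th))
    + th^-1 * (t - (Num.truncn (t / th))%:R * th) * e (Num.truncn (t / th)).+1.

Lemma last_bounds : [/\ (0 < ncells th)%N, (last < ncells th)%N, ncells th = last.+1,
  last.+1%:R * th <= 1 & 1 < last.+2%:R * th].
Proof.
have n0 : (0 < ncells th)%N by apply: ncells_gt0; rewrite th0.
have E : ncells th = last.+1 by rewrite /last prednK.
have /andP[h1 h2] := ncells_bounds th0.
by split; rewrite ?E// -?E.
Qed.

Lemma before_last t : 0 <= t -> t < last%:R * th ->
  let n := Num.truncn (t / th) in
  [/\ (n < last)%N, n%:R * th <= t < n.+1%:R * th & exists2 u, 0 <= u <= 1 & u * th = t - n%:R * th /\ interpolant t = e n + u * (e n.+1 - e n)].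
Proof.
move=> t0 tl n; have q0 : 0 <= t / th by rewrite divr_ge0// ltW.
have n1 : n%:R * th <= t by rewrite -ler_pdivlMr// -truncn_lt.
have n2 : t < n.+1%:R * th by rewrite -ltr_pdivrMr// truncnS_gt.
have nl : (n < last)%N by rewrite -(ltr_nat R) -(ltr_pM2r th0) (le_lt_trans n1).
split => //; first by rewrite n1.
exists (th^-1 * (t - n%:R * th)).
  rewrite mulr_ge0 ?invr_ge0 ?subr_ge0 ?(ltW th0)//= mulrC ler_pdivrMr// mul1r.
  rewrite -natr1 mulrDl in n2; lra.
split; first by rewrite mulrAC mulVf ?mul1r// gt_eqF.
by rewrite /interpolant leNgt tl/= -/n; ring.
Qed.

Lemma cell_rightE i : (i < last)%N -> cell_right th i = i.+1%:R * th.
Proof. by move=> h; rewrite /cell_right -/last h. Qed.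

Lemma cell_right_last : cell_right th last = 1.
Proof. by rewrite /cell_right -/last ltnn. Qed.

(** Consecutive cells share an endpoint, where both estimates are close to [H]. *)
Lemma est_step i : (i < last)%N -> `|e i.+1 - e i| <= 2 * D.
Proof.
move=> il; have [_ l1 E _ _] := last_bounds.
have k1 : `|e i - H (i.+1%:R * th)| <= D.
  apply: he; first by rewrite E; exact: leqW.
  by rewrite cell_rightE// lexx andbT ler_pM2r// ler_nat.
have k2 : `|e i.+1 - H (i.+1%:R * th)| <= D.
  apply: he; first by rewrite E.
  rewrite lexx/=; case: (ltnP i.+1 last) => h.
    by rewrite cell_rightE// ler_pM2r// ler_nat.
  have -> : i.+1 = last by apply/eqP; rewrite eqn_leq il h.
  rewrite cell_right_last; have [_ _ _ h2 _] := last_bounds.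
  by apply: le_trans h2; rewrite ler_pM2r// ler_nat.
rewrite (_ : _ - _ = (e i.+1 - H (i.+1%:R * th)) - (e i - H (i.+1%:R * th))); last by ring.
apply: (le_trans (ler_normB _ _)); lra.
Qed.

Lemma D_ge0 : 0 <= D.
Proof.
have [n0 l1 E _ _] := last_bounds.
apply: (le_trans (normr_ge0 (e last - H 1))); apply: he => //.
rewrite cell_right_last lexx andbT; have [_ _ _ h _] := last_bounds.
by apply: le_trans h; rewrite ler_pM2r// ler_nat.
Qed.

Lemma interpolant_error t : 0 <= t <= 1 -> `|interpolant t - H t| <= D + c * th `^ rho.
Proof.
move=> /andP[t0 t1]; have [n0 l1 E h1 h2] := last_bounds.
have cp : 0 <= c * th `^ rho by apply: (mulr_ge0 c0); exact: powR_ge0.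
have [tl|tl] := leP (last%:R * th) t.
  rewrite /interpolant tl; apply: (@le_trans _ _ D); last by rewrite lerDl.
  by apply: he => //; rewrite cell_right_last tl.
have [nl /andP[m1 m2] [u /andP[u0 u1] [_ ->]]] := before_last t0 tl.
set n := Num.truncn _ in nl m1 m2 *.
have k1 : `|e n - H t| <= D.
  apply: he; first by rewrite E; exact: leqW.
  by rewrite cell_rightE// m1 ltW.
have k2 : `|e n.+1 - H (n.+1%:R * th)| <= D.
  apply: he; first by rewrite E.
  rewrite lexx/=; case: (ltnP n.+1 last) => h.
    by rewrite cell_rightE// ler_pM2r// ler_nat.
  have -> : n.+1 = last by apply/eqP; rewrite eqn_leq nl h.
  by rewrite cell_right_last; apply: le_trans h1; rewrite ler_pM2r// ler_nat.
have k3 : `|H (n.+1%:R * th) - H t| <= c * th `^ rho.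
  apply: (le_trans (hHol _ _)).
  - apply/andP; split; first by apply: mulr_ge0 => //; exact: ltW.
    by apply: le_trans h1; rewrite ler_pM2r// ler_nat ltnW.
  - by rewrite t0.
  apply: (ler_wpM2l c0); apply: ge0_ler_powR; rewrite ?nnegrE ?(ltW th0)//.
    by rewrite ltW// (lt_trans b0).
  rewrite -natr1 mulrDl in m2 *; rewrite ger0_norm; lra.
have -> : e n + u * (e n.+1 - e n) - H t = (1 - u) * (e n - H t) + u * ((e n.+1 - H (n.+1%:R * th)) + (H (n.+1%:R * th) - H t)) by ring.
apply: (le_trans (ler_normD _ _)); rewrite !normrM (ger0_norm u0) ger0_norm ?subr_ge0//.
have k4 : `|e n.+1 - H (n.+1%:R * th) + (H (n.+1%:R * th) - H t)| <= D + c * th `^ rho.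
  exact: (le_trans (ler_normD _ _) (lerD k2 k3)).
have k5 : `|e n - H t| <= D + c * th `^ rho by apply: (le_trans k1); rewrite lerDl.
have u1' : 0 <= 1 - u by rewrite subr_ge0.
have := lerD (ler_wpM2l u1' k5) (ler_wpM2l u0 k4); rewrite -mulrDl subrK mul1r; exact.
Qed.

(** The slopes are at most 2 D / th.  An interval shorter than [th] meets at most two
    linear pieces, and the total variation is additive over them. *)
Lemma interpolant_lipschitz t1 t2 : 0 <= t1 -> t1 <= t2 -> t2 <= 1 -> t2 - t1 < th ->
  `|interpolant t1 - interpolant t2| <= 2 * D * ((t2 - t1) / th).
Proof.
move=> t10 t12 t21 tt; have D0 := D_ge0.
have D20 : 0 <= 2 * D by exact: mulr_ge0.
have tau0 : 0 <= (t2 - t1) / th by rewrite divr_ge0 ?subr_ge0// ltW.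
have [h1|h1] := leP (last%:R * th) t1.
  rewrite /interpolant h1 (le_trans h1 t12) subrr normr0; exact: mulr_ge0.
have [n1l /andP[a1 a2] [u1 /andP[u10 u11] [u1E ->]]] := before_last t10 h1.
set n1 := Num.truncn _ in n1l a1 a2 u1E *.
have s1 := est_step n1l.
have tn : t2 < n1.+2%:R * th.
  by rewrite -[n1.+2%:R]natr1 mulrDl mul1r; lra.
have [h2|h2] := leP (last%:R * th) t2.
  have E : n1.+1 = last.
    have : (last < n1.+2)%N by rewrite -(ltr_nat R) -(ltr_pM2r th0) (le_lt_trans h2).
    by move: n1l; clear; lia.
  rewrite /interpolant h2 -E.
  have -> : e n1 + u1 * (e n1.+1 - e n1) - e n1.+1 = - ((1 - u1) * (e n1.+1 - e n1)) by ring.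
  rewrite normrN normrM ger0_norm ?subr_ge0// mulrC; apply: ler_pM => //; rewrite ?subr_ge0//.
  rewrite ler_pdivlMr// mulrBl u1E; rewrite -E -natr1 mulrDl in h2; lra.
have t20 := le_trans t10 t12.
have [n2l /andP[c1 c2] [u2 /andP[u20 u21] [u2E ->]]] := before_last t20 h2.
set n2 := Num.truncn _ in n2l c1 c2 u2E *.
have n12 : (n1 < n2.+1)%N by rewrite -(ltr_nat R) -(ltr_pM2r th0) (le_lt_trans a1)// (le_lt_trans t12).
have n21 : (n2 < n1.+2)%N by rewrite -(ltr_nat R) -(ltr_pM2r th0) (le_lt_trans c1).
have [E|E] : n2 = n1 \/ n2 = n1.+1 by move: n12 n21; clear; lia.
  rewrite E in u2E *.
  have -> : e n1 + u1 * (e n1.+1 - e n1) - (e n1 + u2 * (e n1.+1 - e n1)) = - ((u2 - u1) * (e n1.+1 - e n1)) by ring.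
  have U : (t2 - t1) / th = u2 - u1 by apply: (canLR (mulfK _)); rewrite ?gt_eqF// mulrBl u1E u2E; ring.
  by rewrite normrN normrM U ger0_norm -?U// mulrC; apply: ler_wpM2r.
have s2 := est_step n2l; rewrite E in u2E s2 *.
have -> : e n1 + u1 * (e n1.+1 - e n1) - (e n1.+1 + u2 * (e n1.+2 - e n1.+1)) =
   - ((1 - u1) * (e n1.+1 - e n1) + u2 * (e n1.+2 - e n1.+1)) by ring.
have U : (t2 - t1) / th = (1 - u1) + u2.
  apply: (canLR (mulfK _)); rewrite ?gt_eqF// mulrDl mulrBl u1E u2E -[n1.+1%:R]natr1; ring.
rewrite normrN U [leRHS]mulrDr; apply: (le_trans (ler_normD _ _)).
rewrite !normrM (ger0_norm u20) ger0_norm ?subr_ge0// ![_ * `|e _ - e _|]mulrC.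
by apply: lerD; apply: ler_wpM2r; rewrite ?subr_ge0.
Qed.

(** For increments longer than [th] the uniform bound suffices, and for shorter ones
    the Lipschitz bound of the interpolant and the Hoelder bound of [H]; in both
    cases the factor th^(-b) is what is lost. *)
Lemma hoelder_norm_interpolant :
  (hoelder_norm b (fun t => interpolant t - H t)%R <= (3 * (D + c * th `^ rho) * th `^ (- b))%:E)%E.
Proof.
have D0 := D_ge0.
have cp : 0 <= c * th `^ rho by apply: (mulr_ge0 c0); exact: powR_ge0.
set D2 := D + c * th `^ rho.
have D20 : 0 <= D2 by exact: addr_ge0.
have thb : 1 <= th `^ (- b).
  rewrite powRN -[leLHS]invr1 lef_pV2 ?posrE ?powR_gt0//.
  have := @ge0_ler_powR R b (ltW b0) th 1; rewrite powR1 !nnegrE; apply => //; exact: ltW.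
have -> : 3 * D2 * th `^ (- b) = D2 * th `^ (- b) + 2 * D2 * th `^ (- b) by ring.
rewrite /hoelder_norm EFinD; apply: leeD.
  apply: ub_ereal_sup => _ [t /= ht <-]; rewrite lee_fin; rewrite in_itv/= in ht.
  apply: (le_trans (interpolant_error ht)); rewrite -/D2.
  by rewrite ler_peMr.
apply: ub_ereal_sup => _ [t1 [t2 [t10 t12 t21 ->]]]; rewrite lee_fin.
have tau0 : 0 < t2 - t1 by rewrite subr_gt0.
rewrite distrC [in X in _ / X]distrC (gtr0_norm tau0) distrC.
have r1 : 0 <= t1 <= 1 by rewrite t10 (le_trans (ltW t12)).
have r2 : 0 <= t2 <= 1 by rewrite t21 (le_trans t10 (ltW t12)).
rewrite ler_pdivrMr ?powR_gt0//.
have [tt|tt] := leP th (t2 - t1).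
  apply: (@le_trans _ _ (2 * D2)).
    have := lerD (interpolant_error r1) (interpolant_error r2); rewrite -/D2 => h.
    apply: (le_trans (ler_normB _ _)); lra.
  rewrite -(mulrA (2 * D2)) ler_peMr ?mulr_ge0//.
  rewrite powRN mulrC ler_pdivlMr ?powR_gt0// mul1r.
  by apply: ge0_ler_powR; rewrite ?nnegrE ?(ltW th0) ?(ltW b0) ?(ltW tau0).
have -> : interpolant t1 - H t1 - (interpolant t2 - H t2) = (interpolant t1 - interpolant t2) - (H t1 - H t2) by ring.
apply: (le_trans (ler_normB _ _)).
have q1 : 0 < (t2 - t1) / th by exact: divr_gt0.
have q2 : (t2 - t1) / th <= 1 by rewrite ler_pdivrMr// mul1r ltW.
have qb : ((t2 - t1) / th) `^ b = th `^ (- b) * (t2 - t1) `^ b.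
  rewrite powRM ?invr_ge0 ?(ltW th0) ?(ltW tau0)// mulrC; congr (_ * _).
  by rewrite -powR_inv1 ?(ltW th0)// -powRrM mulN1r.
have k1 : `|interpolant t1 - interpolant t2| <= 2 * D * (th `^ (- b) * (t2 - t1) `^ b).
  apply: (le_trans (interpolant_lipschitz t10 (ltW t12) t21 tt)).
  apply: ler_wpM2l; first exact: mulr_ge0.
  rewrite -qb -[leLHS]powRr1 ?(ltW q1)//.
  by rewrite /powR gt_eqF// ler_expR; apply: ler_wnM2r => //; apply: ln_le0.
have k2 : `|H t1 - H t2| <= c * th `^ rho * (th `^ (- b) * (t2 - t1) `^ b).
  apply: (le_trans (hHol r1 r2)); rewrite -mulrA; apply: (ler_wpM2l c0).
  rewrite distrC (gtr0_norm tau0) -qb.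
  rewrite [in leLHS](_ : t2 - t1 = th * ((t2 - t1) / th)); last by rewrite mulrC divfK// gt_eqF.
  rewrite powRM ?(ltW th0) ?(ltW q1)//; apply: ler_wpM2l; first exact: powR_ge0.
  rewrite /powR gt_eqF// ler_expR; apply: ler_wnM2r; [exact: ln_le0|exact: ltW].
apply: (le_trans (lerD k1 k2)); rewrite -mulrDl -(mulrA (2 * D2)); apply: ler_wpM2r.
  by apply: mulr_ge0; exact: powR_ge0.
rewrite /D2; lra.
Qed.

End hoelder.

(** * The rate of convergence *)

Lemma powR_le1_small (R : realType) (c rho : R) : 0 <= c -> 0 < rho ->
  exists2 e, 0 < e & forall z, 0 <= z <= e -> c * z `^ rho <= 1.
Proof.
move=> c0 rho0; have c1 : 0 < c + 1 by rewrite ltr_wpDl.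
exists ((c + 1)^-1 `^ rho^-1); first by apply: powR_gt0; rewrite invr_gt0.
move=> z /andP[z0 ze]; apply: (@le_trans _ _ (c * (c + 1)^-1)).
  apply: ler_wpM2l => //.
  have -> : (c + 1)^-1 = ((c + 1)^-1 `^ rho^-1) `^ rho.
    by rewrite -powRrM mulVf ?gt_eqF// powRr1// invr_ge0 ltW.
  by apply: ge0_ler_powR; rewrite ?nnegrE ?powR_ge0 ?(ltW rho0).
by rewrite ler_pdivrMr// mul1r lerDl.
Qed.

Theorem corollary2p2 (R : realType) (d : measure_display)
    (T : measurableType d) (P : probability T R)
    (alpha : R) (halpha : 1 < alpha < 2)
    (Z : set R -> T -> R) (hZ : sas_random_measure P alpha Z)
    (I : (R -> R) -> T -> R) (hI : sas_integral P alpha Z I)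
    (X : R -> R -> T -> R) (hX : lmsm_field P alpha I X)
    (H : R -> R)
    (hHrange : exists h1 h2 : R, [/\ alpha^-1 < h1, h1 <= h2, h2 < 1 &
       forall t : R, t \in `[0, 1] -> H t \in `[h1, h2]])
    (cH rhoH : R)
    (hHoelder : forall t1 t2 : R, t1 \in `[0, 1] -> t2 \in `[0, 1] ->
       `|H t1 - H t2| <= cH * `|t1 - t2| `^ rhoH)
    (hrhoH1 : rhoH <= 1)
    (hrhoHsup : sup [set H t | t in `[0, 1]%classic] < rhoH)
    (beta : R) (hbeta : 0 < beta <= 4^-1)
    (L : nat) (hL2 : (2 <= L)%N) (hL : 2 / beta + 1 < L%:R)
    (b : R) (hb : 0 < b < rhoH / (1 + rhoH)) :
  exists2 kappa : R, 0 < kappa &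
    {ae P, forall w, exists C : R, \forall N \near \oo,
      (hoelder_norm b (fun t =>
          (hurst_est_fun L beta (fun s => lmsm X H s w) N (theta R L N) t
           - H t)%R)
       <= (C * (ln (N%:R : R)) `^ (- kappa))%:E)%E}.
Proof.
have [h1 [h2' [h1a h12' h2'1 hH']]] := hHrange.
have /andP[alpha1 alpha2] := halpha; have /andP[b0 brho'] := hb; have /andP[beta0 beta4] := hbeta.
set h2 := sup _ in hrhoHsup.
have hH'' t : 0 <= t <= 1 -> h1 <= H t <= h2' by move=> ht; have := hH' t; rewrite !in_itv/=; apply.
have ubH : has_ubound [set H t | t in `[0, 1]%classic].
  by exists h2' => _ [t /= ht <-]; rewrite in_itv/= in ht; have /andP[] := hH'' t ht.
have hH t : 0 <= t <= 1 -> h1 <= H t <= h2.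
  move=> ht; have /andP[-> _] := hH'' t ht; apply: ub_le_sup => //.
  by exists t => //=; rewrite in_itv.
have hH0 : h1 <= H 0 <= h2 by apply: hH; rewrite lexx ler01.
have h12 : h1 <= h2 by have /andP[] := hH0; exact: le_trans.
have h21 : h2 < 1.
  apply: le_lt_trans h2'1; apply: ge_sup.
    by exists (H 0), 0 => //=; rewrite in_itv/= lexx ler01.
  by move=> _ [t /= ht <-]; rewrite in_itv/= in ht; have /andP[] := hH'' t ht.
have alpha0 : 0 < alpha by exact: lt_trans alpha1.
have h10 : 0 < h1 by apply: lt_trans h1a; rewrite invr_gt0.
have rho0 : 0 < rhoH by apply: lt_trans hrhoHsup; exact: lt_le_trans h12.
have brho : b < rhoH.
  by apply: (lt_le_trans brho'); rewrite ler_pdivrMr ?addr_gt0// ler_peMr ?(ltW rho0)// lerDl ltW.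
have c0 : 0 <= cH.
  have := hHoelder 0 1; rewrite !in_itv/= !lexx ler01 => /(_ isT isT).
  by rewrite sub0r normrN normr1 powR1 mulr1; exact: le_trans.
have hHol t1 t2 : 0 <= t1 <= 1 -> 0 <= t2 <= 1 -> `|H t1 - H t2| <= cH * `|t1 - t2| `^ rhoH.
  by move=> ht1 ht2; apply: hHoelder; rewrite in_itv.
pose g := beta * ((rhoH - h2) / 2).
have g0 : 0 < g by rewrite mulr_gt0// divr_gt0// subr_gt0.
(* e0 <= 1/64 keeps 9 e0 - 3/2 <= -5/4; the other bound makes the freezing error
   negligible *)
pose e0 := Num.min 64^-1 (g / 2).
have e00 : 0 < e0 by rewrite lt_min; apply/andP; split; [rewrite invr_gt0|exact: divr_gt0].
have e064 : e0 <= 64^-1 by rewrite ge_min lexx.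
have e0b : e0 < g by rewrite gt_min; apply/orP; right; rewrite ltr_pdivrMr// ltr_pMr// ltr1n.
pose th N := theta R L N.
have [ee ee0 hee] := powR_le1_small c0 rho0.
have [|N1 H1] := @theta_small R L (Num.min 1 (ee / 2)); first by rewrite lt_min ltr01 divr_gt0.
have [N2 H2] := @theta_powR R L e0 e00.
have [N3 H3] := @theta_bounds R L.
have fam N : ((N1 + N2).+1 <= N)%N -> (ncells (th N))%:R <= (N%:R : R) `^ e0 /\
  forall i, (i < ncells (th N))%N -> [/\ 0 <= cell_left (th N) i, cell_right (th N) i <= 1,
    2 * (N%:R : R) `^ (- e0) <= cell_right (th N) i - cell_left (th N) i &
    cH * (cell_right (th N) i - cell_left (th N) i) `^ rhoH <= 1].
  move=> hN; have [n1 n2 N0] : [/\ (N1 <= N)%N, (N2 <= N)%N & (0 < N)%N] by move: hN; clear => ?; split; lia.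
  have /andP[th0] := H1 N n1; rewrite le_min => /andP[th1 the].
  have th2 := H2 N n2; rewrite -/(th N) in th0 th1 the th2.
  split.
    have /andP[k1 _] := ncells_bounds th0.
    have p0 : 0 < N%:R `^ e0 :> R by rewrite powR_gt0// ltr0n.
    have k2 : (ncells (th N))%:R * (2 * N%:R `^ (- e0)) <= 1.
      by apply: le_trans k1; apply: ler_wpM2l.
    rewrite powRN mulrA ler_pdivrMr// mul1r in k2.
    by apply: le_trans k2; rewrite ler_peMr// ler1n.
  move=> i hi; have [g1 g2 /andP[g3 g4]] := cell_geometry th0 hi.
  split => //; first exact: le_trans g3.
  apply: hee; rewrite (le_trans (ltW th0) g3) (le_trans g4)//.
  by rewrite mulrC -ler_pdivlMr.
have [C C0 rate] := estimator_rate alpha1 (ltW alpha2) hI hX h1a h12 h21 beta0 beta4 hL2 hL hH c0 hrhoHsup hrhoH1 hHol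
  e00 e064 e0b fam.
exists (rhoH - b); first by rewrite subr_gt0.
apply: filterS rate => w [N4 H4].
pose A := cH * 2 `^ rhoH + C.
have A0 : 0 <= A by apply: addr_ge0 => //; apply: (mulr_ge0 c0); exact: powR_ge0.
exists (3 * (A + cH) * (2 * kappa0 R L) `^ (rhoH - b)).
exists (N1 + N2 + N3 + N4)%N => // N /= hN.
have [[n1 n2] [n3 n4]] : ((N1 <= N)%N /\ (N2 <= N)%N) /\ ((N3 <= N)%N /\ (N4 <= N)%N).
  by move: hN; clear => ?; split; split; lia.
have /andP[th0] := H1 N n1; rewrite le_min => /andP[th1 _].
have th2 := H2 N n2; have [l1 _ th3] := H3 N n3; rewrite -/(th N) in th0 th1 th2 th3 *.
have thr : N%:R `^ (- e0) <= th N `^ rhoH.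
  apply: (@le_trans _ _ (th N)).
    by apply: le_trans th2; rewrite ler_peMl ?powR_ge0// ler1n.
  rewrite -[leLHS](powRr1 (ltW th0)) /powR gt_eqF// ler_expR; apply: ler_wnM2r => //; exact: ln_le0.
have he i t : (i < ncells (th N))%N -> cell_left (th N) i <= t <= cell_right (th N) i ->
    `|hurst_est L beta (fun s => lmsm X H s w) N (cell (th N) i) - H t| <= A * th N `^ rhoH.
  move=> hi ht; rewrite cellE; apply: (le_trans (H4 N i t n4 hi ht)).
  have [_ _ /andP[g3 g4]] := cell_geometry th0 hi.
  rewrite /A mulrDl; apply: lerD; last exact: ler_wpM2l.
  rewrite -mulrA; apply: (ler_wpM2l c0); rewrite -powRM ?(ltW th0)//.
  apply: ge0_ler_powR; rewrite ?nnegrE ?(ltW rho0)//; first exact: (le_trans (ltW th0) g3).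
  by apply: mulr_ge0 => //; exact: ltW.
have hold := hoelder_norm_interpolant th0 th1 c0 b0 brho (ltW (lt_le_trans brho hrhoH1)) hHol he.
apply: (le_trans hold); rewrite lee_fin.
have -> : 3 * (A * th N `^ rhoH + cH * th N `^ rhoH) * th N `^ (- b) = 3 * (A + cH) * th N `^ (rhoH - b).
  rewrite gt0_powRD//; ring.
rewrite -[leRHS]mulrA; apply: ler_wpM2l.
  by apply: mulr_ge0 => //; exact: addr_ge0.
have l0 : 0 < ln (N%:R : R) by exact: lt_le_trans l1.
have k0 := @kappa0_gt0 R L.
have rb : 0 <= rhoH - b by rewrite subr_ge0 ltW.
have -> : ln (N%:R : R) `^ (- (rhoH - b)) = (ln N%:R)^-1 `^ (rhoH - b).
  by rewrite -powR_inv1 ?(ltW l0)// -powRrM mulN1r.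
rewrite -powRM ?invr_ge0 ?(ltW l0)//; last by apply: mulr_ge0 => //; exact: ltW.
apply: ge0_ler_powR; rewrite ?nnegrE ?(ltW th0)//.
by apply: mulr_ge0; rewrite ?invr_ge0 ?(ltW l0)//; apply: mulr_ge0 => //; exact: ltW.
Qed.
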